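(* Let $D\subset\mathbb{R}^2$ be a bounded open set with Lipschitz boundary which is simply connected and has piecewise $C^1$ boundary. Let $\kappa>0$, let $\rho\in L^\infty(D)$ be a positive real-valued function (extended by $\rho=1$ to $\mathbb{R}^2\setminus D$), and let $\mathcal{C}$ be an elastic tensor with $\mathcal{C}=\tilde{\mathcal{C}}$ in $\overline D$ and $\mathcal{C}=\mathcal{C}_0$ in $\mathbb{R}^2\setminus\overline D$ satisfying the standing assumptions listed in the context. Suppose that there exist $x_0\in\partial D$, $\alpha\in(0,1)$ and $C>0$ such that the contrast $h(x):=\kappa^2(\rho(x)-1)\chi_D(x)$ satisfies $$|h(x)|\le C|x-x_0|^\alpha\quad\text{for $x$ near }x_0,$$ and $$\tilde{\mathcal{C}}(x)-\mathcal{C}_0=\tilde{\mathcal{C}}(x_0)-\mathcal{C}_0+\tilde R(x-x_0)\quad\text{for $x$ near }x_0,$$ with $|\tilde R(y)|\le C|y|^\alpha$ and $|\nabla\otimes\tilde R(y)|\le C|y|^{\alpha-1}$ for $y$ near $0$. If $\partial D$ is not $C^1$ near $x_0$, then the obstacle $(D,\mathcal{C},\rho)$ scatters every incident wave $u^{\rm inc}$ satisfying $$\lim_{x\to x_0}\mathcal{T}^{\tilde{\mathcal{C}}-\mathcal{C}_0}u^{\rm inc}(x)\not\equiv0,$$ i.e. every incident wave for which $\mathcal{T}^{\tilde{\mathcal{C}}-\mathcal{C}_0}u^{\rm inc}(x)$ does not tend to $0$ as $x\to x_0$ along $\partial D\setminus\{x_0\}$ (equivalently, at least one of the two one-sided limits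 at $x_0$ along the two arcs of $\partial D$ is nonzero). That is, for every such $u^{\rm inc}$ the scattered field $u^{\rm sc}$ does not vanish identically in $\mathbb{R}^2\setminus\overline D$.
   Context: Here $d=2$. Piecewise $C^1$ boundary: for each $p\in\partial D$ there are $r>0$ and two $C^1$ arcs $\Gamma_-,\Gamma_+$ (of class $C^1$ up to and including their endpoint $p$, with nonvanishing tangent), meeting only at $p$, such that $\partial D\cap B_r(p)=(\Gamma_-\cup\Gamma_+)\cap B_r(p)$. ''$\partial D$ is $C^1$ near $x_0$'' means that for some $r>0$, after a rigid motion, $D\cap B_r(x_0)$ is the part of $B_r(x_0)$ above the graph of a $C^1$ function. Elastic tensors. $\mathcal{C}=(C_{ijk\ell})$ is a real-valued fourth-order tensor field on $\mathbb{R}^d$ satisfying: (a) $C_{ijk\ell}=C_{k\ell ij}$ and $C_{ijk\ell}=C_{jik\ell}$ for all indices; (b) there is $c>0$ with $c|A|^2\le\sum_{i,j,k,\ell}A_{ij}C_{ijk\ell}(x)A_{k\ell}\le c^{-1}|A|^2$ for all $x\in\mathbb{R}^d$ and all real symmetric matrices $A$; (c) $C_{ijk\ell}=\tilde C_{ijk\ell}$ in $\overline D$ for some $\tilde{\mathcal{C}}=(\tilde C_{ijk\ell})$ with $\tilde C_{ijk\ell}\in C^\infty(\mathbb{R}^d)$, and $\mathcal{C}=\mathcal{C}_0$ in $\mathbb{R}^d\setminus\overline D$, where $\mathcal{C}_0$ is constant and isotropic: $(C_0)_{ijk\ell}=\lambda\delta_{ij}\delta_{k\ell}+\mu(\delta_{ik}\delta_{j\ell}+\delta_{i\ell}\delta_{jk})$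 with Lamé constants $\mu>0$, $\lambda+2\mu>0$. Operators: $(\mathcal{L}^{\mathcal{C}}u)_i=\sum_{j,k,\ell=1}^d\partial_j(C_{ijk\ell}(x)\partial_k u_\ell)$ (distributional sense); in particular $\mathcal{L}^{\mathcal{C}_0}u=\mu\Delta u+(\lambda+\mu)\nabla(\nabla\cdot u)$. The traction operator is $(\mathcal{T}^{\mathcal{A}}u)_i=\sum_{j,k,\ell}\nu_jA_{ijk\ell}\partial_ku_\ell$ on $\partial D$, with $\nu$ the inward unit normal to $\partial D$ (at points where it exists). Scattering. An incident wave is a solution $u^{\rm inc}$ of $(\mathcal{L}^{\mathcal{C}_0}+\kappa^2)u^{\rm inc}=0$ in $\mathbb{R}^d$. The corresponding scattered field is the (unique) $u^{\rm sc}\in(H^1_{\rm loc}(\mathbb{R}^d))^d$ such that $u^{\rm to}=u^{\rm inc}+u^{\rm sc}$ satisfies $(\mathcal{L}^{\mathcal{C}}+\kappa^2\rho)u^{\rm to}=0$ in $\mathbb{R}^d$ and $u^{\rm sc}$ satisfies the outgoing Kupradze radiation condition: outside a large ball $u^{\rm sc}=u^{(p)}+u^{(s)}$ with $(\Delta+\kappa_p^2)u^{(p)}=0$, $\partial_iu^{(p)}_j=\partial_ju^{(p)}_i$, $(\Delta+\kappa_s^2)u^{(s)}=0$, $\nabla\cdot u^{(s)}=0$, $\kappa_p^2=\kappa^2/(\lambda+2\mu)$, $\kappa_s^2=\kappa^2/\mu$, and for $*\in\{p,s\}$, $u^{( * )}(x)\to0$ and $|x|^{(d-1)/2}(\partial_{|x|}u^{(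 * )}-\mathrm{i}\kappa_*u^{( * )})\to0$ as $|x|\to\infty$. The medium is nonscattering for $u^{\rm inc}$ if $u^{\rm sc}=0$ in $\mathbb{R}^d\setminus\overline D$; otherwise it scatters $u^{\rm inc}$. *)

(* Defs.v *)
(* The plane is R * R with its product topology and product
   Lebesgue measure; the library norm of R * R is the sup norm, hence the
   explicit Euclidean norm [enorm]. *)
From HB Require Import structures.
From mathcomp Require Import all_boot all_order all_algebra.
From mathcomp Require Import all_classical all_reals all_analysis.
From mathcomp Require Import complex.
Set Implicit Arguments.
Unset Strict Implicit.
Unset Printing Implicit Defensive.
Import Order.TTheory GRing.Theory Num.Theory.
Import numFieldNormedType.Exports.
Local Open Scope classical_set_scope.
Local Open Scope complex_scope.
Local Open Scope ring_scope.

Section Plane.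
Context {R : realType}.

Definition coord (i : 'I_2) (x : R * R) : R := if i == 0 then x.1 else x.2.

Definition basis_vec (i : 'I_2) : R * R := if i == 0 then (1, 0) else (0, 1).

Definition enorm (x : R * R) : R := Num.sqrt (x.1 ^+ 2 + x.2 ^+ 2).

Definition disk (p : R * R) (r : R) : set (R * R) := [set x | enorm (x - p) < r].

Definition bdry (A : set (R * R)) : set (R * R) := closure A `\` interior A.

Definition partial (i : 'I_2) (f : R * R -> R) : R * R -> R :=
  fun x => 'D_(basis_vec i) f x.

(* For open U: all partial derivatives of order <= n exist and are continuous
   on U.  On open sets this agrees with the class C^n. *)
Fixpoint Cn_on (n : nat) (U : set (R * R)) (f : R * R -> R) : Prop :=
  (forall x, U x -> {for x, continuous f}) /\
  if n is m.+1 then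
    forall i : 'I_2, (forall x, U x -> derivable f x (basis_vec i)) /\
                     Cn_on m U (partial i f)
  else True.

Definition smooth (f : R * R -> R) : Prop := forall n, Cn_on n setT f.

Definition test_function (phi : R * R -> R) : Prop :=
  smooth phi /\ exists r : R, forall x, r < enorm x -> phi x = 0.

Definition C1_fun (f : R -> R) : Prop :=
  (forall t, derivable f t 1) /\ continuous (derive1 f).

Definition rot (c s : R) (x : R * R) : R * R :=
  (c * x.1 - s * x.2, s * x.1 + c * x.2).

(* After the rigid motion x |-> rot c s (x - p), which sends p to the origin,
   D \cap B_r(p) is the part of B_r(p) above the graph of phi. *)
Definition above_graph (D : set (R * R)) (p : R * R) (r c s : R)
    (phi : R -> R) : Prop :=
  [/\ 0 < r, c ^+ 2 + s ^+ 2 = 1 &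
      D `&` disk p r =
      [set x | phi (rot c s (x - p)).1 < (rot c s (x - p)).2] `&` disk p r].

Definition lipschitz_boundary (D : set (R * R)) : Prop :=
  forall p, bdry D p -> exists (r c s : R) (phi : R -> R),
    (exists L : R, forall t u : R, `|phi t - phi u| <= L * `|t - u|) /\
    above_graph D p r c s phi.

Definition C1_boundary_near (D : set (R * R)) (p : R * R) : Prop :=
  exists (r c s : R) (phi : R -> R), C1_fun phi /\ above_graph D p r c s phi.

Definition arc_set (g : R -> R * R) : set (R * R) := g @` `[0, 1].

(* "C^1 up to and including the endpoint" is phrased by letting g be the
   restriction to [0, 1] of a C^1 function on the line. *)
Definition C1_arc_from (p : R * R) (g : R -> R * R) : Prop :=
  let g1 t := (g t).1 in
  let g2 t := (g t).2 in
  [/\ g 0 = p, C1_fun g1, C1_fun g2,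
      (forall t u : R, 0 <= t <= 1 -> 0 <= u <= 1 -> g t = g u -> t = u) &
      (forall t : R, 0 <= t <= 1 -> (derive1 g1 t, derive1 g2 t) != (0, 0))].

Definition piecewise_C1_boundary (D : set (R * R)) : Prop :=
  forall p, bdry D p -> exists (r : R) (g h : R -> R * R),
    [/\ 0 < r, C1_arc_from p g, C1_arc_from p h,
        arc_set g `&` arc_set h = [set p] &
        bdry D `&` disk p r = (arc_set g `|` arc_set h) `&` disk p r].

Definition path_in (D : set (R * R)) (g : R -> R * R) : Prop :=
  {within `[0, 1], continuous g} /\ (forall t : R, 0 <= t <= 1 -> D (g t)).

Definition simply_connected (D : set (R * R)) : Prop :=
  (forall x y, D x -> D y -> exists g, [/\ path_in D g, g 0 = x & g 1 = y]) /\
  (forall g : R -> R * R, path_in D g -> g 0 = g 1 ->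
     exists H : R * R -> R * R,
       [/\ {within `[0, 1] `*` `[0, 1], continuous H},
           (forall s t : R, 0 <= s <= 1 -> 0 <= t <= 1 -> D (H (s, t))),
           (forall t : R, 0 <= t <= 1 -> H (0, t) = g t /\ H (1, t) = g 0) &
           (forall s : R, 0 <= s <= 1 -> H (s, 0) = g 0 /\ H (s, 1) = g 0)]).

(* In the rotated frame the inward unit normal at the origin of the graph of
   phi is (-phi'(0), 1) / sqrt (1 + phi'(0)^2). *)
Definition is_inward_normal (D : set (R * R)) (q n : R * R) : Prop :=
  exists (r c s : R) (phi : R -> R),
    [/\ C1_fun phi, above_graph D q r c s phi &
        rot c s n = (Num.sqrt (1 + derive1 phi 0 ^+ 2))^-1 *: (- derive1 phi 0, 1)].

(* 0 at boundary points where there is no normal *)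
Definition inward_normal (D : set (R * R)) (q : R * R) : R * R :=
  xget 0 [set n | is_inward_normal D q n].

Definition mu2 := ((@lebesgue_measure R) \x (@lebesgue_measure R))%E.

Definition cRe (f : R * R -> R[i]) : R * R -> R := fun x => complex.Re (f x).
Definition cIm (f : R * R -> R[i]) : R * R -> R := fun x => complex.Im (f x).

Definition cpartial (i : 'I_2) (f : R * R -> R[i]) : R * R -> R[i] :=
  fun x => partial i (cRe f) x +i* partial i (cIm f) x.

Definition cCn_on (n : nat) (U : set (R * R)) (f : R * R -> R[i]) : Prop :=
  Cn_on n U (cRe f) /\ Cn_on n U (cIm f).

Definition cint (f : R * R -> R[i]) : R[i] :=
  (\int[mu2]_x cRe f x) +i* (\int[mu2]_x cIm f x).

Definition L2loc_real (f : R * R -> R) : Prop :=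
  measurable_fun setT f /\
  forall r : R, mu2.-integrable (disk 0 r) (fun x => (f x ^+ 2)%:E).

Definition L2loc (f : R * R -> R[i]) : Prop :=
  L2loc_real (cRe f) /\ L2loc_real (cIm f).

Definition weak_partial (k : 'I_2) (f g : R * R -> R[i]) : Prop :=
  forall phi, test_function phi ->
    cint (fun x => (partial k phi x)%:C * f x) =
    - cint (fun x => (phi x)%:C * g x).

Definition H1loc (f : R * R -> R[i]) : Prop :=
  L2loc f /\ forall k : 'I_2, exists g, L2loc g /\ weak_partial k f g.

Definition vector_field := 'I_2 -> R * R -> R[i].

Definition tensor := 'I_2 -> 'I_2 -> 'I_2 -> 'I_2 -> R.

Definition tensor_field := R * R -> tensor.

Definition isotropic_tensor (lambda mu : R) : tensor := fun i j k l =>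
  lambda * (i == j)%:R * (k == l)%:R +
  mu * ((i == k)%:R * (j == l)%:R + (i == l)%:R * (j == k)%:R).

Definition tensor_norm (A : tensor) : R :=
  Num.sqrt (\sum_i \sum_j \sum_k \sum_l A i j k l ^+ 2).

Definition tensor_grad_norm (A : tensor_field) (y : R * R) : R :=
  Num.sqrt (\sum_(m < 2) \sum_i \sum_j \sum_k \sum_l
              partial m (fun z => A z i j k l) y ^+ 2).

Definition tensor_symmetric (A : tensor_field) : Prop :=
  forall x i j k l, A x i j k l = A x k l i j /\ A x i j k l = A x j i k l.

Definition tensor_elliptic (A : tensor_field) : Prop :=
  exists2 c : R, 0 < c & forall x (M : 'M[R]_2), M^T = M ->
    let nM := \sum_i \sum_j M i j ^+ 2 in
    c * nM <= \sum_i \sum_j \sum_k \sum_l M i j * A x i j k l * M k l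
           <= c^-1 * nM.

(* D occupied by the material Ct, the rest of the plane by the material C0 *)
Definition elastic_tensor (D : set (R * R)) (C Ct : tensor_field)
    (C0 : tensor) : Prop :=
  [/\ tensor_symmetric C, tensor_elliptic C,
      (forall i j k l, smooth (fun x => Ct x i j k l)),
      (forall x, closure D x -> C x = Ct x) &
      (forall x, ~ closure D x -> C x = C0)].

Definition elastic_op (A : tensor_field) (u : vector_field) : vector_field :=
  fun i x => \sum_j \sum_k \sum_l
    cpartial j (fun y => (A y i j k l)%:C * cpartial k (u l) y) x.

(* Incident waves are taken as classical solutions: the operator has constant
   coefficients and is elliptic, so distributional solutions are smooth. *)
Definition incident_wave (C0 : tensor) (kappa : R) (u : vector_field) : Prop :=
  (forall i, cCn_on 2 setT (u i)) /\
  forall i x, elastic_op (fun=> C0) u i x + (kappa ^+ 2)%:C * u i x = 0.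

(* (L^A + kappa^2 rho) u = 0 in the distributional sense, for u with a locally
   square integrable weak gradient G, G k l standing for \partial_k u_l.
   Real test functions suffice since the equation is linear. *)
Definition weak_solution (A : tensor_field) (rho : R * R -> R) (kappa : R)
    (u : vector_field) : Prop :=
  exists G : 'I_2 -> 'I_2 -> R * R -> R[i],
    (forall k l, L2loc (G k l) /\ weak_partial k (u l) (G k l)) /\
    forall (i : 'I_2) phi, test_function phi ->
      - cint (fun x => \sum_j \sum_k \sum_l
                 (A x i j k l * partial j phi x)%:C * G k l x) +
      cint (fun x => (kappa ^+ 2 * rho x * phi x)%:C * u i x) = 0.

Definition traction (D : set (R * R)) (A : tensor_field) (u : vector_field) :
    vector_field := fun i x =>
  \sum_j \sum_k \sum_l
    (coord j (inward_normal D x) * A x i j k l)%:C * cpartial k (u l) x.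

Definition vanishes_at_infinity (f : R * R -> R[i]) : Prop :=
  forall e : R, 0 < e ->
    exists M : R, forall x, M < enorm x -> Normc.normc (f x) < e.

Definition radial_deriv (f : R * R -> R[i]) : R * R -> R[i] := fun x =>
  \sum_i (coord i x / enorm x)%:C * cpartial i f x.

Definition helmholtz_on (U : set (R * R)) (k : R) (f : R * R -> R[i]) : Prop :=
  forall x, U x -> \sum_i cpartial i (cpartial i f) x + (k ^+ 2)%:C * f x = 0.

(* the weight is |x|^((d-1)/2) with d = 2 *)
Definition outgoing (k : R) (f : R * R -> R[i]) : Prop :=
  vanishes_at_infinity f /\
  vanishes_at_infinity (fun x =>
    (Num.sqrt (enorm x))%:C * (radial_deriv f x - (0 +i* k) * f x)).

Definition kupradze (lambda mu kappa : R) (u : vector_field) : Prop :=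
  let kp := kappa / Num.sqrt (lambda + 2 * mu) in
  let ks := kappa / Num.sqrt mu in
  exists (r : R) (up us : vector_field),
    let U := [set x | r < enorm x] in
    [/\ (forall i, cCn_on 2 U (up i) /\ cCn_on 2 U (us i)),
        {ae mu2, forall x, U x -> forall i, u i x = up i x + us i x},
        (forall i, helmholtz_on U kp (up i) /\ outgoing kp (up i)) /\
        (forall x, U x -> forall i j, cpartial i (up j) x = cpartial j (up i) x) &
        (forall i, helmholtz_on U ks (us i) /\ outgoing ks (us i)) /\
        (forall x, U x -> \sum_i cpartial i (us i) x = 0)].

Definition scattered_field (lambda mu kappa : R) (C : tensor_field)
    (rho : R * R -> R) (uinc usc : vector_field) : Prop :=
  [/\ (forall i, H1loc (usc i)),
      weak_solution C rho kappa (fun i x => uinc i x + usc i x) &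
      kupradze lambda mu kappa usc].

Definition nonscattering (D : set (R * R)) (lambda mu kappa : R)
    (C : tensor_field) (rho : R * R -> R) (uinc : vector_field) : Prop :=
  exists2 usc, scattered_field lambda mu kappa C rho uinc usc &
    {ae mu2, forall x, ~ closure D x -> forall i, usc i x = 0}.

Definition scatters (D : set (R * R)) (lambda mu kappa : R)
    (C : tensor_field) (rho : R * R -> R) (uinc : vector_field) : Prop :=
  ~ nonscattering D lambda mu kappa C rho uinc.

(* positive element of L^oo(D), extended by 1; the values in D matter only
   almost everywhere *)
Definition density (D : set (R * R)) (rho : R * R -> R) : Prop :=
  [/\ measurable_fun setT rho,
      (exists M : R, {ae mu2, forall x, D x -> `|rho x| <= M}),
      {ae mu2, forall x, D x -> 0 < rho x} &
      (forall x, ~ D x -> rho x = 1)].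

Definition contrast (D : set (R * R)) (kappa : R) (rho : R * R -> R) :
    R * R -> R :=
  fun x => kappa ^+ 2 * (rho x - 1) * \1_D x.

(* As x tends to x0 along \partial D \ {x0}. *)
Definition traction_tends_to_0 (D : set (R * R)) (x0 : R * R)
    (A : tensor_field) (u : vector_field) : Prop :=
  forall i : 'I_2,
    (fun x => Normc.normc (traction D A u i x)) @ within (bdry D `\ x0) (nbhs x0)
      --> (0 : R).

End Plane.

Arguments vector_field : clear implicits.
Arguments tensor : clear implicits.
Arguments tensor_field : clear implicits.

(* Main.v *)
Require Import Defs.
From mathcomp Require Import all_boot all_order all_algebra.
From mathcomp Require Import all_classical all_reals all_analysis.
From mathcomp Require Import complex measurable_realfun.
From mathcomp Require Import ring lra.
Set Implicit Arguments.
Unset Strict Implicit.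
Unset Printing Implicit Defensive.
Import Order.TTheory GRing.Theory Num.Theory.
Import numFieldNormedType.Exports.
Local Open Scope classical_set_scope.
Local Open Scope complex_scope.
Local Open Scope ring_scope.

(* Suppose that the medium is nonscattering.  The scattered field then vanishes
   outside the closure of D, and the weak equation for the total field minus the
   one for the incident field becomes an identity on D alone.  It is tested with
   the fields p_i W + q_i X_2 W^2, W = 1 / (X_1 + tau X_2), annihilated by the
   operator with coefficients frozen at x0, whose pole lies at distance eps from
   x0 outside D.  If the stress jump A_ij = (Ct - C0)_ijkl d_k u_l at x0 were
   not zero, then tau, p, q could be chosen such that A : grad Phi = b W^2 with
   b <> 0.  In the frame where D is the part above a Lipschitz graph, the
   integral of b W^2 over D grows like log (1 / eps), because the one-sided
   slopes of the graph at x0 are distinct when the boundary is not C^1, while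
   every other term is at most an arbitrarily small multiple of log (1 / eps)
   plus a constant.  Hence A = 0, and the traction tends to 0. *)

(** * Directional derivatives and functions of class C^n *)

(** The obstacle is the difference v of the total and the incident field. Of its weak gradient w
    only square integrability is known, while the gradient Psi of the singular field has size k^2,
    with k comparable to the reciprocal distance to the pole. The weak equation alone leaves C : Psi
    : w, and k^2 |w| cannot be controlled. What remains is (C - Ct(x0)) : Psi : w, where smoothness
    of Ct gains a factor |x - x0| <= const / k. All errors are then at most K k (1 + |v| + |w|).
    Young's inequality splits this into k^2 / 8, whose integral is at most a quarter of log (1 /
    eps) up to a constant, and a multiple of 1 + |v|^2 + |w|^2, whose integral does not involve eps.
    The main term is normalised, by a complex factor on p and q, to grow at least like half of log
    (1 / eps); this is why real parts suffice. *)

Section Calculus.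
Context {R : realType}.

(** Both difference quotients are the same function. This reduces the chain rule, the fundamental
    theorem of calculus on slices and the minimum argument of [partial_at_zero] to one variable. *)
Lemma is_derive_line (V : normedModType R) (f : V -> R) x v (t l : R) :
  is_derive t 1 (fun h : R => f (x + h *: v)) l <-> is_derive (x + t *: v) v f l.
Proof.
have E : (fun h : R => h^-1 *: (((fun h : R => f (x + h *: v)) \o shift t) (h *: 1)
   - f (x + t *: v))) = (fun h => h^-1 *: ((f \o shift (x + t *: v)) (h *: v) - f (x + t *: v))).
  apply: funext => h /=; congr (_ *: (f _ - _)).
  by rewrite scaler1 scalerDl addrCA.
split=> -[d1 d2]; split; rewrite /derivable /derive.
- by rewrite -E.
- by rewrite -E.
- by rewrite E.
- by rewrite E.
Qed.

Lemma is_derive_comp1 (V : normedModType R) (f : V -> R) (e : R -> R) x v (l l' : R) :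
  is_derive x v f l -> is_derive (f x) 1 e l' -> is_derive x v (fun y => e (f y)) (l' * l).
Proof.
have -> : x = x + (0 : R) *: v by rewrite scale0r addr0.
move=> /is_derive_line df de; apply/is_derive_line.
have [d1 E1] := df; have [d2 E2] := de.
apply: DeriveDef.
  apply/derivable1_diffP.
  have := @differentiable_comp _ _ _ _ (fun h : R => f (x + h *: v)) e 0.
  apply; exact/derivable1_diffP.
rewrite -derive1E; have /= -> := @derive1_comp R (fun h : R => f (x + h *: v)) e 0 d1 d2.
by rewrite !derive1E E2 E1.
Qed.

Lemma cvg_near_const (g : R -> R) (l : R) :
  (forall h, h != 0 -> g h = l) -> g @ 0^' --> l.
Proof.
move=> gl; apply: cvg_near_cst; apply/nbhs_ballP; exists 1 => //= h _ h0.
exact: gl.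
Qed.

Lemma is_derive_fst (x v : R * R) : is_derive x v (fun y : R * R => y.1) v.1.
Proof.
have H : (fun h : R => h^-1 *: (((fun y : R * R => y.1) \o shift x) (h *: v) - x.1)) @ 0^' --> v.1.
  by apply: cvg_near_const => h h0; rewrite /= addrK /GRing.scale /= mulrA mulVf ?mul1r.
by split; [apply/cvg_ex; exists v.1|exact: cvg_lim H].
Qed.

Lemma is_derive_snd (x v : R * R) : is_derive x v (fun y : R * R => y.2) v.2.
Proof.
have H : (fun h : R => h^-1 *: (((fun y : R * R => y.2) \o shift x) (h *: v) - x.2)) @ 0^' --> v.2.
  by apply: cvg_near_const => h h0; rewrite /= addrK /GRing.scale /= mulrA mulVf ?mul1r.
by split; [apply/cvg_ex; exists v.2|exact: cvg_lim H].
Qed.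

Section FunForms.
Variable (V : normedModType R).
Implicit Types (f g : V -> R).

Lemma is_derive_add f g x v (a b : R) : is_derive x v f a -> is_derive x v g b ->
  is_derive x v (fun y => f y + g y) (a + b).
Proof. exact: is_deriveD. Qed.

Lemma is_derive_opp f x v (a : R) : is_derive x v f a ->
  is_derive x v (fun y => - f y) (- a).
Proof. exact: is_deriveN. Qed.

Lemma is_derive_sub f g x v (a b : R) : is_derive x v f a -> is_derive x v g b ->
  is_derive x v (fun y => f y - g y) (a - b).
Proof. exact: is_deriveB. Qed.

Lemma is_derive_mul f g x v (a b : R) : is_derive x v f a -> is_derive x v g b ->
  is_derive x v (fun y => f y * g y) (a * g x + f x * b).
Proof.
move=> df dg; have H := is_deriveM df dg; apply: is_derive_eq H _.
by rewrite /GRing.scale /= addrC mulrC.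
Qed.

Lemma is_derive_cmul f x v (c a : R) : is_derive x v f a ->
  is_derive x v (fun y => c * f y) (c * a).
Proof. by move=> df; exact: (@is_deriveZ _ _ _ f c). Qed.

Lemma is_derive_inv f x v (a : R) : f x != 0 -> is_derive x v f a ->
  is_derive x v (fun y => (f y)^-1) (- a / f x ^+ 2).
Proof.
move=> f0 [df ea]; split; first exact: derivableV.
by rewrite deriveV // ea /GRing.scale /= mulNr mulrC mulNr.
Qed.

Lemma is_derive_div f g x v (a b : R) : g x != 0 -> is_derive x v f a ->
  is_derive x v g b ->
  is_derive x v (fun y => f y / g y) ((a * g x - f x * b) / g x ^+ 2).
Proof.
move=> g0 df dg; apply: is_derive_eq.
  exact: (is_derive_mul df (is_derive_inv g0 dg)).
by rewrite /=; field.

Qed.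

Lemma is_derive_pow f x v k (a : R) : is_derive x v f a ->
  is_derive x v (fun y => f y ^+ k) (k%:R * f x ^+ k.-1 * a).
Proof.
move=> df; have -> : (fun y => f y ^+ k) = f ^+ k by apply/funext => y; rewrite fctE.
exact: is_deriveX.
Qed.

Lemma is_derive_fsum n (h : 'I_n -> V -> R) x v (dh : 'I_n -> R) :
  (forall i, is_derive x v (h i) (dh i)) ->
  is_derive x v (fun y => \sum_(i < n) h i y) (\sum_(i < n) dh i).
Proof.
move=> H; have -> : (fun y => \sum_(i < n) h i y) = \sum_(i < n) h i.
  by apply/funext => y; rewrite fct_sumE.
exact: is_derive_sum.
Qed.

End FunForms.

Lemma partialP (i : 'I_2) (f : R * R -> R) x a : is_derive x (basis_vec i) f a -> partial i f x = a.
Proof. by case. Qed.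

Lemma partial_congr (i : 'I_2) (f g : R * R -> R) x : (\near x, f x = g x) -> partial i f x = partial i g x.
Proof. exact: near_eq_derive. Qed.

Lemma near_open (U : set (R * R)) x (P : set (R * R)) : open U -> U x ->
  (forall y, U y -> P y) -> \near x, P x.
Proof. by move=> oU Ux UP; apply: filterS UP _; exact: open_nbhs_nbhs. Qed.

Implicit Types (U : set (R * R)) (f g : R * R -> R).

Lemma Cn_on_cont n U f : Cn_on n U f -> forall x, U x -> {for x, continuous f}.
Proof. by case: n => [|n] []. Qed.

(** The clauses of [Cn_on] are pointwise and [partial i f] does not depend on the set, so regularity
    glues. It serves where a cut-off field is smooth for different reasons on two overlapping
    sets. *)
Lemma Cn_on_union n (U W : set (R * R)) f : Cn_on n U f -> Cn_on n W f -> Cn_on n (U `|` W) f.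
Proof.
elim: n f => [|n IH] f [H1 H2] [K1 K2]; split => //.
- by move=> x [|]; [exact: H1|exact: K1].
- by move=> x [|]; [exact: H1|exact: K1].
- move=> i; have [H3 H4] := H2 i; have [K3 K4] := K2 i; split; last exact: IH.
  by move=> x [|]; [exact: H3|exact: K3].
Qed.

Lemma Cn_on_le n (U : set (R * R)) f : Cn_on n.+1 U f -> Cn_on n U f.
Proof.
elim: n f => [|n IH] f [H1 H2]; split => //.
by move=> i; have [H3 H4] := H2 i; split => //; exact: IH.
Qed.

Lemma continuous_congr f g U x : open U -> U x -> (forall x, U x -> f x = g x) ->
  {for x, continuous f} -> {for x, continuous g}.
Proof.
move=> oU Ux fg H; rewrite /prop_for /continuous_at -fg //; apply: cvg_trans H; apply: near_eq_cvg.
exact: (near_open oU Ux).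
Qed.

Lemma Cn_on_congr n (U : set (R * R)) f g : open U -> (forall x, U x -> f x = g x) ->
  Cn_on n U f -> Cn_on n U g.
Proof.
move=> oU; elim: n f g => [|n IH] f g fg [H1 H2].
  by split=> // x Ux; exact: (continuous_congr oU Ux fg (H1 _ Ux)).
split; first by move=> x Ux; exact: (continuous_congr oU Ux fg (H1 _ Ux)).
move=> i; have [H3 H4] := H2 i; split.
  by move=> x Ux; apply: near_eq_derivable (H3 _ Ux); exact: (near_open oU Ux).
apply: IH H4 => x Ux; apply: partial_congr; exact: (near_open oU Ux).
Qed.

Lemma Cn_on_cst n U (a : R) : Cn_on n U (fun=> a).
Proof.
elim: n U a => [|n IH] U a; first by split => // x _; exact: cvg_cst.
split=> [x _|i]; first exact: cvg_cst.
split; first by move=> x _; exact: derivable_cst.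
have -> : partial i (fun=> a) = fun=> 0; last exact: IH.
by apply/funext => x; rewrite /partial derive_cst.
Qed.

Lemma Cn_on_fst n U : Cn_on n U (fun x : R * R => x.1).
Proof.
have C x : {for x, continuous (fun y : R * R => y.1)} by exact: cvg_fst.
case: n => [|n]; first by split.
split=> // i; split; first by move=> x _; have [] := is_derive_fst x (basis_vec i).
have -> : partial i (fun x : R * R => x.1) = fun=> (basis_vec i).1; last exact: Cn_on_cst.
by apply/funext => x; apply: partialP; exact: is_derive_fst.
Qed.

Lemma Cn_on_snd n U : Cn_on n U (fun x : R * R => x.2).
Proof.
have C x : {for x, continuous (fun y : R * R => y.2)} by exact: cvg_snd.
case: n => [|n]; first by split.
split=> // i; split; first by move=> x _; have [] := is_derive_snd x (basis_vec i).
have -> : partial i (fun x : R * R => x.2) = fun=> (basis_vec i).2; last exact: Cn_on_cst.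
by apply/funext => x; apply: partialP; exact: is_derive_snd.
Qed.

Lemma Cn_on_derive n U f i x : Cn_on n.+1 U f -> U x -> is_derive x (basis_vec i) f (partial i f x).
Proof. by move=> [_ /(_ i)[H _]] Ux; apply: derivableP; exact: H. Qed.

Lemma Cn_on_partial n U f i : Cn_on n.+1 U f -> Cn_on n U (partial i f).
Proof. by move=> [_ /(_ i)[_]]. Qed.

Lemma Cn_on_add n U f g : open U -> Cn_on n U f -> Cn_on n U g -> Cn_on n U (fun x => f x + g x).
Proof.
move=> oU; elim: n f g => [|n IH] f g Hf Hg.
  by split=> // x Ux; apply: cvgD; [exact: Cn_on_cont Hf _ Ux|exact: Cn_on_cont Hg _ Ux].
split; first by move=> x Ux; apply: cvgD; [exact: Cn_on_cont Hf _ Ux|exact: Cn_on_cont Hg _ Ux].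
move=> i.
have D x : U x -> is_derive x (basis_vec i) (fun x => f x + g x) (partial i f x + partial i g x).
  by move=> Ux; apply: is_derive_add; [exact: Cn_on_derive Hf Ux|exact: Cn_on_derive Hg Ux].
split; first by move=> x /D[].
apply: (@Cn_on_congr _ _ (fun x => partial i f x + partial i g x)) => //.
  by move=> x /D/partialP.
by apply: IH; exact: Cn_on_partial.
Qed.

Lemma Cn_on_mul n U f g : open U -> Cn_on n U f -> Cn_on n U g -> Cn_on n U (fun x => f x * g x).
Proof.
move=> oU; elim: n f g => [|n IH] f g Hf Hg.
  by split=> // x Ux; apply: cvgM; [exact: Cn_on_cont Hf _ Ux|exact: Cn_on_cont Hg _ Ux].
split; first by move=> x Ux; apply: cvgM; [exact: Cn_on_cont Hf _ Ux|exact: Cn_on_cont Hg _ Ux].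
move=> i.
have D x : U x -> is_derive x (basis_vec i) (fun x => f x * g x) (partial i f x * g x + f x * partial i g x).
  by move=> Ux; apply: is_derive_mul; [exact: Cn_on_derive Hf Ux|exact: Cn_on_derive Hg Ux].
split; first by move=> x /D[].
apply: (@Cn_on_congr _ _ (fun x => partial i f x * g x + f x * partial i g x)) => //.
  by move=> x /D/partialP.
by apply: Cn_on_add => //; apply: IH; try exact: Cn_on_partial; exact: Cn_on_le.
Qed.

Lemma Cn_on_scale n U (c : R) f : open U -> Cn_on n U f -> Cn_on n U (fun x => c * f x).
Proof. by move=> oU; apply: Cn_on_mul => //; exact: Cn_on_cst. Qed.

Lemma Cn_on_opp n U f : open U -> Cn_on n U f -> Cn_on n U (fun x => - f x).
Proof.
move=> oU Hf; apply: (@Cn_on_congr _ _ (fun x => -1 * f x)) => //; last exact: Cn_on_scale.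
by move=> x _; rewrite mulN1r.
Qed.

Lemma Cn_on_sub n U f g : open U -> Cn_on n U f -> Cn_on n U g -> Cn_on n U (fun x => f x - g x).
Proof. by move=> oU Hf Hg; apply: Cn_on_add => //; exact: Cn_on_opp. Qed.

Lemma Cn_on_exp n U f k : open U -> Cn_on n U f -> Cn_on n U (fun x => f x ^+ k).
Proof.
move=> oU Hf; elim: k => [|k IH].
  by apply: (@Cn_on_congr _ _ (fun=> 1)) => //; exact: Cn_on_cst.
apply: (@Cn_on_congr _ _ (fun x => f x * f x ^+ k)) => //; last exact: Cn_on_mul.
by move=> x _; rewrite exprS.
Qed.

Lemma Cn_on_inv n U f : open U -> (forall x, U x -> f x != 0) -> Cn_on n U f ->
  Cn_on n U (fun x => (f x)^-1).
Proof.
move=> oU f0; elim: n => [|n IH] Hf.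
  by split=> // x Ux; apply: cvgV; [exact: f0|exact: Cn_on_cont Hf _ Ux].
split; first by move=> x Ux; apply: cvgV; [exact: f0|exact: Cn_on_cont Hf _ Ux].
move=> i.
have D x : U x -> is_derive x (basis_vec i) (fun x => (f x)^-1) (- partial i f x / f x ^+ 2).
  by move=> Ux; apply: is_derive_inv; [exact: f0|exact: Cn_on_derive Hf Ux].
split; first by move=> x /D[].
apply: (@Cn_on_congr _ _ (fun x => - partial i f x * ((f x)^-1) ^+ 2)) => //.
  by move=> x /D/partialP ->; rewrite exprVn.
apply: Cn_on_mul => //; first by apply: Cn_on_opp => //; exact: Cn_on_partial.
by apply: Cn_on_exp => //; apply: IH; exact: Cn_on_le.
Qed.

Lemma Cn_on_sum n U m (f : 'I_m -> R * R -> R) : open U -> (forall i, Cn_on n U (f i)) ->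
  Cn_on n U (fun x => \sum_(i < m) f i x).
Proof.
move=> oU; elim: m f => [|m IH] f Hf.
  by apply: (@Cn_on_congr _ _ (fun=> 0)) => //; [move=> x _; rewrite big_ord0|exact: Cn_on_cst].
apply: (@Cn_on_congr _ _ (fun x => f ord0 x + \sum_(i < m) f (lift ord0 i) x)) => //.
  by move=> x _; rewrite big_ord_recl.
by apply: Cn_on_add => //; apply: IH => i; exact: Hf.
Qed.

(* t^(-k) exp(-1/t), extended by 0 to t <= 0: these functions span a space closed under differentiation. *)
Definition flat (k : nat) (t : R) : R := if 0 < t then t ^- k * expR (- t^-1) else 0.

Lemma flat_le0 k t : t <= 0 -> flat k t = 0.
Proof. by rewrite /flat ltNge => ->. Qed.

Lemma flat_ge0 k t : 0 <= flat k t.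
Proof.
rewrite /flat; case: ifPn => // t0; apply: mulr_ge0; last exact: expR_ge0.
by rewrite invr_ge0 exprn_ge0 // ltW.
Qed.

Lemma flat_gt0 k t : 0 < t -> 0 < flat k t.
Proof.
move=> t0; rewrite /flat t0 mulr_gt0 ?expR_gt0 // invr_gt0.
exact: exprn_gt0.
Qed.

(** Raising exp x >= x at x = 1 / ((k+2) t) to the power k+2 gives exp (1/t) >= ((k+2) t)^-(k+2).
    The exponent k+2 leaves a factor t^2, which makes the difference quotient at 0 tend to 0. *)
Lemma flat_bound k t : flat k t <= k.+2%:R ^+ k.+2 * t ^+ 2.
Proof.
have [t0|t0] := leP t 0.
  by rewrite flat_le0 // mulr_ge0 ?sqr_ge0 ?exprn_ge0.
have h : (k.+2%:R * t) ^- k.+2 <= expR (t^-1).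
  have -> : t^-1 = k.+2%:R * (k.+2%:R * t)^-1.
    by rewrite invfM mulrA divff ?mul1r.
  rewrite expRM_natl -exprVn lerXn2r ?nnegrE ?invr_ge0 ?expR_ge0 ?mulr_ge0 ?(ltW t0) //.
  by apply: le_trans (expR_ge1Dx _); rewrite lerDr.
rewrite /flat t0 expRN.
have e0 := expR_gt0 (t^-1).
have kt : 0 < (k.+2%:R * t) ^+ k.+2 by rewrite exprn_gt0 // mulr_gt0.
have h' : (expR t^-1)^-1 <= (k.+2%:R * t) ^+ k.+2.
  by rewrite -[leRHS]invrK lef_pV2 ?posrE ?invr_gt0.
apply: (@le_trans _ _ (t ^- k * (k.+2%:R * t) ^+ k.+2)).
  by rewrite ler_wpM2l // invr_ge0 exprn_ge0 // ltW.
rewrite exprMn [t ^+ k.+2](_ : _ = t ^+ k * t ^+ 2); last by rewrite -exprD addn2.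
rewrite mulrCA mulKf //.
by rewrite expf_neq0 // gt_eqF.
Qed.

Lemma flat_derive k (t : R) : is_derive t 1 (flat k) (flat k.+2 t - k%:R * flat k.+1 t).
Proof.
have [t0|t0|->] := ltgtP t 0.
- rewrite !flat_le0 ?ltW // mulr0 subr0.
  apply: (near_eq_is_derive (f := cst (0 : R))).
  by near=> s; rewrite flat_le0 //; near: s; apply: filterS (lt_nbhsl t0) => s /ltW.
- have tn : t != 0 by rewrite gt_eqF.
  apply: (near_eq_is_derive (f := fun s : R => (s^-1) ^+ k * expR (- s^-1))).
    near=> s; rewrite /flat ifT ?exprVn //.
    by near: s; exact: lt_nbhsr.
  have di := is_derive_inv (f := id) tn (is_derive_id t (1 : R)).
  have de := is_derive_comp1 (is_derive_opp di) (is_derive_expR (- t^-1)).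
  have dk := is_derive_pow k di.
  apply: is_derive_eq (is_derive_mul dk de) _.
  rewrite /flat t0 /GRing.scale /= /idfun.
  (* The power rule produces [k.-1], which is truncated at k = 0. *)
  case: k dk => [|k] dk; first by rewrite !exprVn; field.
  by rewrite -!exprVn -!natr1 !exprS; field.
- rewrite !flat_le0 // mulr0 subr0.
  have H : (fun h : R => h^-1 *: (((flat k) \o shift 0) (h *: 1) - flat k 0)) @ 0^' --> (0 : R).
    apply/cvgrPdist_le => e e0; near=> h.
    rewrite sub0r normrN /= addr0 scaler1 (flat_le0 _ (lexx 0)) subr0 /GRing.scale /=.
    rewrite normrM normfV (ger0_norm (flat_ge0 _ _)).
    have h0 : h != 0 by near: h; exact: nbhs_dnbhs_neq.
    have hp : 0 < `|h| by rewrite normr_gt0.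
    rewrite mulrC ler_pdivrMr //; apply: (le_trans (flat_bound _ _)).
    rewrite -real_normK ?num_real // expr2 mulrA ler_wpM2r //.
    rewrite -ler_pdivlMl ?exprn_gt0 //.
    near: h; apply: dnbhs0_le; rewrite mulr_gt0 // invr_gt0 exprn_gt0 //.
  by split; [apply/cvg_ex; exists 0|exact: cvg_lim H].
Unshelve. all: by end_near. Qed.

Lemma Cn_on_flat n k U f : open U -> Cn_on n U f -> Cn_on n U (fun x => flat k (f x)).
Proof.
move=> oU; elim: n k => [|n IH] k Hf.
  split=> // x Ux; apply: (@continuous_comp _ _ _ f (flat k)); first exact: Cn_on_cont Hf _ Ux.
  by apply: differentiable_continuous; apply/derivable1_diffP; case: (flat_derive k (f x)).
split.
  move=> x Ux; apply: (@continuous_comp _ _ _ f (flat k)); first exact: Cn_on_cont Hf _ Ux.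
  by apply: differentiable_continuous; apply/derivable1_diffP; case: (flat_derive k (f x)).
move=> i.
have D x : U x -> is_derive x (basis_vec i) (fun x => flat k (f x))
    ((flat k.+2 (f x) - k%:R * flat k.+1 (f x)) * partial i f x).
  by move=> Ux; apply: is_derive_comp1 (flat_derive _ _); exact: Cn_on_derive Hf Ux.
split; first by move=> x /D[].
apply: (@Cn_on_congr _ _ (fun x => (flat k.+2 (f x) - k%:R * flat k.+1 (f x)) * partial i f x)) => //.
  by move=> x /D/partialP.
have Hf' := Cn_on_le Hf.
apply: Cn_on_mul => //; last exact: Cn_on_partial.
by apply: Cn_on_sub => //; [exact: IH|apply: Cn_on_scale => //; exact: IH].
Qed.

(** The smooth transition from 0 on t <= 0 to 1 on t >= 1; every cut-off below is a [step] of a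
    polynomial. The denominator is positive because t and 1 - t are never both nonpositive. *)
Definition step (t : R) : R := flat 0 t / (flat 0 t + flat 0 (1 - t)).

Lemma step_den t : 0 < flat 0 t + flat 0 (1 - t).
Proof.
have [t0|t0] := leP t 0.
  by rewrite ltr_wpDl ?flat_ge0 // flat_gt0 //; lra.
by rewrite ltr_wpDr ?flat_ge0 // flat_gt0.
Qed.

Lemma step_le0 t : t <= 0 -> step t = 0.
Proof. by move=> t0; rewrite /step flat_le0 // mul0r. Qed.

Lemma step_ge1 t : 1 <= t -> step t = 1.
Proof.
move=> t0; rewrite /step [flat 0 (1 - t)]flat_le0 ?addr0 ?divff ?gt_eqF ?flat_gt0 //; lra.
Qed.

Lemma step_ge0 t : 0 <= step t.
Proof. by rewrite divr_ge0 ?flat_ge0 // ltW // step_den. Qed.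

Lemma step_le1 t : step t <= 1.
Proof. by rewrite ler_pdivrMr ?step_den // mul1r lerDl flat_ge0. Qed.

Lemma Cn_on_step n U f : open U -> Cn_on n U f -> Cn_on n U (fun x => step (f x)).
Proof.
move=> oU Hf; have H1 : Cn_on n U (fun x => flat 0 (1 - f x)).
  by apply: Cn_on_flat => //; apply: Cn_on_sub => //; exact: Cn_on_cst.
apply: Cn_on_mul => //; first exact: Cn_on_flat.
apply: Cn_on_inv => //; first by move=> x _; rewrite gt_eqF // step_den.
by apply: Cn_on_add => //; exact: Cn_on_flat.
Qed.

End Calculus.

(** * Complex-valued functions and singular fields *)

Section ComplexCalculus.
Context {R : realType}.
Local Notation Re := complex.Re.
Local Notation Im := complex.Im.
Implicit Types (F G : R * R -> R[i]) (U : set (R * R)) (a b z : R[i]).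

Lemma ReD a b : Re (a + b) = Re a + Re b. Proof. by case: a b => [? ?] []. Qed.
Lemma ImD a b : Im (a + b) = Im a + Im b. Proof. by case: a b => [? ?] []. Qed.
Lemma ReN a : Re (- a) = - Re a. Proof. by case: a. Qed.
Lemma ImN a : Im (- a) = - Im a. Proof. by case: a. Qed.
Lemma ReM a b : Re (a * b) = Re a * Re b - Im a * Im b.
Proof. by case: a b => [? ?] []. Qed.
Lemma ImM a b : Im (a * b) = Re a * Im b + Im a * Re b.
Proof. by case: a b => [? ?] []. Qed.
Lemma ReV a : Re a^-1 = Re a / (Re a ^+ 2 + Im a ^+ 2). Proof. by case: a. Qed.
Lemma ImV a : Im a^-1 = - (Im a / (Re a ^+ 2 + Im a ^+ 2)). Proof. by case: a. Qed.
Lemma ReMr (c : R) b : Re (c%:C * b) = c * Re b.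
Proof. by rewrite ReM /= mul0r subr0. Qed.
Lemma ImMr (c : R) b : Im (c%:C * b) = c * Im b.
Proof. by rewrite ImM /= mul0r addr0. Qed.
Lemma Re_sum n (h : 'I_n -> R[i]) : Re (\sum_(i < n) h i) = \sum_(i < n) Re (h i).
Proof. by apply: (big_morph _ ReD). Qed.
Lemma Im_sum n (h : 'I_n -> R[i]) : Im (\sum_(i < n) h i) = \sum_(i < n) Im (h i).
Proof. by apply: (big_morph _ ImD). Qed.
Lemma complex_ext a b : Re a = Re b -> Im a = Im b -> a = b.
Proof. by case: a b => [? ?] [? ?] /= -> ->. Qed.

Lemma sum2 (V : nmodType) (h : 'I_2 -> V) : \sum_(i < 2) h i = h 0 + h 1.
Proof. by rewrite big_ord_recl big_ord1; congr (_ + h _); apply/val_inj. Qed.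

Lemma ord2P (i : 'I_2) : i = 0 \/ i = 1.
Proof. by case: i => [[|[|//]] ?]; [left|right]; exact: val_inj. Qed.

Lemma sqr_complex_gt0 a : a != 0 -> 0 < Re a ^+ 2 + Im a ^+ 2.
Proof.
move=> a0; rewrite lt_neqAle addr_ge0 ?sqr_ge0 // andbT eq_sym.
apply: contra a0; rewrite paddr_eq0 ?sqr_ge0 // !sqrf_eq0 => /andP[/eqP r /eqP i].
by apply/eqP/complex_ext.
Qed.

(** A derivative of a complex-valued function of real variables is kept as a pair of real ones, so
    that the real calculus above applies to it componentwise. *)
Definition cder (i : 'I_2) F (x : R * R) (l : R[i]) :=
  is_derive x (basis_vec i) (cRe F) (Re l) /\ is_derive x (basis_vec i) (cIm F) (Im l).

Lemma cder_cst i x a : cder i (fun=> a) x 0.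
Proof. by split; [exact: (is_derive_cst (Re a))|exact: (is_derive_cst (Im a))]. Qed.

Lemma cder_add i x F G a b : cder i F x a -> cder i G x b -> cder i (fun y => F y + G y) x (a + b).
Proof.
move=> [f1 f2] [g1 g2]; split.
  have -> : cRe (fun y => F y + G y) = fun y => cRe F y + cRe G y.
    by apply/funext => y; exact: ReD.
  by rewrite ReD; exact: is_derive_add.
have -> : cIm (fun y => F y + G y) = fun y => cIm F y + cIm G y.
  by apply/funext => y; exact: ImD.
by rewrite ImD; exact: is_derive_add.
Qed.

Lemma cder_mul i x F G a b : cder i F x a -> cder i G x b ->
  cder i (fun y => F y * G y) x (a * G x + F x * b).
Proof.
move=> [f1 f2] [g1 g2]; split.
  have -> : cRe (fun y => F y * G y) = fun y => cRe F y * cRe G y - cIm F y * cIm G y.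
    by apply/funext => y; exact: ReM.
  apply: is_derive_eq (is_derive_sub (is_derive_mul f1 g1) (is_derive_mul f2 g2)) _.
  by rewrite ReD !ReM /cRe /cIm; ring.
have -> : cIm (fun y => F y * G y) = fun y => cRe F y * cIm G y + cIm F y * cRe G y.
  by apply/funext => y; exact: ImM.
apply: is_derive_eq (is_derive_add (is_derive_mul f1 g2) (is_derive_mul f2 g1)) _.
by rewrite ImD !ImM /cRe /cIm; ring.
Qed.

Lemma cder_scale i x F a b : cder i F x a -> cder i (fun y => b * F y) x (b * a).
Proof. by move=> /(cder_mul (cder_cst i x b)); rewrite mul0r add0r. Qed.

Lemma cder_inv i x F a : F x != 0 -> cder i F x a ->
  cder i (fun y => (F y)^-1) x (- a * (F x)^-1 ^+ 2).
Proof.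
move=> F0 [f1 f2]; have n0 := sqr_complex_gt0 F0.
have n1 : cRe F x ^+ 2 + cIm F x ^+ 2 != 0 by rewrite gt_eqF.
have dn := is_derive_add (is_derive_pow 2 f1) (is_derive_pow 2 f2).
split.
  have -> : cRe (fun y => (F y)^-1) = fun y => cRe F y / (cRe F y ^+ 2 + cIm F y ^+ 2).
    by apply/funext => y; exact: ReV.
  apply: is_derive_eq (is_derive_div (g := fun y => cRe F y ^+ 2 + cIm F y ^+ 2) n1 f1 dn) _.
  by move: n1; rewrite ReM ReN ImN expr2 ReM ImM ReV ImV /cRe /cIm /= => n1; field.
have -> : cIm (fun y => (F y)^-1) = fun y => - (cIm F y / (cRe F y ^+ 2 + cIm F y ^+ 2)).
  by apply/funext => y; exact: ImV.
apply: is_derive_eq (is_derive_opp (is_derive_div (g := fun y => cRe F y ^+ 2 + cIm F y ^+ 2) n1 f2 dn)) _.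
by move: n1; rewrite ImM ReN ImN expr2 ReM ImM ReV ImV /cRe /cIm /= => n1; field.
Qed.

Lemma cCn_cst n U a : cCn_on n U (fun=> a).
Proof. by split; [exact: (Cn_on_cst n U (Re a))|exact: (Cn_on_cst n U (Im a))]. Qed.

Lemma cCn_add n U F G : open U -> cCn_on n U F -> cCn_on n U G -> cCn_on n U (fun y => F y + G y).
Proof.
move=> oU [f1 f2] [g1 g2]; split.
  by apply: (Cn_on_congr oU _ (Cn_on_add oU f1 g1)) => x _; rewrite /cRe ReD.
by apply: (Cn_on_congr oU _ (Cn_on_add oU f2 g2)) => x _; rewrite /cIm ImD.
Qed.

Lemma cCn_mul n U F G : open U -> cCn_on n U F -> cCn_on n U G -> cCn_on n U (fun y => F y * G y).
Proof.
move=> oU [f1 f2] [g1 g2]; split.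
  apply: (Cn_on_congr oU _ (Cn_on_sub oU (Cn_on_mul oU f1 g1) (Cn_on_mul oU f2 g2))) => x _.
  by rewrite /cRe ReM.
apply: (Cn_on_congr oU _ (Cn_on_add oU (Cn_on_mul oU f1 g2) (Cn_on_mul oU f2 g1))) => x _.
by rewrite /cIm ImM.
Qed.

Lemma cCn_exp n U F k : open U -> cCn_on n U F -> cCn_on n U (fun y => F y ^+ k).
Proof.
move=> oU H; elim: k => [|k IH].
  have -> : (fun y => F y ^+ 0) = fun=> 1 by [].
  exact: cCn_cst.
have -> : (fun y => F y ^+ k.+1) = fun y => F y * F y ^+ k by apply/funext => y; rewrite exprS.
exact: cCn_mul.
Qed.

Lemma cCn_inv n U F : open U -> (forall x, U x -> F x != 0) -> cCn_on n U F ->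
  cCn_on n U (fun y => (F y)^-1).
Proof.
move=> oU F0 [f1 f2].
have H : Cn_on n U (fun x => (cRe F x ^+ 2 + cIm F x ^+ 2)^-1).
  apply: Cn_on_inv => //; first by move=> x /F0/sqr_complex_gt0; move/gt_eqF/negbT.
  by apply: Cn_on_add => //; apply: Cn_on_exp.
split.
  by apply: (Cn_on_congr oU _ (Cn_on_mul oU f1 H)) => x _; rewrite /cRe ReV.
apply: (Cn_on_congr oU _ (Cn_on_opp oU (Cn_on_mul oU f2 H))) => x _.
by rewrite /cIm ImV.
Qed.

Definition linf (z0 z1 : R[i]) (x : R * R) : R[i] := z0 * (x.1)%:C + z1 * (x.2)%:C.

Lemma cder_fst i (x : R * R) : cder i (fun y => (y.1)%:C) x (((basis_vec i).1 : R)%:C).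
Proof.
split; first exact: is_derive_fst.
exact: (is_derive_cst (0 : R)).
Qed.

Lemma cder_snd i (x : R * R) : cder i (fun y => (y.2)%:C) x (((basis_vec i).2 : R)%:C).
Proof.
split; first exact: is_derive_snd.
exact: (is_derive_cst (0 : R)).
Qed.

Lemma cder_linf i z0 z1 x : cder i (linf z0 z1) x (if i == 0 then z0 else z1).
Proof.
have := cder_add (cder_scale z0 (cder_fst i x)) (cder_scale z1 (cder_snd i x)).
congr cder; rewrite /basis_vec; case: ifP => _ /=.
  by rewrite mulr1 mulr0 addr0.
by rewrite mulr1 mulr0 add0r.
Qed.

Lemma cCn_linf n U z0 z1 : open U -> cCn_on n U (linf z0 z1).
Proof.
move=> oU; apply: cCn_add => //; apply: cCn_mul => //; try exact: cCn_cst.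
  by split; [exact: Cn_on_fst|exact: (Cn_on_cst n U (0 : R))].
by split; [exact: Cn_on_snd|exact: (Cn_on_cst n U (0 : R))].
Qed.

Lemma is_derive_linfV z0 z1 i x : linf z0 z1 x != 0 -> forall b,
  is_derive x (basis_vec i) (fun y => Re (b * (linf z0 z1 y)^-1))
    (Re (- b * (if i == 0 then z0 else z1) * (linf z0 z1 x)^-1 ^+ 2)).
Proof.
move=> L0 b; have [H _] := cder_scale b (cder_inv L0 (cder_linf i z0 z1 x)).
by apply: is_derive_eq H _; rewrite mulNr mulrN -mulNr mulrA.
Qed.

Lemma cder_eq i F x a b : cder i F x a -> a = b -> cder i F x b.
Proof. by move=> + <-. Qed.

Lemma cder_pow i x F a k : cder i F x a -> cder i (fun y => F y ^+ k) x (k%:R * F x ^+ k.-1 * a).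
Proof.
move=> H; elim: k => [|k IH].
  apply: cder_eq (cder_cst i x 1) _.
  by rewrite !mul0r.
have -> : (fun y => F y ^+ k.+1) = fun y => F y * F y ^+ k by apply/funext => y; rewrite exprS.
apply: cder_eq (cder_mul H IH) _ => /=.
case: k {IH} => [|k] /=; first by rewrite expr0; ring.
by rewrite exprS -!natr1; ring.
Qed.

Lemma Re_le_normc a : `|Re a| <= Normc.normc a.
Proof.
case: a => a b /=; rewrite -sqrtr_sqr ler_wsqrtr // lerDl; exact: sqr_ge0.
Qed.

Lemma Im_le_normc a : `|Im a| <= Normc.normc a.
Proof.
case: a => a b /=; rewrite -sqrtr_sqr ler_wsqrtr // lerDr; exact: sqr_ge0.
Qed.

Lemma normc_ge0 a : 0 <= Normc.normc a.
Proof. by case: a => ? ? /=; exact: sqrtr_ge0. Qed.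

Lemma normc_le a : Normc.normc a <= `|Re a| + `|Im a|.
Proof.
case: a => a b /=; rewrite -[leRHS]ger0_norm ?addr_ge0 // -sqrtr_sqr ler_wsqrtr //.
rewrite -(real_normK (num_real a)) -(real_normK (num_real b)).
by have := normr_ge0 a; have := normr_ge0 b; nra.
Qed.

Lemma normc_pow a k : Normc.normc (a ^+ k) = Normc.normc a ^+ k.
Proof. by elim: k => [|k IH]; [rewrite !expr0 Normc.normc1|rewrite !exprS Normc.normcM IH]. Qed.

(** Cramer's rule for the real system formed by the real and imaginary parts of [linf z0 z1 x]; its
    determinant is Im (z1 conj z0). *)
Lemma linf_solve1 z0 z1 x :
  Im (z1 * conjc z0) * x.1 = Im z1 * Re (linf z0 z1 x) - Re z1 * Im (linf z0 z1 x).
Proof. by case: z0 z1 x => [a b] [c d] [x y]; rewrite /linf !(ReD, ImD, ReM, ImM) /=; ring. Qed.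

Lemma linf_solve2 z0 z1 x :
  Im (z1 * conjc z0) * x.2 = Re z0 * Im (linf z0 z1 x) - Im z0 * Re (linf z0 z1 x).
Proof. by case: z0 z1 x => [a b] [c d] [x y]; rewrite /linf !(ReD, ImD, ReM, ImM) /=; ring. Qed.

(** Cramer's rule expresses x through the form, so a form whose two coefficients are independent
    over the reals is comparable to the norm. All size estimates of the singular fields rest on
    this. *)
Lemma linf_lower z0 z1 : Im (z1 * conjc z0) != 0 -> exists2 K : R, 0 < K &
  forall x, `|x.1| + `|x.2| <= K * Normc.normc (linf z0 z1 x).
Proof.
set d := Im _ => d0.
have dp : 0 < `|d| by rewrite normr_gt0.
pose M : R := `|Re z0| + `|Im z0| + `|Re z1| + `|Im z1|.
have M0 : 0 <= M by rewrite !addr_ge0.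
exists ((2 * M + 1) / `|d|); first by rewrite divr_gt0 // ltr_wpDl // mulr_ge0.
move=> x; set w := linf _ _ _.
have rw := Re_le_normc w; have iw := Im_le_normc w; have nw := normc_ge0 w.
have E1 : d * x.1 = Im z1 * Re w - Re z1 * Im w.
  exact: linf_solve1.
have E2 : d * x.2 = Re z0 * Im w - Im z0 * Re w.
  exact: linf_solve2.
rewrite mulrAC ler_pdivlMr // mulrDl -!normrM ![_ * d]mulrC E1 E2.
apply: (@le_trans _ _ (M * Normc.normc w)); last by rewrite ler_wpM2r //; lra.
apply: le_trans (lerD (ler_normB _ _) (ler_normB _ _)) _; rewrite !normrM /M !mulrDl.
rewrite [leRHS](_ : _ = (`|Im z1| * Normc.normc w + `|Re z1| * Normc.normc w) +
  (`|Re z0| * Normc.normc w + `|Im z0| * Normc.normc w)); last by ring.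
by rewrite !lerD // ler_wpM2l.
Qed.

Section FundamentalField.
Variables (tau : R[i]) (p q : 'I_2 -> R[i]).

(** [zc] is the gradient of X_1 + tau X_2, and [nc] that of X_2. *)
Definition zc (j : 'I_2) : R[i] := if j == 0 then 1 else tau.
Definition nc (j : 'I_2) : R[i] := if j == 0 then 0 else 1.
Definition Wf (x : R * R) : R[i] := (linf 1 tau x)^-1.
(** The second term comes from differentiating a family p(tau) W in tau, which gives p'(tau) W -
    p(tau) X_2 W^2. It is what a double root of the characteristic polynomial requires. [Psi i j] is
    the partial derivative of [Phi i] in direction j. *)
Definition Phi (i : 'I_2) (x : R * R) : R[i] := p i * Wf x + q i * ((x.2)%:C * Wf x ^+ 2).
Definition Psi (i j : 'I_2) (x : R * R) : R[i] :=
  (q i * nc j - p i * zc j) * Wf x ^+ 2 - 2 * q i * zc j * ((x.2)%:C * Wf x ^+ 3).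

Hypothesis tau_im : Im tau != 0.

Lemma linf_tau_lower : exists2 K : R, 0 < K &
  forall x, `|x.1| + `|x.2| <= K * Normc.normc (linf 1 tau x).
Proof. by apply: linf_lower; rewrite (_ : conjc 1 = 1) ?mulr1 //; congr (_ +i* _); exact: oppr0. Qed.

Lemma linf_tau_neq0 x : x != 0 -> linf 1 tau x != 0.
Proof.
move=> x0; apply/eqP => E; have [K K0 /(_ x)] := linf_tau_lower.
rewrite E Normc.normc0 mulr0 => H.
have : `|x.1| + `|x.2| == 0 by rewrite eq_le H addr_ge0.
rewrite paddr_eq0 // !normr_eq0; case/andP => /eqP a /eqP b; case/eqP: x0.
by case: x a b {E H} => /= ? ? -> ->.
Qed.

Lemma basis_snd i : (((basis_vec i).2 : R)%:C : R[i]) = nc i.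
Proof. by rewrite /basis_vec /nc; case: ifP. Qed.

Lemma cder_W j x : x != 0 -> cder j Wf x (- zc j * Wf x ^+ 2).
Proof. by move=> /linf_tau_neq0 L; exact: cder_inv L (cder_linf j 1 tau x). Qed.

Lemma cder_Phi i j x : x != 0 -> cder j (Phi i) x (Psi i j x).
Proof.
move=> x0; have dW := cder_W j x0.
apply: cder_eq (cder_add (cder_scale (p i) dW)
  (cder_scale (q i) (cder_mul (cder_snd j x) (cder_pow 2 dW)))) _.
by rewrite basis_snd /Psi /=; ring.
Qed.

Lemma PsiE i j : Psi i j = fun x => (q i * nc j - p i * zc j) * Wf x ^+ 2 +
  - (2 * q i * zc j) * ((x.2)%:C * Wf x ^+ 3).
Proof. by apply/funext => x; rewrite /Psi mulNr. Qed.

Lemma cder_Psi i j k x : x != 0 -> cder k (Psi i j) x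
  (2 * Wf x ^+ 3 * (p i * zc j * zc k - q i * (nc j * zc k + zc j * nc k)) +
   6 * (x.2)%:C * Wf x ^+ 4 * (q i * zc j * zc k)).
Proof.
move=> x0; have dW := cder_W k x0; rewrite PsiE.
apply: cder_eq (cder_add (cder_scale (q i * nc j - p i * zc j) (cder_pow 2 dW))
  (cder_scale (- (2 * q i * zc j)) (cder_mul (cder_snd k x) (cder_pow 3 dW)))) _ => /=.
  by rewrite basis_snd; ring.
Qed.

Lemma open_neq0 : open [set x : R * R | x != 0].
Proof.
rewrite (_ : [set _ | _] = ~` [set 0]); last by apply/seteqP; split => x /eqP.
by apply: closed_openC; apply: accessible_closed_set1; apply: hausdorff_accessible; exact: norm_hausdorff.
Qed.

Lemma cCn_W n : cCn_on n [set x : R * R | x != 0] Wf.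
Proof.
apply: cCn_inv; first exact: open_neq0.
  by move=> x; exact: linf_tau_neq0.
by apply: cCn_linf; exact: open_neq0.
Qed.

Lemma cCn_snd n U : open U -> cCn_on n U (fun x : R * R => (x.2)%:C).
Proof. by move=> oU; split; [exact: Cn_on_snd|exact: (Cn_on_cst n U (0 : R))]. Qed.

Lemma cCn_Phi n i : cCn_on n [set x : R * R | x != 0] (Phi i).
Proof.
have oU := open_neq0; have W := cCn_W n.
apply: cCn_add => //; apply: cCn_mul => //; first exact: cCn_cst.
  exact: cCn_cst.
by apply: cCn_mul => //; [exact: cCn_snd|exact: cCn_exp].
Qed.

Lemma cCn_Psi n i j : cCn_on n [set x : R * R | x != 0] (Psi i j).
Proof.
have oU := open_neq0; have W := cCn_W n.
have H k c d : cCn_on n [set x : R * R | x != 0] (fun x => c * Wf x ^+ 2 + d * ((x.2)%:C * Wf x ^+ k)).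
  apply: cCn_add => //; apply: cCn_mul => //; try exact: cCn_cst.
    exact: cCn_exp.
  by apply: cCn_mul => //; [exact: cCn_snd|exact: cCn_exp].
by rewrite PsiE; exact: H.
Qed.

Lemma Wf_bound : exists2 K : R, 0 < K & forall x, x != 0 ->
  Normc.normc (Wf x) <= K / (`|x.1| + `|x.2|).
Proof.
have [K K0 HK] := linf_tau_lower; exists K => // x x0.
rewrite /Wf Normc.normcV.
have L0 : 0 < Normc.normc (linf 1 tau x).
  rewrite lt_neqAle normc_ge0 andbT eq_sym; apply: contra (linf_tau_neq0 x0) => /eqP/Normc.eq0_normc ->.
  by [].
have X0 : 0 < `|x.1| + `|x.2|.
  rewrite lt_neqAle addr_ge0 // andbT eq_sym; apply: contra x0.
  rewrite paddr_eq0 // !normr_eq0; case/andP => /eqP a /eqP b.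
  by case: x a b {L0} => /= ? ? -> ->.
by rewrite ler_pdivlMr // mulrC ler_pdivrMr.
Qed.

(** Homogeneity of degree -1: the factor X_2 compensates one of the two powers of W. In the same way
    [Psi] has degree -2. *)
Lemma Phi_bound i : exists2 K : R, 0 < K & forall x, x != 0 ->
  `|Re (Phi i x)| <= K / (`|x.1| + `|x.2|).
Proof.
have [K K0 HK] := Wf_bound.
exists (Normc.normc (p i) * K + Normc.normc (q i) * K ^+ 2 + 1).
  by rewrite ltr_wpDl // addr_ge0 // mulr_ge0 ?normc_ge0 ?exprn_ge0 // ltW.
move=> x x0; have X0 : 0 < `|x.1| + `|x.2|.
  rewrite lt_neqAle addr_ge0 // andbT eq_sym; apply: contra x0.
  rewrite paddr_eq0 // !normr_eq0; case/andP => /eqP a /eqP b.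
  by case: x a b => /= ? ? -> ->.
set s := `|x.1| + `|x.2| in X0 *.
have HW : Normc.normc (Wf x) <= K / s := HK _ x0.
apply: le_trans (Re_le_normc _) _; apply: le_trans (le_normcD _ _) _.
rewrite (Normc.normcM (p i)) (Normc.normcM (q i)) (Normc.normcM (x.2)%:C) normc_pow.
have -> : Normc.normc (x.2)%:C = `|x.2| by rewrite /= expr0n addr0 sqrtr_sqr.
have x2 : `|x.2| <= s by rewrite lerDr.
rewrite !mulrDl -[leLHS]addr0 !lerD ?divr_ge0 ?(ltW X0) //.
  by rewrite -mulrA ler_wpM2l ?normc_ge0.
rewrite -mulrA ler_wpM2l ?normc_ge0 //.
apply: (@le_trans _ _ (s * (K / s) ^+ 2)).
  apply: ler_pM => //; first by rewrite exprn_ge0 ?normc_ge0.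
  by rewrite lerXn2r // ?nnegrE ?normc_ge0 ?divr_ge0 ?ltW.
by rewrite [leLHS](_ : _ = K ^+ 2 / s) //; field; rewrite gt_eqF.
Qed.

Lemma Psi_bound i j : exists2 K : R, 0 < K & forall x, x != 0 ->
  `|Re (Psi i j x)| <= K / (`|x.1| + `|x.2|) ^+ 2.
Proof.
have [K K0 HK] := Wf_bound.
pose a := Normc.normc (q i * nc j - p i * zc j); pose b := Normc.normc (2 * q i * zc j).
exists (a * K ^+ 2 + b * K ^+ 3 + 1).
  by rewrite ltr_wpDl // addr_ge0 // mulr_ge0 ?normc_ge0 ?exprn_ge0 // ltW.
move=> x x0; have X0 : 0 < `|x.1| + `|x.2|.
  rewrite lt_neqAle addr_ge0 // andbT eq_sym; apply: contra x0.
  rewrite paddr_eq0 // !normr_eq0; case/andP => /eqP c /eqP d.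
  by case: x c d => /= ? ? -> ->.
set s := `|x.1| + `|x.2| in X0 *.
have HW : Normc.normc (Wf x) <= K / s := HK _ x0.
apply: le_trans (Re_le_normc _) _; apply: le_trans (le_normcD _ _) _.
rewrite normcN (Normc.normcM (q i * nc j - p i * zc j)) (Normc.normcM (2 * q i * zc j)) (Normc.normcM (x.2)%:C) !normc_pow -/a -/b.
have -> : Normc.normc (x.2)%:C = `|x.2| by rewrite /= expr0n addr0 sqrtr_sqr.
have x2 : `|x.2| <= s by rewrite lerDr.
have s2 : 0 < s ^+ 2 by rewrite exprn_gt0.
rewrite !mulrDl -[leLHS]addr0 !lerD ?divr_ge0 ?(ltW s2) //.
  rewrite -mulrA ler_wpM2l ?normc_ge0 // -expr_div_n.
  by rewrite lerXn2r // ?nnegrE ?normc_ge0 ?divr_ge0 ?ltW.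
rewrite -mulrA ler_wpM2l ?normc_ge0 //.
apply: (@le_trans _ _ (s * (K / s) ^+ 3)).
  apply: ler_pM => //; first by rewrite exprn_ge0 ?normc_ge0.
  by rewrite lerXn2r // ?nnegrE ?normc_ge0 ?divr_ge0 ?ltW.
by rewrite [leLHS](_ : _ = K ^+ 3 / s ^+ 2) //; field; rewrite gt_eqF.
Qed.

(** By [cder_Psi] a second derivative of [Phi] combines W^3 and X_2 W^4; the two algebraic
    conditions annihilate the two coefficients separately. *)
Lemma Psi_solves (C : tensor R) (l : 'I_2) x : x != 0 ->
  (forall l, \sum_i \sum_j \sum_k (C i j k l)%:C * (q i * zc j * zc k) = 0) ->
  (forall l, \sum_i \sum_j \sum_k (C i j k l)%:C *
     (p i * zc j * zc k - q i * (nc j * zc k + zc j * nc k)) = 0) ->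
  \sum_i \sum_j \sum_k C i j k l * partial k (cRe (Psi i j)) x = 0.
Proof.
move=> x0 /(_ l) H1 /(_ l) H2.
have E i j k : C i j k l * partial k (cRe (Psi i j)) x =
  Re ((C i j k l)%:C * (2 * Wf x ^+ 3 * (p i * zc j * zc k - q i * (nc j * zc k + zc j * nc k)) +
   6 * (x.2)%:C * Wf x ^+ 4 * (q i * zc j * zc k))).
  by rewrite ReMr; congr (_ * _); apply: partialP; case: (cder_Psi i j k x0).
under eq_bigr do under eq_bigr do under eq_bigr do rewrite E.
under eq_bigr do under eq_bigr do rewrite -Re_sum.
under eq_bigr do rewrite -Re_sum.
rewrite -Re_sum.
transitivity (Re (2 * Wf x ^+ 3 * (\sum_i \sum_j \sum_k (C i j k l)%:C *
     (p i * zc j * zc k - q i * (nc j * zc k + zc j * nc k))) +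
   6 * (x.2)%:C * Wf x ^+ 4 * (\sum_i \sum_j \sum_k (C i j k l)%:C * (q i * zc j * zc k)))).
  by congr (complex.Re _); rewrite !sum2; ring.
by rewrite H1 H2 !mulr0 addr0.
Qed.

(** The assumption removes the X_2 W^3 part of A : Psi, so that a pure multiple of W^2 is left, to
    which the corner integral applies. *)
Lemma Psi_pairing (A : 'I_2 -> 'I_2 -> R) x :
  \sum_i \sum_j (A i j)%:C * (q i * zc j) = 0 ->
  \sum_i \sum_j A i j * Re (Psi i j x) =
  Re ((\sum_i \sum_j (A i j)%:C * (q i * nc j - p i * zc j)) * Wf x ^+ 2).
Proof.
move=> H.
under eq_bigr do under eq_bigr do rewrite -ReMr.
under eq_bigr do rewrite -Re_sum.
rewrite -Re_sum.
transitivity (Re ((\sum_i \sum_j (A i j)%:C * (q i * nc j - p i * zc j)) * Wf x ^+ 2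
  - 2 * ((x.2)%:C * Wf x ^+ 3) * (\sum_i \sum_j (A i j)%:C * (q i * zc j)))).
  by congr (complex.Re _); rewrite /Psi !sum2; ring.
by rewrite H mulr0 subr0.
Qed.

End FundamentalField.

End ComplexCalculus.

(** * Symbol of the operator and choice of the singular field *)

Definition hornerP {S : comNzRingType} :=
  (@hornerD S, @hornerN S, @hornerZ S, @hornerM S, @hornerC S, @hornerX S, @hornerXn S).

Section Symbol.
Context {R : realType}.
Local Notation Re := complex.Re.
Local Notation Im := complex.Im.
Variable C : tensor R.
Hypothesis C_major : forall i j k l, C i j k l = C k l i j.
Hypothesis C_minor : forall i j k l, C i j k l = C j i k l.
Variable c : R.
Hypothesis c_gt0 : 0 < c.
Hypothesis C_ge : forall M : 'M[R]_2, M^T = M ->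
  c * (\sum_i \sum_j M i j ^+ 2) <= \sum_i \sum_j \sum_k \sum_l M i j * C i j k l * M k l.

(** The symbol of the operator (the acoustic tensor) at the covector (s, t): the contraction of C
    with the covector in its two middle indices. *)
Definition realsymbol (s t : R) (i l : 'I_2) : R :=
  C i 0 0 l * s ^+ 2 + (C i 0 1 l + C i 1 0 l) * (s * t) + C i 1 1 l * t ^+ 2.

(** Ellipticity is assumed on symmetric matrices, so it is applied to the symmetrisation of the
    rank-one matrix (a, b) (s, t). Its squared norm is half of |(a, b)|^2 |(s, t)|^2 plus half of
    the squared scalar product, whence the constant c / 2. *)
Lemma realsymbol_ge s t (a b : R) :
  c / 2 * ((a ^+ 2 + b ^+ 2) * (s ^+ 2 + t ^+ 2)) <=
  realsymbol s t 0 0 * a ^+ 2 + (realsymbol s t 0 1 + realsymbol s t 1 0) * (a * b)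
   + realsymbol s t 1 1 * b ^+ 2.
Proof.
pose M : 'M[R]_2 := \matrix_(i, j) (((if i == 0 then a else b) * (if j == 0 then s else t) +
   (if j == 0 then a else b) * (if i == 0 then s else t)) / 2).
have MT : M^T = M by apply/matrixP => i j; rewrite !mxE; ring.
have := C_ge MT.
rewrite !sum2 !mxE /=.
have h1 i j k l : C i j k l = C i j l k by rewrite C_major C_minor C_major.
have e1 : C 1 0 0 0 = C 0 1 0 0 by rewrite C_minor.
have e2 : C 1 0 1 1 = C 0 1 1 1 by rewrite C_minor.
have e3 : C 1 0 0 1 = C 0 1 0 1 by rewrite C_minor.
have e4 : C 1 0 1 0 = C 0 1 0 1 by rewrite C_minor h1.
have e5 : C 0 1 1 0 = C 0 1 0 1 by rewrite h1.
have e6 : C 0 0 1 0 = C 0 1 0 0 by rewrite h1 C_major.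
have e7 : C 0 0 0 1 = C 0 1 0 0 by rewrite C_major.
have e8 : C 1 1 1 0 = C 0 1 1 1 by rewrite h1 C_major.
have e9 : C 1 1 0 1 = C 0 1 1 1 by rewrite C_major.
have e10 : C 1 1 0 0 = C 0 0 1 1 by rewrite C_major.
rewrite /realsymbol ?(e1, e2, e3, e4, e5, e6, e7, e8, e9, e10) => H.
apply: le_trans (le_trans _ H) _; last by rewrite le_eqVlt; apply/orP; left; apply/eqP; field.
rewrite [leLHS](_ : _ = c * ((a ^+ 2 + b ^+ 2) * (s ^+ 2 + t ^+ 2) / 2)); last by ring.
rewrite ler_pM2l //.
suff : 0 <= (a * s + b * t) ^+ 2 by nra.
exact: sqr_ge0.
Qed.

(** The quadratic form at (1, 0) is q00 > 0, and at (-q10, q00) it equals q00 times the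
    determinant. *)
Lemma realsymbol_det_gt0 s t : (s, t) != (0, 0) ->
  0 < realsymbol s t 0 0 * realsymbol s t 1 1 - realsymbol s t 0 1 * realsymbol s t 1 0.
Proof.
move=> st; have n0 : 0 < s ^+ 2 + t ^+ 2.
  rewrite lt_neqAle addr_ge0 ?sqr_ge0 // andbT eq_sym; apply: contra st.
  by rewrite paddr_eq0 ?sqr_ge0 // !sqrf_eq0 => /andP[/eqP -> /eqP ->].
have h0 : 0 < realsymbol s t 0 0.
  have := realsymbol_ge s t 1 0; rewrite !mulr0 expr0n /= !mulr0 expr1n mulr1 !addr0 mul1r.
  by apply: lt_le_trans; rewrite mulr_gt0 // divr_gt0.
have := realsymbol_ge s t (- realsymbol s t 1 0) (realsymbol s t 0 0).
set q00 := realsymbol s t 0 0 in h0 *; set q01 := realsymbol s t 0 1.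
set q10 := realsymbol s t 1 0; set q11 := realsymbol s t 1 1.
rewrite [X in _ <= X](_ : _ = q00 * (q00 * q11 - q01 * q10)); last by ring.
move=> H; rewrite -(pmulr_rgt0 _ h0); apply: lt_le_trans H.
rewrite mulr_gt0 ?divr_gt0 // mulr_gt0 // ltr_wpDl ?sqr_ge0 // exprn_gt0 //.
Qed.

Definition symR (i l : 'I_2) : {poly R} :=
  (C i 0 0 l)%:P + (C i 0 1 l + C i 1 0 l) *: 'X + C i 1 1 l *: 'X^2.

Lemma horner_symR i l t : (symR i l).[t] = realsymbol 1 t i l.
Proof. by rewrite /symR /realsymbol !hornerP; ring. Qed.

Lemma size_symR i l : (size (symR i l) <= 3)%N.
Proof.
apply: leq_trans (size_polyD _ _) _; rewrite geq_max; apply/andP; split.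
  apply: leq_trans (size_polyD _ _) _; rewrite geq_max; apply/andP; split.
    by apply: leq_trans (size_polyC_leq1 _) _.
  by apply: leq_trans (size_scale_leq _ _) _; rewrite size_polyX.
by apply: leq_trans (size_scale_leq _ _) _; rewrite size_polyXn.
Qed.

Definition detR : {poly R} := symR 0 0 * symR 1 1 - symR 0 1 * symR 1 0.

(** The coefficient of degree four is the determinant of the symbol at the covector (0, 1), hence
    positive. *)
Lemma size_detR : size detR = 5%N.
Proof.
have h i j k l : (size (symR i j * symR k l)%R <= 5)%N.
  apply: leq_trans (size_polyMleq _ _) _.
  by rewrite -subn1 leq_subLR (leq_add (size_symR i j) (size_symR k l)).
apply/eqP; rewrite eqn_leq; apply/andP; split.
  by apply: leq_trans (size_polyD _ _) _; rewrite geq_max size_polyN !h.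
rewrite ltnNge; apply/negP => /leq_sizeP /(_ 4%N (leqnn _)).
have := @realsymbol_det_gt0 0 1; rewrite xpair_eqE oner_eq0 andbF => /(_ isT).
rewrite /realsymbol !expr0n /= !(mulr0, mul0r, add0r) !expr1n !mulr1.
rewrite /detR coefB !coefM !big_ord_recl !big_ord0 /= /bump /= !subn0 /=.
rewrite /symR !coefD !coefZ !coefC !coefX !coefXn /=.
rewrite !(mulr0, mul0r, add0r, addr0, mulr1) => H E.
by rewrite E ltxx in H.
Qed.

Lemma detR_gt0 t : 0 < detR.[t].
Proof.
by rewrite /detR hornerD hornerN !hornerM !horner_symR; apply: realsymbol_det_gt0;
  rewrite xpair_eqE oner_eq0.
Qed.

Local Notation rc := (real_complex R).
Definition symC i l : {poly R[i]} := map_poly rc (symR i l).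
Definition detC : {poly R[i]} := map_poly rc detR.

Lemma detCE : detC = symC 0 0 * symC 1 1 - symC 0 1 * symC 1 0.
Proof. by rewrite /detC /detR rmorphB /= !rmorphM. Qed.

Lemma horner_symC i l tau : (symC i l).[tau] =
  \sum_j \sum_k (C i j k l)%:C * (zc tau j * zc tau k).
Proof.
rewrite /symC /symR !rmorphD /= map_polyC !map_polyZ /= map_polyX map_polyXn !hornerP !sum2 /zc /=.
by rewrite rmorphD; ring.
Qed.

Lemma horner_dsymC i l tau : (symC i l)^`().[tau] =
  \sum_j \sum_k (C i j k l)%:C * (nc j * zc tau k + zc tau j * nc k).
Proof.
rewrite /symC /symR !rmorphD /= map_polyC !map_polyZ /= map_polyX map_polyXn.
rewrite !derivD !derivZ derivC derivX derivXn !hornerP !sum2 /zc /nc /=.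
by rewrite rmorphD; ring.
Qed.

Lemma map_conj_rc (P : {poly R}) : map_poly (@conjc R) (map_poly rc P) = map_poly rc P.
Proof.
rewrite -map_poly_comp; apply: eq_map_poly => x /=.
by congr (_ +i* _); rewrite oppr0.
Qed.

Lemma horner_conj (P : {poly R}) tau : (map_poly rc P).[conjc tau] = conjc ((map_poly rc P).[tau]).
Proof. by rewrite -{1}map_conj_rc horner_map. Qed.

Lemma root_detC_nonreal tau : detC.[tau] = 0 -> Im tau != 0.
Proof.
move=> H; apply/eqP => t0; have E : tau = rc (Re tau) by apply: complex_ext.
move: H; rewrite E /detC horner_map => /(congr1 (@complex.Re R)) /= H.
by have := detR_gt0 (Re tau); rewrite H ltxx.
Qed.

Lemma conj_neq (tau : R[i]) : Im tau != 0 -> conjc tau != tau.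
Proof.
move=> t0; apply: contra t0 => /eqP /(congr1 (@complex.Im R)); case: tau => a b /= H.
by apply/eqP; lra.
Qed.

Lemma conj_root tau : detC.[tau] = 0 -> detC.[conjc tau] = 0.
Proof. by rewrite /detC horner_conj => ->; rewrite rmorph0. Qed.

Lemma conj_droot tau : detC^`().[tau] = 0 -> detC^`().[conjc tau] = 0.
Proof. by rewrite /detC deriv_map horner_conj => ->; rewrite rmorph0. Qed.

Lemma poly_small_root (a : {poly R[i]}) n x : (size a <= n.+1)%N -> a.[x] = 0 ->
  exists2 b : {poly R[i]}, (size b <= n)%N & a = b * ('X - x%:P).
Proof.
move=> sa /eqP/factor_theorem[b E]; exists b => //.
have [->|b0] := eqVneq b 0; first by rewrite size_poly0.
by move: sa; rewrite E size_Mmonic ?monicXsubC // size_XsubC addn2.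
Qed.

(* Degree four against degree three: a cubic sharing all roots of the symbol, with multiplicities, vanishes. *)
Lemma cubic_eq0 (a : {poly R[i]}) : (size a <= 4)%N ->
  (forall tau, detC.[tau] = 0 -> a.[tau] = 0) ->
  (forall tau, detC.[tau] = 0 -> detC^`().[tau] = 0 -> a^`().[tau] = 0) ->
  a = 0.
Proof.
move=> sa a0 a1.
have sN : size detC = 5%N by rewrite size_map_poly size_detR.
have D0 : detC != 0 by rewrite -size_poly_eq0 sN.
(* A double root and its conjugate, also double and distinct from it because the root is not real,
   give four zeros of a, counted with multiplicity. *)
have dbl tau : detC.[tau] = 0 -> detC^`().[tau] = 0 -> a = 0.
  move=> r d; have im := root_detC_nonreal r.
  have cn := conj_neq im.
  have [b sb Eb] := poly_small_root sa (a0 _ r).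
  have b0 : b.[tau] = 0.
    have := a1 _ r d; rewrite Eb derivM derivXsubC mulr1 !hornerP subrr mulr0 add0r.
    by [].
  have [e se Ee] := poly_small_root sb b0.
  have e0 : e.[conjc tau] = 0.
    have /eqP := a0 _ (conj_root r); rewrite Eb Ee !hornerP !mulf_eq0 subr_eq0 (negbTE cn) !orbF.
    by move/eqP.
  have [f sf Ef] := poly_small_root se e0.
  have f0 : f.[conjc tau] = 0.
    have /eqP := a1 _ (conj_root r) (conj_droot d); rewrite Eb Ee Ef.
    rewrite !derivM !derivXsubC !mulr1 !hornerP subrr !(mulr0, mul0r, addr0, add0r) ?mulr1.
    by rewrite !mulf_eq0 subr_eq0 (negbTE cn) !orbF => /eqP.
  have [g sg Eg] := poly_small_root sf f0.
  by move: sg; rewrite leqn0 size_poly_eq0 => /eqP g0; rewrite Eb Ee Ef Eg g0 !mul0r.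
have [t0 /rootP r0] : exists t, root detC t by apply/closed_rootP; rewrite sN.
have im0 := root_detC_nonreal r0.
have [P1 s1 E1] := poly_small_root (n := 4) (eq_leq sN) r0.
have r1 : P1.[conjc t0] = 0.
  have /eqP := conj_root r0; rewrite E1 !hornerP mulf_eq0 subr_eq0 (negbTE (conj_neq im0)) orbF.
  by move/eqP.
have [P2 s2 E2] := poly_small_root s1 r1.
have sP2 : size P2 = 3%N.
  have P20 : P2 != 0 by apply: contra D0 => /eqP P20; rewrite E1 E2 P20 !mul0r.
  move: sN; rewrite E1 E2 !size_Mmonic ?monicXsubC //; last first.
    by rewrite mulf_neq0 // polyXsubC_eq0.
  by rewrite !size_XsubC !addn2 /= => -[].
have [t1 /rootP q1] : exists t, root P2 t by apply/closed_rootP; rewrite sP2.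
have [P3 s3 E3] := poly_small_root (n := 2) (eq_leq sP2) q1.
have r1' : detC.[t1] = 0 by rewrite E1 E2 !hornerP q1 !mul0r.
have im1 := root_detC_nonreal r1'.
(* A root of the quadratic cofactor that repeats t0 or its conjugate is a double root of the symbol.
   Otherwise t0, t1 and their conjugates are four distinct zeros of a. *)
have [e1|ne1] := eqVneq t1 t0.
  apply: (dbl t0) => //; rewrite E1 E2 E3 e1 !derivM !derivXsubC !hornerP subrr.
  by rewrite !(mulr0, mul0r, addr0, add0r).
have [e1'|ne1'] := eqVneq t1 (conjc t0).
  apply: (dbl (conjc t0)); first exact: conj_root.
  rewrite E1 E2 E3 e1' !derivM !derivXsubC !hornerP subrr.
  by rewrite !(mulr0, mul0r, addr0, add0r).
apply/eqP/negPn/negP => an0.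
have := max_poly_roots an0 (rs := [:: t0; conjc t0; t1; conjc t1]).
rewrite /= !(rootE) !a0 //; try exact: conj_root.
rewrite eqxx /= => /(_ isT) /(_ _) H.
have : (4 < size a)%N.
  apply: H; rewrite !inE !negb_or /= !andbT.
  rewrite [t0 == _]eq_sym (conj_neq im0) [t0 == t1]eq_sym ne1 [conjc t0 == t1]eq_sym ne1'.
  rewrite [t1 == conjc t1]eq_sym (conj_neq im1) /= andbT.
  rewrite (inj_eq (can_inj (@conjcK R))) [t0 == t1]eq_sym ne1 andbT.
  by apply: contra ne1' => /eqP ->; rewrite conjcK.
by rewrite ltnNge sa.
Qed.

(** The rows of the adjugate of the symbol matrix: at a root of the determinant they are left null
    vectors of the symbol. *)
Definition adjrow (e i : 'I_2) : {poly R[i]} :=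
  if e == 0 then (if i == 0 then symC 1 1 else - symC 0 1)
  else (if i == 0 then - symC 1 0 else symC 0 0).

Lemma adjrow_mul e l : \sum_i adjrow e i * symC i l = if e == l then detC else 0.
Proof.
rewrite detCE sum2; have [->|->] := ord2P e; have [->|->] := ord2P l; rewrite /adjrow /=; ring.
Qed.

Variable A : 'I_2 -> 'I_2 -> R.

Definition zp (j : 'I_2) : {poly R[i]} := if j == 0 then 1%:P else 'X.

(** Up to sign, the constant b of the pairing as a polynomial in tau, for p a row of the adjugate
    and q = 0. Its derivative plays this role for the field attached to a double root. *)
Definition cubic e : {poly R[i]} :=
  \sum_i \sum_j ((A i j)%:C *: adjrow e i) * zp j.

Lemma size_cubic e : (size (cubic e) <= 4)%N.
Proof.
have sC i l : (size (symC i l) <= 3)%N by rewrite size_map_poly size_symR.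
have sa i : (size (adjrow e i) <= 3)%N.
  by rewrite /adjrow; case: ifP => _; case: ifP => _; rewrite ?size_polyN.
have h i j : (size (((A i j)%:C *: adjrow e i) * zp j)%R <= 4)%N.
  apply: leq_trans (size_polyMleq _ _) _.
  rewrite -subn1 leq_subLR (leq_add (n1 := 3) (n2 := 2)) //.
    exact: leq_trans (size_scale_leq _ _) (sa i).
  by rewrite /zp; case: ifP => _; rewrite ?size_polyX // (leq_trans (size_polyC_leq1 _)).
have hD (P Q : {poly R[i]}) : (size P <= 4 -> size Q <= 4 -> size (P + Q)%R <= 4)%N.
  by move=> hP hQ; apply: leq_trans (size_polyD _ _) _; rewrite geq_max hP hQ.
rewrite /cubic !sum2; exact: (hD _ _ (hD _ _ (h _ _) (h _ _)) (hD _ _ (h _ _) (h _ _))).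
Qed.

Lemma horner_cubic e tau : (cubic e).[tau] =
  \sum_i \sum_j (A i j)%:C * ((adjrow e i).[tau] * zc tau j).
Proof. by rewrite /cubic !sum2 /zp /= !hornerP /zc /=; ring. Qed.

Lemma horner_dcubic e tau : (cubic e)^`().[tau] =
  \sum_i \sum_j (A i j)%:C * ((adjrow e i)^`().[tau] * zc tau j + (adjrow e i).[tau] * nc j).
Proof.
have T (a : R[i]) (P : {poly R[i]}) j : (a *: P * zp j)^`().[tau] =
    a * (P^`().[tau] * zc tau j + P.[tau] * nc j).
  rewrite derivM derivZ hornerD !hornerM !hornerZ /zp /zc /nc.
  have [->|->] := ord2P j => /=; first by rewrite derivC !hornerC; ring.
  by rewrite derivX hornerX hornerC; ring.
by rewrite /cubic !sum2 !derivD !hornerD !T.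
Qed.

(** At a real tau the determinant is nonzero and the adjugate invertible, so A (1, tau) = 0; two
    values of tau determine A. *)
Lemma cubic_eq0_A : cubic 0 = 0 -> cubic 1 = 0 -> forall i j, A i j = 0.
Proof.
move=> c0 c1.
have H (t : R) i : A i 0 + A i 1 * t = 0.
  have D : detC.[t%:C] != 0.
    rewrite /detC horner_map; apply/eqP => /(congr1 (@complex.Re R)) /= H.
    by have := detR_gt0 t; rewrite H ltxx.
  have := congr1 (fun P : {poly _} => P.[t%:C]) c0; have := congr1 (fun P : {poly _} => P.[t%:C]) c1.
  rewrite /= !horner_cubic !horner0 !sum2 /adjrow /zc /= !hornerP => h1 h0.
  move: D; rewrite detCE !hornerP; set q00 := (symC 0 0).[_] in h1 h0 *.
  set q11 := (symC 1 1).[_] in h1 h0 *; set q01 := (symC 0 1).[_] in h1 h0 *.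
  set q10 := (symC 1 0).[_] in h1 h0 * => D.
  have K0 : (q00 * q11 - q01 * q10) * (A 0 0 + A 0 1 * t)%:C = 0.
    rewrite rmorphD rmorphM /= -[RHS](_ : q00 * 0 + q01 * 0 = 0); last by rewrite !mulr0 addr0.
    by rewrite -{1}h0 -{1}h1; ring.
  have K1 : (q00 * q11 - q01 * q10) * (A 1 0 + A 1 1 * t)%:C = 0.
    rewrite rmorphD rmorphM /= -[RHS](_ : q10 * 0 + q11 * 0 = 0); last by rewrite !mulr0 addr0.
    by rewrite -{1}h0 -{1}h1; ring.
  move/eqP: K0; move/eqP: K1; rewrite !mulf_eq0 (negbTE D) /= => /eqP/(congr1 (@complex.Re R)) /= K1 /eqP/(congr1 (@complex.Re R)) /= K0.
  by have [->|->] := ord2P i.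
move=> i j; have h0 := H 0 i; have h1 := H 1 i.
rewrite mulr0 addr0 in h0; rewrite h0 add0r mulr1 in h1.
by have [->|->] := ord2P j.
Qed.

(** Indirect: if every admissible field had b = 0, both cubics would vanish at the roots of the
    symbol with their multiplicities, hence identically, and A with them. Double roots do occur, for
    instance for an isotropic frozen tensor, so two kinds of fields are tried. *)
Lemma test_field_exists : (exists i j, A i j != 0) -> exists (tau : R[i]) (p q : 'I_2 -> R[i]),
  [/\ Im tau != 0,
      (forall l, \sum_i \sum_j \sum_k (C i j k l)%:C * (q i * zc tau j * zc tau k) = 0),
      (forall l, \sum_i \sum_j \sum_k (C i j k l)%:C *
         (p i * zc tau j * zc tau k - q i * (nc j * zc tau k + zc tau j * nc k)) = 0),
      \sum_i \sum_j (A i j)%:C * (q i * zc tau j) = 0 &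
      \sum_i \sum_j (A i j)%:C * (q i * nc j - p i * zc tau j) != 0].
Proof.
move=> [i0 [j0 A0]].
have mulE e l tau : \sum_i (adjrow e i).[tau] * (symC i l).[tau] = (if e == l then detC else 0).[tau].
  by rewrite -adjrow_mul horner_sum; under [RHS]eq_bigr do rewrite hornerM.
have dmulE e l tau : \sum_i ((adjrow e i)^`().[tau] * (symC i l).[tau] +
    (adjrow e i).[tau] * (symC i l)^`().[tau]) = (if e == l then detC else 0)^`().[tau].
  by rewrite -adjrow_mul !sum2 derivD !derivM !hornerP.
apply: contrapT => H.
have K e : cubic e = 0.
  have a0 tau : detC.[tau] = 0 -> (cubic e).[tau] = 0.
    move=> r; apply: contrapT => ne; apply: H.
    exists tau, (fun i => (adjrow e i).[tau]), (fun=> 0); split.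
    - exact: root_detC_nonreal.
    - by move=> l; rewrite !sum2 !(mul0r, mulr0, addr0).
    - move=> l; have := mulE e l tau; rewrite [RHS](_ : _ = 0); last first.
        by case: ifP => _ //; rewrite horner0.
      by move=> E; rewrite -[RHS]E !sum2 !horner_symC !sum2; ring.
    - by rewrite !sum2 !(mul0r, mulr0, addr0).
    - apply/eqP => E; apply: ne; rewrite horner_cubic.
      transitivity (- (\sum_i \sum_j (A i j)%:C * (0 * nc j - (adjrow e i).[tau] * zc tau j))).
        by rewrite !sum2; ring.
      by rewrite E oppr0.
  apply: cubic_eq0 => //; first exact: size_cubic.
  move=> tau r d; apply: contrapT => ne; apply: H.
  (* The tau-derivative of the previous field. Differentiating the relation adjugate times symbol
     equals determinant gives the condition on p and q, since the derivative of the determinant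
     vanishes too. *)
  exists tau, (fun i => (adjrow e i)^`().[tau]), (fun i => - (adjrow e i).[tau]); split.
  - exact: root_detC_nonreal.
  - move=> l; have := mulE e l tau; rewrite [RHS](_ : _ = 0); last first.
      by case: ifP => _ //; rewrite horner0.
    by move=> E; apply: oppr_inj; rewrite oppr0 -[RHS]E !sum2 !horner_symC !sum2; ring.
  - move=> l; have := dmulE e l tau; rewrite [RHS](_ : _ = 0); last first.
      by case: ifP => _ //; rewrite ?deriv0 ?horner0.
    by move=> E; rewrite -[RHS]E !sum2 !horner_symC !horner_dsymC !sum2; ring.
  - apply: oppr_inj; rewrite oppr0 -[RHS](a0 _ r) horner_cubic !sum2; ring.
  - apply/eqP => E; apply: ne; rewrite horner_dcubic.
    transitivity (- (\sum_i \sum_j (A i j)%:C * (- (adjrow e i).[tau] * nc j - (adjrow e i)^`().[tau] * zc tau j))).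
      by rewrite !sum2; ring.
    by rewrite E oppr0.
by move: A0; rewrite (cubic_eq0_A (K 0) (K 1)) eqxx.
Qed.

End Symbol.

(** * Measure-preserving maps of the plane *)

Section Plane_measure.
Context {R : realType}.
Local Notation leb := (@lebesgue_measure R).

(** The plane carries the product sigma-algebra; an open set belongs to it as the countable union of
    the rational squares that it contains. *)
Lemma open_measurable2 (U : set (R * R)) : open (U : set (R * R)) -> measurable U.
Proof.
move=> oU.
pose box (q q' r : rat) : set (R * R) :=
  `](ratr q - ratr r), (ratr q + ratr r)[ `*` `](ratr q' - ratr r), (ratr q' + ratr r)[.
have -> : U = \bigcup_(q in [set: rat]) \bigcup_(q' in [set: rat]) \bigcup_(r in [set: rat])
    (if `[< box q q' r `<=` U >] then box q q' r else set0) :> set (R * R).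
  apply/seteqP; split; last first.
    by move=> x [q _] [q' _] [r _]; case: ifPn => // /asboolP; exact.
  move=> [x y] Uxy.
  have /nbhs_ballP[e /= e0 H] : nbhs (x, y) U by apply: open_nbhs_nbhs.
  have /rat_in_itvoo[r] : 0 < e / 2 by rewrite divr_gt0.
  rewrite in_itv /= => /andP[r0 re].
  have /rat_in_itvoo[q] : x - ratr r < x + ratr r :> R by lra.
  rewrite in_itv /= => /andP[q1 q2].
  have /rat_in_itvoo[q'] : y - ratr r < y + ratr r :> R by lra.
  rewrite in_itv /= => /andP[q3 q4].
  exists q => //; exists q' => //; exists r => //.
  rewrite ifT; first by split; rewrite /= in_itv /=; apply/andP; split; lra.
  apply/asboolP => -[u v] [/=]; rewrite !in_itv /= => /andP[u1 u2] /andP[v1 v2].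
  by apply: H; split => /=; rewrite /ball /= ltr_norml; apply/andP; split; lra.
apply: bigcupT_measurable_rat => q; apply: bigcupT_measurable_rat => q'.
apply: bigcupT_measurable_rat => r; case: ifPn => _ //.
by apply: measurableX; exact: measurable_itv.
Qed.

Lemma continuous_measurable2 (f : R * R -> R) : continuous f -> measurable_fun setT (f : (R * R) -> R).
Proof.
move=> cf; apply: (measurability _ (RGenOInfty.measurableE R)).
move=> _ [_ [a ->] <-]; rewrite setTI; apply: open_measurable2.
apply: open_comp; first by move=> x _; exact: cf.
exact: interval_open.
Qed.

Lemma within_measurable2 (U : set (R * R)) (f : R * R -> R) : open U ->
  (forall x, U x -> {for x, continuous f}) -> measurable_fun (U : set (R * R)) (f : (R * R) -> R).
Proof.
move=> oU cf; apply: (measurability _ (RGenOInfty.measurableE R)).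
move=> _ [_ [a ->] <-]; apply: open_measurable2; rewrite openE => x [Ux /= fx].
have := cf _ Ux => /(_ [set y | a < y]); rewrite /interior.
have H : nbhs (f x) [set y | a < y].
  by apply: open_nbhs_nbhs; split; [exact: open_gt|move: fx; rewrite /= in_itv /= andbT].
move=> /(_ H) H'; near=> y; split; near: y.
  exact: open_nbhs_nbhs.
by apply: filterS H' => y /=; rewrite in_itv /= andbT.
Unshelve. all: by end_near. Qed.

Lemma measurable_translation (a : R) : measurable_fun [set: R] (fun x : R => x + a).
Proof. by apply: measurable_funD => //; exact: measurable_id. Qed.

(** The translated measure agrees with Lebesgue measure on half-open intervals, which determine
    it. *)
Lemma lebesgue_translation (a : R) (A : set R) : measurable A ->
  pushforward leb (fun x : R => x + a : measurableTypeR R) A = leb A.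
Proof.
move=> mA; have mf := measurable_translation a.
apply/esym; apply: (lebesgue_measure_unique _ mA) => //= _ [[u v] _ <-].
rewrite /pushforward /=.
have -> : (fun x : R => x + a) @^-1` `]u, v]%classic = `](u - a), (v - a)]%classic.
  by apply/seteqP; split => x /=; rewrite !in_itv /=; lra.
rewrite !lebesgue_measure_itv /= !lte_fin ltrD2r.
by case: ifP => // _; rewrite -!EFinD; congr (_%:E); ring.
Qed.

Lemma ge0_integral_translation (F : R -> \bar R) (a : R) : measurable_fun setT F ->
  (forall x, 0 <= F x)%E -> (\int[leb]_x F (x + a)%R = \int[leb]_x F x)%E.
Proof.
move=> mF F0; have mf := measurable_translation a.
transitivity (\int[pushforward leb (fun x : R => (x + a)%R : measurableTypeR R)]_x F x)%E.
  by rewrite ge0_integral_pushforward // preimage_setT.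
by apply: eq_measure_integral => A mA _; exact: lebesgue_translation.
Qed.

Definition shear1 (g : R -> R) (x : (R * R)) : (R * R) := (x.1 + g x.2, x.2).
Definition shear2 (g : R -> R) (x : (R * R)) : (R * R) := (x.1, x.2 + g x.1).

Lemma measurable_shear1 (g : R -> R) : measurable_fun setT g -> measurable_fun setT (shear1 g).
Proof.
move=> mg; apply: measurable_fun_pair => /=.
  apply: measurable_funD; first exact: measurable_fst.
  by apply: measurableT_comp => //; exact: measurable_snd.
exact: measurable_snd.
Qed.

Lemma measurable_shear2 (g : R -> R) : measurable_fun setT g -> measurable_fun setT (shear2 g).
Proof.
move=> mg; apply: measurable_fun_pair => /=.
  exact: measurable_fst.
apply: measurable_funD; first exact: measurable_snd.
by apply: measurableT_comp => //; exact: measurable_fst.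
Qed.

(** By Tonelli the area is the integral of the lengths of the horizontal slices, and the shear
    translates each slice. *)
Lemma mu2_shear1 (g : R -> R) (A : set (R * R)) : measurable_fun setT g -> measurable A ->
  mu2 (shear1 g @^-1` A) = mu2 A.
Proof.
move=> mg mA; have ms := measurable_shear1 mg.
have mA' : measurable (shear1 g @^-1` A) by rewrite -[X in measurable X]setTI; exact: ms.
have H (B : set (R * R)) : measurable B -> mu2 B = (\int[leb]_y \int[leb]_x (\1_B (x, y))%:E)%E.
  move=> mB; transitivity (\int[mu2]_x (\1_B x)%:E)%E; first by rewrite integral_indic // setIT.
  rewrite /mu2 fubini_tonelli2 //.
    by apply/measurable_EFinP; exact: measurable_indic.
rewrite (H _ mA) (H _ mA'); apply: eq_integral => y _.
rewrite -(@ge0_integral_translation (fun x => (\1_A (x, y))%:E) (g y)) //.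
  apply/measurable_EFinP; apply: measurableT_comp; first exact: measurable_indic.
  exact: pair2_measurable.
Qed.

Lemma mu2_shear2 (g : R -> R) (A : set (R * R)) : measurable_fun setT g -> measurable A ->
  mu2 (shear2 g @^-1` A) = mu2 A.
Proof.
move=> mg mA; have ms := measurable_shear2 mg.
have mA' : measurable (shear2 g @^-1` A) by rewrite -[X in measurable X]setTI; exact: ms.
have H (B : set (R * R)) : measurable B -> mu2 B = (\int[leb]_x \int[leb]_y (\1_B (x, y))%:E)%E.
  move=> mB; transitivity (\int[mu2]_x (\1_B x)%:E)%E; first by rewrite integral_indic // setIT.
  rewrite /mu2 fubini_tonelli1 //.
    by apply/measurable_EFinP; exact: measurable_indic.
rewrite (H _ mA) (H _ mA'); apply: eq_integral => x _.
rewrite -(@ge0_integral_translation (fun y => (\1_A (x, y))%:E) (g x)) //.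
  apply/measurable_EFinP; apply: measurableT_comp; first exact: measurable_indic.
  exact: pair1_measurable.
Qed.

Local Notation P := (measurableTypeR R * measurableTypeR R)%type.

(** Meant for the passage to the corner frame, a translation followed by a rotation. Both are
    composed of shears, so no Jacobian formula enters. *)
Definition preserves (T : R * R -> R * R) := measurable_fun [set: P] (T : P -> P) /\
  forall A : set P, measurable A -> mu2 (T @^-1` A) = mu2 A.

Lemma preserves_comp (S T : R * R -> R * R) : preserves S -> preserves T -> preserves (S \o T).
Proof.
move=> [mS hS] [mT hT]; split; first exact: measurableT_comp.
move=> A mA; rewrite comp_preimage hT ?hS //.
by rewrite -[X in measurable X]setTI; exact: mS.
Qed.

Lemma preserves_shear1 g : measurable_fun setT g -> preserves (shear1 g).
Proof. by move=> mg; split; [exact: measurable_shear1|move=> A; exact: mu2_shear1]. Qed.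

Lemma preserves_shear2 g : measurable_fun setT g -> preserves (shear2 g).
Proof. by move=> mg; split; [exact: measurable_shear2|move=> A; exact: mu2_shear2]. Qed.

Lemma preserves_translation (p : R * R) : preserves (fun x => x - p).
Proof.
have -> : (fun x => x - p) = shear1 (cst (- p.1)) \o shear2 (cst (- p.2)).
  by apply/funext => -[x y]; case: p => a b.
by apply: preserves_comp; [apply: preserves_shear1|apply: preserves_shear2]; exact: measurable_cst.
Qed.

(* A rotation by an angle that is not a multiple of pi is a product of three shears. *)
Lemma preserves_rot_neq0 (c s : R) : c ^+ 2 + s ^+ 2 = 1 -> s != 0 -> preserves (Defs.rot c s).
Proof.
move=> cs s0; pose a := (c - 1) / s.
have ml b : measurable_fun [set: R] ( *%R b) by exact: mulrl_measurable.
have -> : Defs.rot c s = shear1 ( *%R a) \o shear2 ( *%R s) \o shear1 ( *%R a).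
  apply/funext => -[x y]; rewrite /Defs.rot /shear1 /shear2 /=.
  have e1 : a * s = c - 1 by rewrite /a divfK.
  have e2 : a * (1 + c) = - s.
    by apply: (mulIf s0); rewrite mulrAC e1; lra.
  congr (_, _).
    transitivity (x * (1 + a * s) + y * (a + a * (1 + a * s))); last by ring.
    have -> : a + a * (1 + a * s) = - s by rewrite e1 -e2; ring.
    by rewrite e1; ring.
  transitivity (x * s + y * (1 + a * s)); last by ring.
  by rewrite e1; ring.
by apply: preserves_comp; [apply: preserves_comp|]; [exact: preserves_shear1|exact: preserves_shear2|exact: preserves_shear1].
Qed.

Lemma preserves_rot (c s : R) : c ^+ 2 + s ^+ 2 = 1 -> preserves (Defs.rot c s).
Proof.
move=> cs; have [s0|s0] := eqVneq s 0; last exact: preserves_rot_neq0.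
have c0 : c != 0 by apply: contra_eq_neq cs => ->; rewrite s0 expr0n addr0 eq_sym oner_eq0.
(* With s = 0 the map is a quarter turn followed by a rotation whose sine - c is nonzero. *)
have -> : Defs.rot c s = Defs.rot s (- c) \o Defs.rot 0 1.
  by apply/funext => -[x y]; rewrite /Defs.rot /= s0; congr (_, _); ring.
apply: preserves_comp; apply: preserves_rot_neq0.
- by rewrite sqrrN addrC.
- by rewrite oppr_eq0.
- by rewrite expr0n expr1n add0r.
- exact: oner_neq0.
Qed.

Let pushforward_mu2 (T : P -> P) (F : P -> \bar R) : preserves T ->
  (\int[pushforward mu2 T]_x F x = \int[mu2]_x F x)%E.
Proof. by move=> [mT hT]; apply: eq_measure_integral => A mA _; exact: hT. Qed.

Lemma preserves_integrable (T : P -> P) (F : P -> R) : preserves T ->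
  mu2.-integrable setT (EFin \o F) -> mu2.-integrable setT (EFin \o (F \o T)).
Proof.
move=> pT /integrableP[mF iF]; have mT := pT.1; apply/integrableP; split.
  by have := measurableT_comp mF mT.
apply: le_lt_trans iF.
have mFa : measurable_fun [set: P] (fun x : P => `|(F x)%:E|%E).
  by have := measurableT_comp (@abse_measurable R setT) mF; apply.
have := pushforward_mu2 (fun x => `|(F x)%:E|%E) pT.
by rewrite (ge0_integral_pushforward mT) // preimage_setT => ->.
Qed.

Lemma preserves_integral (T : P -> P) (F : P -> R) : preserves T ->
  mu2.-integrable setT (EFin \o F) ->
  (\int[mu2]_x (F (T x))%:E = \int[mu2]_x (F x)%:E)%E.
Proof.
move=> pT iF; have iFT := preserves_integrable pT iF; have mT := pT.1.
have mF := measurable_int _ iF.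
have := pushforward_mu2 (fun x => (F x)%:E) pT.
by rewrite (integral_pushforward mT mF) // preimage_setT => ->.
Qed.

End Plane_measure.

(** * Integration in the plane *)

Section Plane_integral.
Context {R : realType}.
Local Notation leb := (@lebesgue_measure R).
Local Notation P := (measurableTypeR R * measurableTypeR R)%type.

Lemma integral_derive (F f : R -> R) (a b : R) : a < b ->
  (forall x, a <= x <= b -> is_derive x 1 F (f x)) ->
  {within `[a, b], continuous f} ->
  (\int[leb]_(x in `[a, b]) (f x)%:E = (F b - F a)%:E)%E.
Proof.
move=> ab dF cf; rewrite (@continuous_FTC2 _ f F) //; last first.
  move=> x; rewrite in_itv /= => /andP[ax xb]; rewrite derive1E.
  by have [_ ->] : is_derive x 1 F (f x) by apply: dF; rewrite !ltW.
have cF x : a <= x <= b -> {for x, continuous F}.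
  move=> xab; apply: differentiable_continuous; apply/derivable1_diffP.
  by case: (dF _ xab).
split.
- by move=> x; rewrite in_itv /= => /andP[ax xb]; case: (dF x) => //; rewrite !ltW.
- by apply: cvg_at_right_filter; apply: cF; rewrite lexx ltW.
- by apply: cvg_at_left_filter; apply: cF; rewrite lexx ltW.
Qed.

Definition box (r : R) : set (R * R) := `[- r, r] `*` `[- r, r].

Lemma boxP r x : box r x <-> `|x.1| <= r /\ `|x.2| <= r.
Proof. by rewrite /box /= !in_itv /= !ler_norml; split=> -[]. Qed.

Lemma measurable_box r : measurable (box r : set P).
Proof. by apply: measurableX; exact: measurable_itv. Qed.

Lemma mu2_box_fin r : (mu2 (box r) < +oo)%E.
Proof.
rewrite /mu2 product_measure1E; try exact: measurable_itv.
rewrite lte_mul_pinfty //= lebesgue_measure_itv /=; last by case: ifP => // _; rewrite -EFinB ltry.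
by case: ifP => // _; rewrite -EFinB.
Qed.

Lemma compact_box r : compact (box r).
Proof. by apply: compact_setX; exact: segment_compact. Qed.

Lemma bounded_on_box r (f : R * R -> R) : (forall x, box r x -> {for x, continuous f}) ->
  exists2 M, 0 <= M & forall x, box r x -> `|f x| <= M.
Proof.
move=> cf; have [r0|r0] := leP 0 r; last first.
  exists 0 => // x /boxP[h _]; have := le_trans (normr_ge0 _) h; lra.
have [||c _ H] := compact_EVT_max (f := fun x => `|f x|) _ (@compact_box r).
- by exists (0, 0); apply/boxP; rewrite normr0.
- apply: continuous_in_subspaceT => x; rewrite inE => bx.
  by apply: cvg_norm; exact: cf.
by exists `|f c| => // x bx; apply: H; rewrite inE.
Qed.

Lemma integrable_bounded_supp r (f : R * R -> R) M : measurable_fun [set: P] (f : P -> R) ->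
  (forall x, ~ box r x -> f x = 0) -> (forall x, `|f x| <= M) ->
  mu2.-integrable setT (EFin \o f).
Proof.
move=> mf f0 fM.
have H : mu2.-integrable (box r) (EFin \o f).
  apply: measurable_bounded_integrable.
  - exact: measurable_box.
  - exact: mu2_box_fin.
  - exact: measurable_funS mf.
  - by exists M; split; [exact: num_real|move=> y My x _ /=; rewrite (le_trans (fM x)) // ltW].
have := (@integrable_mkcond _ P R mu2 (box r) (EFin \o f) (measurable_box r)).1 H.
apply: eq_integrable => // x _; rewrite patchE.
by case: ifPn => //; rewrite notin_setE => /f0 /= ->.
Qed.

Lemma integrable_cont_supp r (f : R * R -> R) : continuous f ->
  (forall x, ~ box r x -> f x = 0) -> mu2.-integrable setT (EFin \o f).
Proof.
move=> cf f0; have [M M0 fM] := bounded_on_box (fun x (_ : box r x) => cf x).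
apply: (@integrable_bounded_supp r _ M) => //.
  exact: continuous_measurable2.
move=> x; have [/fM//|/f0->] := pselect (box r x); by rewrite normr0.
Qed.

Lemma continuous_pair1 (y : R) : continuous (fun s : R => (s, y)).
Proof. by move=> s; exact: (@cvg_pair R R R (nbhs s) (nbhs s) (nbhs y) _ _ _ id (cst y) cvg_id (@cvg_cst _ y _ _ _)). Qed.

Lemma continuous_pair2 (x : R) : continuous (fun s : R => (x, s)).
Proof. by move=> s; exact: (@cvg_pair R R R (nbhs s) (nbhs x) (nbhs s) _ _ _ (cst x) id (@cvg_cst _ x _ _ _) cvg_id). Qed.

Lemma pair_line1 (t y : R) : (t, y) = (0, y) + t *: basis_vec 0 :> R * R.
Proof. by transitivity (0 + t * 1, y + t * 0); [by rewrite mulr1 mulr0 add0r addr0|by []]. Qed.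

Lemma pair_line2 (x t : R) : (x, t) = (x, 0) + t *: basis_vec 1 :> R * R.
Proof. by transitivity (x + t * 0, 0 + t * 1); [by rewrite mulr1 mulr0 add0r addr0|by []]. Qed.

Lemma is_derive_slice1 (f : R * R -> R) t y l : is_derive (t, y) (basis_vec 0) f l ->
  is_derive t 1 (fun s : R => f (s, y)) l.
Proof.
have -> : (fun s : R => f (s, y)) = fun s => f ((0, y) + s *: basis_vec 0).
  by apply/funext => s; rewrite -pair_line1.
by rewrite pair_line1 => H; apply/is_derive_line.
Qed.

Lemma is_derive_slice2 (f : R * R -> R) x t l : is_derive (x, t) (basis_vec 1) f l ->
  is_derive t 1 (fun s : R => f (x, s)) l.
Proof.
have -> : (fun s : R => f (x, s)) = fun s => f ((x, 0) + s *: basis_vec 1).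
  by apply/funext => s; rewrite -pair_line2.
by rewrite pair_line2 => H; apply/is_derive_line.
Qed.

Lemma not_box_open r : open [set x | ~ box r x].
Proof.
have : closed (box r).
  by apply: compact_closed; [exact: norm_hausdorff|exact: compact_box].
by move/closed_openC.
Qed.

Lemma partial_supp r (f : R * R -> R) k : (forall x, ~ box r x -> f x = 0) ->
  forall x, ~ box r x -> partial k f x = 0.
Proof.
move=> f0 x bx; transitivity (partial k (fun=> 0 : R) x).
  apply: partial_congr.
  by have := open_nbhs_nbhs (conj (@not_box_open r) bx : open_nbhs x _); apply: filterS => y /f0.
by rewrite /partial derive_cst.
Qed.

Lemma integral_derive_supp (F f : R -> R) (r : R) : 0 < r ->
  (forall x : R, is_derive x 1 F (f x)) -> continuous f ->
  (forall x, r < `|x| -> F x = 0) -> (forall x, r < `|x| -> f x = 0) ->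
  (\int[leb]_x (f x)%:E = 0)%E.
Proof.
move=> r0 dF cf F0 f0.
have r1 : r < r + 1 by rewrite ltrDl.
transitivity (\int[leb]_(x in `[(- (r + 1))%R, (r + 1)%R]) (f x)%:E)%E.
  rewrite [RHS]integral_mkcond; apply: eq_integral => x _; rewrite patchE.
  case: ifPn => //; rewrite notin_setE /= in_itv /= => /negP H; rewrite f0 //.
  by rewrite ltNge; apply: contra H; rewrite ler_norml => /andP[? ?]; apply/andP; split; lra.
have lt : - (r + 1) < r + 1 by lra.
rewrite (@integral_derive F f _ _ lt (fun x _ => dF x) (continuous_subspaceT cf)).
by rewrite !F0 ?subrr // ?normrN gtr0_norm //; lra.
Qed.

(** Fubini with the variable of differentiation innermost: on each line the integral is a difference
    of two values outside the support. *)
Lemma integral_partial0 (k : 'I_2) (h : R * R -> R) (r : R) : Cn_on 1 setT h ->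
  (forall x, ~ box r x -> h x = 0) -> (\int[mu2]_x partial k h x = 0).
Proof.
move=> Ch h0.
wlog r0 : r h0 / 0 < r.
  move=> /(_ (`|r| + 1)); apply; last by rewrite ltr_wpDl.
  move=> x bx; apply: h0 => /boxP[b1 b2]; apply: bx; apply/boxP.
  by have := ler_norm r; split; lra.
have d0 := partial_supp k h0.
have cp : continuous (partial k h).
  by move=> x; exact: (Cn_on_cont (Cn_on_partial k Ch) (x := x)).
have ip := integrable_cont_supp cp d0.
have dh x : is_derive x (basis_vec k) h (partial k h x) by exact: Cn_on_derive Ch _.
have nb1 s t : r < `|s| -> ~ box r (s, t) by move=> H /boxP[/=]; rewrite leNgt H.
have nb2 s t : r < `|t| -> ~ box r (s, t) by move=> H /boxP[/= _]; rewrite leNgt H.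
rewrite /Rintegral.
have [E|E] := ord2P k; rewrite {}E in d0 cp ip dh *.
  rewrite /mu2 -(integral21_prod_meas1 ip) /=.
  have E y : (\int[leb]_x (partial 0 h (x, y))%:E = 0)%E.
    apply: (@integral_derive_supp (fun s : R => h (s, y)) (fun s => partial 0 h (s, y)) r r0).
    - by move=> s; apply: is_derive_slice1; exact: dh.
    - move=> s; apply: (@continuous_comp _ _ _ (fun s : R => (s, y)) (partial 0 h)); last exact: cp.
      exact: continuous_pair1.
    - by move=> s rs; apply: h0; exact: nb1.
    - by move=> s rs; apply: d0; exact: nb1.
  rewrite (eq_integral (cst 0%E)); last by move=> y _; exact: E.
  by rewrite integral0.
rewrite /mu2 -(integral12_prod_meas1 ip) /=.
have E x : (\int[leb]_y (partial 1 h (x, y))%:E = 0)%E.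
    apply: (@integral_derive_supp (fun s : R => h (x, s)) (fun s => partial 1 h (x, s)) r r0).
    - by move=> s; apply: is_derive_slice2; exact: dh.
    - move=> s; apply: (@continuous_comp _ _ _ (fun s : R => (x, s)) (partial 1 h)); last exact: cp.
      exact: continuous_pair2.
    - by move=> s rs; apply: h0; exact: nb2.
    - by move=> s rs; apply: d0; exact: nb2.
  rewrite (eq_integral (cst 0%E)); last by move=> x _; exact: E.
  by rewrite integral0.
Qed.

End Plane_integral.

(** * Smooth exhaustion and local square integrability *)

Section Exhaustion.
Context {R : realType}.

Lemma Cn_on_prod n (U : set (R * R)) m (f : 'I_m -> R * R -> R) : open U ->
  (forall i, Cn_on n U (f i)) -> Cn_on n U (fun x => \prod_(i < m) f i x).
Proof.
move=> oU; elim: m f => [|m IH] f Hf.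
  by apply: (@Cn_on_congr _ _ _ (fun=> 1)) => //; [move=> x _; rewrite big_ord0|exact: Cn_on_cst].
apply: (@Cn_on_congr _ _ _ (fun x => f ord0 x * \prod_(i < m) f (lift ord0 i) x)) => //.
  by move=> x _; rewrite big_ord_recl.
by apply: Cn_on_mul => //; apply: IH => i; exact: Hf.
Qed.

Definition rbox (q : rat * rat * rat) : set (R * R) :=
  `](ratr q.1.1 - ratr q.2), (ratr q.1.1 + ratr q.2)[ `*`
  `](ratr q.1.2 - ratr q.2), (ratr q.1.2 + ratr q.2)[.

Definition rbump (m : nat) (q : rat * rat * rat) (x : R * R) : R :=
  step (m%:R * (x.1 - (ratr q.1.1 - ratr q.2))) * step (m%:R * (ratr q.1.1 + ratr q.2 - x.1)) *
  (step (m%:R * (x.2 - (ratr q.1.2 - ratr q.2))) * step (m%:R * (ratr q.1.2 + ratr q.2 - x.2))).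

Lemma open_rbox_sub (U : set (R * R)) x : open U -> U x -> exists q, rbox q `<=` U /\ rbox q x.
Proof.
case: x => x y oU Uxy.
have /nbhs_ballP[e /= e0 H] : nbhs (x, y) U by apply: open_nbhs_nbhs.
have /rat_in_itvoo[r] : 0 < e / 2 by rewrite divr_gt0.
rewrite in_itv /= => /andP[r0 re].
have /rat_in_itvoo[q] : x - ratr r < x + ratr r :> R by lra.
rewrite in_itv /= => /andP[q1 q2].
have /rat_in_itvoo[q'] : y - ratr r < y + ratr r :> R by lra.
rewrite in_itv /= => /andP[q3 q4].
exists (q, q', r); split; last by split; rewrite /= in_itv /=; apply/andP; split; lra.
move=> -[u v] [/=]; rewrite !in_itv /= => /andP[u1 u2] /andP[v1 v2].
by apply: H; split => /=; rewrite /ball /= ltr_norml; apply/andP; split; lra.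
Qed.

Lemma rbump01 m q x : 0 <= rbump m q x <= 1.
Proof.
have h (a b : R) : 0 <= a <= 1 -> 0 <= b <= 1 -> 0 <= a * b <= 1.
  by move=> /andP[a0 a1] /andP[b0 b1]; rewrite mulr_ge0 //= mulr_ile1.
have s (t : R) : 0 <= step t <= 1 by rewrite step_ge0 step_le1.
by rewrite /rbump; do 3!(apply: (h) => //).
Qed.

Lemma rbump_out m q x : ~ rbox q x -> rbump m q x = 0.
Proof.
move=> nb; have m0 : 0 <= m%:R :> R by [].
rewrite /rbump.
have [h1|h1] := leP x.1 (ratr q.1.1 - ratr q.2).
  by rewrite step_le0 ?mul0r // mulr_ge0_le0 // subr_le0.
have [h2|h2] := leP (ratr q.1.1 + ratr q.2) x.1.
  by rewrite [X in _ * X * _]step_le0 ?mulr0 ?mul0r // mulr_ge0_le0 // subr_le0.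
have [h3|h3] := leP x.2 (ratr q.1.2 - ratr q.2).
  by rewrite [X in _ * _ * (X * _)]step_le0 ?mulr0 ?mul0r ?mulr0 // mulr_ge0_le0 // subr_le0.
have [h4|h4] := leP (ratr q.1.2 + ratr q.2) x.2.
  by rewrite [X in _ * _ * (_ * X)]step_le0 ?mulr0 ?mul0r ?mulr0 // mulr_ge0_le0 // subr_le0.
by case: nb; split; rewrite /= in_itv /= ?h1 ?h2 ?h3 ?h4.
Qed.

Lemma step_eventually (a : R) : 0 < a -> exists N : nat, forall m, (N <= m)%N -> step (m%:R * a) = 1.
Proof.
move=> a0; exists (Num.bound a^-1) => m Nm; apply: step_ge1.
rewrite -ler_pdivrMr // mul1r; apply: le_trans (ltW (archi_boundP _)) _.
  by rewrite invr_ge0 ltW.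
by rewrite ler_nat.
Qed.

Lemma rbump_in q x : rbox q x -> exists N : nat, forall m, (N <= m)%N -> rbump m q x = 1.
Proof.
move=> -[]; rewrite /= !in_itv /= => /andP[a1 a2] /andP[b1 b2].
have [N1 h1] : exists N : nat, forall m, (N <= m)%N -> step (m%:R * (x.1 - (ratr q.1.1 - ratr q.2))) = 1.
  by apply: step_eventually; rewrite subr_gt0.
have [N2 h2] : exists N : nat, forall m, (N <= m)%N -> step (m%:R * (ratr q.1.1 + ratr q.2 - x.1)) = 1.
  by apply: step_eventually; rewrite subr_gt0.
have [N3 h3] : exists N : nat, forall m, (N <= m)%N -> step (m%:R * (x.2 - (ratr q.1.2 - ratr q.2))) = 1.
  by apply: step_eventually; rewrite subr_gt0.
have [N4 h4] : exists N : nat, forall m, (N <= m)%N -> step (m%:R * (ratr q.1.2 + ratr q.2 - x.2)) = 1.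
  by apply: step_eventually; rewrite subr_gt0.
exists (maxn (maxn N1 N2) (maxn N3 N4)) => m; rewrite !geq_max => /andP[/andP[? ?] /andP[? ?]].
by rewrite /rbump h1 // h2 // h3 // h4 // !mulr1.
Qed.

Lemma Cn_on_rbump n m q : Cn_on n setT (rbump m q).
Proof.
have oT := @openT (R * R)%type.
have s1 (a b : R) : Cn_on n setT (fun x : R * R => step (a * (x.1 - b))).
  apply: Cn_on_step => //; apply: Cn_on_scale => //; apply: Cn_on_sub => //; [exact: Cn_on_fst|exact: Cn_on_cst].
have s2 (a b : R) : Cn_on n setT (fun x : R * R => step (a * (b - x.1))).
  apply: Cn_on_step => //; apply: Cn_on_scale => //; apply: Cn_on_sub => //; [exact: Cn_on_cst|exact: Cn_on_fst].
have s3 (a b : R) : Cn_on n setT (fun x : R * R => step (a * (x.2 - b))).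
  apply: Cn_on_step => //; apply: Cn_on_scale => //; apply: Cn_on_sub => //; [exact: Cn_on_snd|exact: Cn_on_cst].
have s4 (a b : R) : Cn_on n setT (fun x : R * R => step (a * (b - x.2))).
  apply: Cn_on_step => //; apply: Cn_on_scale => //; apply: Cn_on_sub => //; [exact: Cn_on_cst|exact: Cn_on_snd].
by apply: Cn_on_mul => //; apply: Cn_on_mul.
Qed.

(* 1 - prod (1 - bump_n) over the first m rational boxes contained in U. *)
Lemma smooth_exhaustion (U : set (R * R)) : open U -> exists chi : nat -> R * R -> R,
  [/\ (forall m, smooth (chi m)), (forall m x, 0 <= chi m x <= 1),
      (forall m x, ~ U x -> chi m x = 0) &
      (forall x, U x -> exists N : nat, forall m, (N <= m)%N -> chi m x = 1)].
Proof.
move=> oU.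
(* The same m sharpens the bumps and lengthens the product, so at a given point of U it has to
   exceed both the sharpness needed there and the index of a rational box around that point. *)
pose b m n x := if unpickle n is Some q then (if `[< rbox q `<=` U >] then rbump m q x else 0) else 0.
exists (fun m x => 1 - \prod_(n < m) (1 - b m n x)).
have b01 m n x : 0 <= b m n x <= 1.
  rewrite /b; case: unpickle => [q|]; last by rewrite lexx ler01.
  by case: ifP => _; [exact: rbump01|rewrite lexx ler01].
split.
- move=> m n; have oT := @openT (R * R)%type.
  apply: Cn_on_sub => //; first exact: Cn_on_cst.
  apply: Cn_on_prod => // i; apply: Cn_on_sub => //; first exact: Cn_on_cst.
  rewrite /b; case: unpickle => [q|]; last exact: Cn_on_cst.
  case: `[< _ >]; [exact: Cn_on_rbump|exact: Cn_on_cst].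
- move=> m x.
  have /andP[p0 p1] : 0 <= \prod_(n < m) (1 - b m n x) <= 1.
    apply/andP; split; first by apply: prodr_ge0 => i _; case/andP: (b01 m i x) => ? ?; lra.
    by apply: prodr_ile1 => i _; case/andP: (b01 m i x) => ? ?; apply/andP; split; lra.
  by apply/andP; split; lra.
- move=> m x nU; rewrite big1 ?subrr // => i _; rewrite /b.
  case: unpickle => [q|]; last by rewrite subr0.
  case: ifP => [/asboolP qU|_]; last by rewrite subr0.
  by rewrite rbump_out ?subr0 // => /qU.
- move=> x Ux; have [q [qU qx]] := open_rbox_sub oU Ux.
  have [N HN] := rbump_in qx.
  exists (maxn N (pickle q).+1) => m; rewrite geq_max => /andP[Nm qm].
  rewrite (bigD1 (Ordinal qm)) //= {1}/b pickleK ifT; last by apply/asboolP.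
  by rewrite HN // subrr mul0r subr0.
Qed.

(** A zero of a nonnegative function is a minimum. Applied to the exhaustion functions, it shows
    that their gradients also vanish off the open set. *)
Lemma partial_at_zero (f : R * R -> R) k x : smooth f -> (forall y, 0 <= f y) -> f x = 0 ->
  partial k f x = 0.
Proof.
move=> sf f0 fx.
have d (t : R) : is_derive t 1 (fun h : R => f (x + h *: basis_vec k)) (partial k f (x + t *: basis_vec k)).
  by apply/is_derive_line; exact: Cn_on_derive (sf 1%N) _.
have [_ E] := d 0; have [_ E'] : is_derive (0 : R) 1 (fun h : R => f (x + h *: basis_vec k)) 0.
  apply: (@derive1_at_min _ _ (-1) 1) => //.
  - by rewrite in_itv /= ltr01 andbT ltrN10.
  - by move=> t _; rewrite scale0r addr0 fx.
by move: E; rewrite scale0r addr0 E' => <-.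
Qed.

End Exhaustion.

(** * Products with locally square integrable functions *)

Section L2_pairing.
Context {R : realType}.
Local Notation P := (measurableTypeR R * measurableTypeR R)%type.

Lemma enorm_le_sum (x : R * R) : enorm x <= `|x.1| + `|x.2|.
Proof.
rewrite /enorm -[leRHS]ger0_norm ?addr_ge0 // -sqrtr_sqr ler_wsqrtr //.
rewrite -(real_normK (num_real x.1)) -(real_normK (num_real x.2)).
by have := normr_ge0 x.1; have := normr_ge0 x.2; nra.
Qed.

Lemma enorm_ge1 (x : R * R) : `|x.1| <= enorm x.
Proof. by rewrite -sqrtr_sqr ler_wsqrtr // lerDl sqr_ge0. Qed.

Lemma enorm_ge2 (x : R * R) : `|x.2| <= enorm x.
Proof. by rewrite -sqrtr_sqr ler_wsqrtr // lerDr sqr_ge0. Qed.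

Lemma continuous_enorm : continuous (@enorm R).
Proof.
move=> x; have -> : @enorm R = Num.sqrt \o (fun x : R * R => x.1 ^+ 2 + x.2 ^+ 2) by [].
apply: continuous_comp; last exact: sqrt_continuous.
have oT := @openT (R * R)%type.
apply: (Cn_on_cont (n := 0) (U := setT)); last by [].
exact: (Cn_on_add oT (Cn_on_exp 2 oT (Cn_on_fst 0 setT)) (Cn_on_exp 2 oT (Cn_on_snd 0 setT))).
Qed.

Lemma continuous_sub_cst (p : R * R) : continuous (fun x : R * R => x - p).
Proof. by move=> x; apply: cvgB; [exact: cvg_id|exact: cvg_cst]. Qed.

Lemma open_disk p r : open (@disk R p r).
Proof.
have -> : disk p r = (fun x : R * R => enorm (x - p)) @^-1` [set t | t < r] by [].
apply: open_comp; last exact: open_lt.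
move=> x _; have h1 := @continuous_sub_cst p x; have h2 := @continuous_enorm (x - p).
exact: (continuous_comp h1 h2).
Qed.

Lemma disk_supp_box p r (f : R * R -> R) : (forall x, ~ disk p r x -> f x = 0) ->
  forall x, ~ box (`|p.1| + `|p.2| + r) x -> f x = 0.
Proof.
move=> f0 x nb; apply: f0; rewrite /disk /= => xr; apply: nb; apply/boxP.
have h1 := enorm_ge1 (x - p); have h2 := enorm_ge2 (x - p).
have e1 : `|x.1| <= `|(x - p).1| + `|p.1| by apply: le_trans (ler_normD _ _); rewrite subrK.
have e2 : `|x.2| <= `|(x - p).2| + `|p.2| by apply: le_trans (ler_normD _ _); rewrite subrK.
by have := normr_ge0 p.1; have := normr_ge0 p.2; split; lra.
Qed.

Lemma L2loc_box_integrable (f : R * R -> R) r : L2loc_real f ->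
  mu2.-integrable (box r : set P) (fun x => (f x ^+ 2)%:E).
Proof.
move=> [mf if2]; apply: integrableS (if2 (2 * `|r| + 1)).
- by apply: open_measurable2; exact: open_disk.
- exact: measurable_box.
- move=> x /boxP[h1 h2]; rewrite /disk /= subr0.
  by apply: le_lt_trans (enorm_le_sum x) _; have := ler_norm r; lra.
Qed.

(** On the box, |g f| <= K (1 + f^2). *)
Lemma L2loc_mul_integrable (g f : R * R -> R) r K :
  measurable_fun [set: P] (g : P -> R) -> (forall x, ~ box r x -> g x = 0) ->
  (forall x, `|g x| <= K) -> L2loc_real f ->
  mu2.-integrable [set: P] (fun x => (g x * f x)%:E).
Proof.
move=> mg g0 gK Lf; have [mf _] := Lf.
have mf' : measurable_fun [set: P] (f : P -> R) := mf.
have ib := L2loc_box_integrable r Lf.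
have i1 : mu2.-integrable (box r : set P) (EFin \o cst 1).
  apply: measurable_bounded_integrable.
  - exact: measurable_box.
  - exact: mu2_box_fin.
  - exact: measurable_cst.
  - by exists 1; split; [exact: num_real|move=> y My x _ /=; rewrite normr1 ltW].
have i2 : mu2.-integrable (box r : set P) (fun x => (K%:E * (1%:E + (f x ^+ 2)%:E))%E).
  by apply: integrableZl; [exact: measurable_box|apply: integrableD => //; exact: measurable_box].
have mgf : measurable_fun [set: P] (fun x : P => g x * f x : R) by exact: measurable_funM.
have H : mu2.-integrable (box r : set P) (fun x => (g x * f x)%:E).
  apply: le_integrable i2.
  - exact: measurable_box.
  - by apply/measurable_EFinP; exact: measurable_funS mgf.
  - move=> x _; rewrite -EFinD -EFinM !abse_EFin lee_fin.
    have K0 : 0 <= K by apply: le_trans (gK x).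
    rewrite [leLHS]normrM [leRHS]ger0_norm; last by apply: mulr_ge0 => //; rewrite addr_ge0 // sqr_ge0.
    apply: ler_pM => //; rewrite -(real_normK (num_real (f x))).
    by have := normr_ge0 (f x); nra.
have := (@integrable_mkcond _ P R mu2 (box r) (fun x => (g x * f x)%:E) (@measurable_box R r)).1 H.
apply: eq_integrable => // x _; rewrite patchE.
by case: ifPn => //; rewrite notin_setE => /g0 /= ->; rewrite mul0r.
Qed.

Lemma L2loc_continuous (f : R * R -> R) : continuous f -> L2loc_real f.
Proof.
move=> cf; split; first exact: continuous_measurable2.
move=> r; have [M M0 fM] := bounded_on_box (fun x (_ : box r x) => cf x).
apply: (@integrableS _ P R mu2 (box r)); first exact: measurable_box.
- by apply: open_measurable2; exact: open_disk.
- move=> x; rewrite /disk /= subr0 => xr; apply/boxP.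
  by split; apply: le_trans (ltW xr); [exact: enorm_ge1|exact: enorm_ge2].
apply: (@measurable_bounded_integrable _ P R mu2 (fun x => f x ^+ 2)).
- exact: measurable_box.
- exact: mu2_box_fin.
- have mf : measurable_fun [set: P] (f : P -> R) by exact: continuous_measurable2.
  by apply: measurable_funS (measurable_funX 2 mf).
- exists (M ^+ 2); split; first exact: num_real.
  move=> y My x bx /=; rewrite normrX; apply: le_trans (ltW My).
  by rewrite lerXn2r ?nnegrE // fM.
Qed.

Lemma L2loc_add (f g : R * R -> R) : L2loc_real f -> L2loc_real g -> L2loc_real (fun x => f x + g x).
Proof.
move=> [mf if2] [mg ig2].
have mf' : measurable_fun [set: P] (f : P -> R) := mf.
have mg' : measurable_fun [set: P] (g : P -> R) := mg.
have ms : measurable_fun [set: P] (fun x : P => f x + g x : R) by exact: measurable_funD.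
split; first exact: ms.
move=> r; have md : measurable (disk 0 r : set P) by apply: open_measurable2; exact: open_disk.
have i2 : mu2.-integrable (disk 0 r : set P) (fun x => (2%:E * ((f x ^+ 2)%:E + (g x ^+ 2)%:E))%E).
  by apply: integrableZl => //; apply: integrableD.
apply: le_integrable i2 => //.
  by apply/measurable_EFinP; apply: measurable_funS (measurable_funX 2 ms).
move=> x _; rewrite -EFinD -EFinM !abse_EFin lee_fin.
rewrite [leLHS]ger0_norm; last exact: sqr_ge0.
have h1 := sqr_ge0 (f x); have h2 := sqr_ge0 (g x); have h3 := sqr_ge0 (f x - g x).
by rewrite [leRHS]ger0_norm; nra.
Qed.

Lemma L2loc_scale (c : R) (f : R * R -> R) : L2loc_real f -> L2loc_real (fun x => c * f x).
Proof.
move=> [mf if2]; have mf' : measurable_fun [set: P] (f : P -> R) := mf.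
have ms : measurable_fun [set: P] (fun x : P => c * f x : R) by apply: measurable_funM => //; exact: measurable_cst.
split; first exact: ms.
move=> r; have md : measurable (disk 0 r : set P) by apply: open_measurable2; exact: open_disk.
have i2 : mu2.-integrable (disk 0 r : set P) (fun x => ((c ^+ 2)%:E * ((f x ^+ 2)%:E))%E).
  by apply: integrableZl.
by apply: eq_integrable i2 => // x _; rewrite -EFinM exprMn.
Qed.

Lemma L2loc_sub (f g : R * R -> R) : L2loc_real f -> L2loc_real g -> L2loc_real (fun x => f x - g x).
Proof.
move=> Lf Lg; have := L2loc_add Lf (L2loc_scale (-1) Lg).
by have -> : (fun x => f x + -1 * g x) = (fun x => f x - g x) by apply/funext => x; rewrite mulN1r.
Qed.

End L2_pairing.

(** * Weak equations and the transmission identity *)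

Section Identity.
Context {R : realType}.
Local Notation P := (measurableTypeR R * measurableTypeR R)%type.
Implicit Types (f g phi : R * R -> R).

Instance ae_mu2_filter : Filter (nbhs (almost_everywhere (@mu2 R))).
Proof. exact: ae_filter_ringOfSetsType. Qed.

Definition intg f := mu2.-integrable [set: P] (EFin \o (f : P -> R)).
Definition I2 f : R := \int[mu2]_x f x.

Lemma intgD f g : intg f -> intg g -> intg (fun x => f x + g x).
Proof. by move=> hf hg; apply: eq_integrable (integrableD _ hf hg) => // x _; rewrite /= EFinD. Qed.
Lemma intgB f g : intg f -> intg g -> intg (fun x => f x - g x).
Proof. by move=> hf hg; apply: eq_integrable (integrableB _ hf hg) => // x _; rewrite /= EFinB. Qed.
Lemma intgZ c f : intg f -> intg (fun x => c * f x).
Proof. by move=> hf; apply: eq_integrable (integrableZl _ c hf) => // x _; rewrite /= EFinM. Qed.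
Lemma intg0 : intg (fun=> 0).
Proof. exact: integrable0. Qed.
Lemma intg_sum n (h : 'I_n -> R * R -> R) : (forall i, intg (h i)) -> intg (fun x => \sum_(i < n) h i x).
Proof.
elim: n h => [|n IH] h H.
  have -> : (fun x => \sum_(i < 0) h i x) = (fun=> 0) by apply/funext => x; rewrite big_ord0.
  exact: intg0.
have -> : (fun x => \sum_(i < n.+1) h i x) = (fun x => h ord0 x + \sum_(i < n) h (lift ord0 i) x).
  by apply/funext => x; rewrite big_ord_recl.
by apply: intgD => //; apply: IH.
Qed.

Lemma I2D f g : intg f -> intg g -> I2 (fun x => f x + g x) = I2 f + I2 g.
Proof. by move=> hf hg; exact: RintegralD. Qed.
Lemma I2B f g : intg f -> intg g -> I2 (fun x => f x - g x) = I2 f - I2 g.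
Proof. by move=> hf hg; exact: RintegralB. Qed.
Lemma I20 : I2 (fun=> 0) = 0.
Proof. by rewrite /I2 /Rintegral integral0. Qed.
Lemma I2_sum n (h : 'I_n -> R * R -> R) : (forall i, intg (h i)) ->
  I2 (fun x => \sum_(i < n) h i x) = \sum_(i < n) I2 (h i).
Proof.
elim: n h => [|n IH] h H.
  rewrite big_ord0; transitivity (I2 (fun=> 0)); last exact: I20.
  by congr I2; apply/funext => x; rewrite big_ord0.
rewrite big_ord_recl -IH; last by [].
rewrite -I2D //; last by apply: intg_sum.
by congr I2; apply/funext => x; rewrite big_ord_recl.
Qed.

Lemma I2_ae f g : intg f -> measurable_fun [set: P] (g : P -> R) ->
  {ae mu2, forall x, f x = g x} -> intg g /\ I2 f = I2 g.
Proof.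
move=> hf mg fg; have mf := measurable_int _ hf.
have mg' : measurable_fun [set: P] (EFin \o (g : P -> R)) by exact/measurable_EFinP.
have fg' : ae_eq mu2 [set: P] (EFin \o (f : P -> R)) (EFin \o (g : P -> R)).
  by apply: filterS fg => x /= -> _.
split; last by congr (fine _); exact: ae_eq_integral fg'.
apply/integrableP; split => //.
move/integrableP: hf => [_]; congr (_ < _)%E.
apply: ae_eq_integral => //.
- by have := measurableT_comp (@abse_measurable R setT) mf; apply.
- by have := measurableT_comp (@abse_measurable R setT) mg'; apply.
by apply: filterS fg => x /= -> _.
Qed.

Lemma test_smooth phi : test_function phi -> forall n, Cn_on n setT phi.
Proof. by case. Qed.

Lemma test_cont phi : test_function phi -> continuous phi.
Proof. by move=> [s _] x; exact: (Cn_on_cont (s 0%N) (x := x)). Qed.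

Lemma test_box phi : test_function phi -> exists r, forall x, ~ box r x -> phi x = 0.
Proof.
move=> [_ [r h]]; exists r => x nb; apply: h; rewrite ltNge; apply/negP => xr.
by apply: nb; apply/boxP; split; apply: le_trans xr; [exact: enorm_ge1|exact: enorm_ge2].
Qed.

Lemma box_test phi r : smooth phi -> (forall x, ~ box r x -> phi x = 0) -> test_function phi.
Proof.
move=> s h; split => //; exists (`|r| + `|r|) => x xr; apply: h => /boxP[h1 h2].
have := enorm_le_sum x; have := ler_norm r; lra.
Qed.

Lemma test_partial k phi : test_function phi -> test_function (partial k phi).
Proof.
move=> ht; have [r h] := test_box ht; apply: (@box_test _ r).
  by move=> n; apply: Cn_on_partial; exact: (test_smooth ht n.+1).
exact: partial_supp.
Qed.

Lemma smooth_cst (c : R) : smooth (fun=> c : R).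
Proof. by move=> n; exact: Cn_on_cst. Qed.

Lemma test_mul phi g : test_function phi -> smooth g -> test_function (fun x => phi x * g x).
Proof.
move=> ht sg; have [r h] := test_box ht; apply: (@box_test _ r).
  by move=> n; apply: Cn_on_mul; [exact: openT|exact: test_smooth|exact: sg].
by move=> x /h ->; rewrite mul0r.
Qed.

Lemma test_scale c phi : test_function phi -> test_function (fun x => c * phi x).
Proof.
move=> ht; have [r h] := test_box ht; apply: (@box_test _ r).
  by move=> n; apply: Cn_on_scale; [exact: openT|exact: test_smooth].
by move=> x /h ->; rewrite mulr0.
Qed.

Lemma test_add f g : test_function f -> test_function g -> test_function (fun x => f x + g x).
Proof.
move=> [sf [r1 h1]] [sg [r2 h2]]; split.
  by move=> n; apply: Cn_on_add; [exact: openT|exact: sf|exact: sg].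
exists (Num.max r1 r2) => x; rewrite gt_max => /andP[a b]; by rewrite h1 // h2 // addr0.
Qed.

Lemma test_sub f g : test_function f -> test_function g -> test_function (fun x => f x - g x).
Proof.
move=> tf tg; have := test_add tf (test_scale (-1) tg).
by have -> : (fun x => f x + -1 * g x) = (fun x => f x - g x) by apply/funext => x; rewrite mulN1r.
Qed.

Lemma test_sum n (h : 'I_n -> R * R -> R) : (forall i, test_function (h i)) ->
  test_function (fun x => \sum_(i < n) h i x).
Proof.
elim: n h => [|n IH] h H.
  have -> : (fun x => \sum_(i < 0) h i x) = (fun=> 0) by apply/funext => x; rewrite big_ord0.
  by apply: (@box_test _ 0) => //; exact: smooth_cst.
have -> : (fun x => \sum_(i < n.+1) h i x) = (fun x => h ord0 x + \sum_(i < n) h (lift ord0 i) x).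
  by apply/funext => x; rewrite big_ord_recl.
by apply: test_add => //; apply: IH.
Qed.

(** Measurable, locally bounded multipliers, for which the product with a test function and a
    locally square integrable function is integrable. The tensor jumps across the boundary and the
    density is only measurable, so continuity cannot be asked for. *)
Definition coef (c : R * R -> R) := measurable_fun [set: P] (c : P -> R) /\
  forall r, exists2 K, 0 <= K & forall x, box r x -> `|c x| <= K.

Lemma coef_cont c : continuous c -> coef c.
Proof.
move=> cc; split; first exact: continuous_measurable2.
move=> r; have [K K0 h] := bounded_on_box (fun x (_ : box r x) => cc x).
by exists K.
Qed.

Lemma coef_mul c d : coef c -> coef d -> coef (fun x => c x * d x).
Proof.
move=> [mc bc] [md bd]; split; first exact: measurable_funM.
move=> r; have [K K0 HK] := bc r; have [L L0 HL] := bd r; exists (K * L); [exact: mulr_ge0|move=> x bx].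
by rewrite normrM ler_pM // ?HK ?HL.
Qed.

Lemma test_coef phi : test_function phi -> coef phi.
Proof. by move=> h; apply: coef_cont; exact: test_cont. Qed.

Lemma intg_test c phi f : test_function phi -> coef c -> L2loc_real f ->
  intg (fun x => c x * phi x * f x).
Proof.
move=> ht [mc bc] Lf; have [r h] := test_box ht.
have [K K0 HK] := bc r; have [mp bp] := test_coef ht; have [L L0 HL] := bp r.
apply: (@L2loc_mul_integrable R (fun x => c x * phi x) f r (K * L)) => //.
- exact: measurable_funM.
- by move=> x /h ->; rewrite mulr0.
- move=> x; have [bx|nb] := pselect (box r x).
    by rewrite normrM ler_pM // ?HK ?HL.
  by rewrite h // mulr0 normr0 mulr_ge0.
Qed.

Lemma I2_ibp k phi f : test_function phi -> Cn_on 1 setT f ->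
  I2 (fun x => partial k phi x * f x + phi x * partial k f x) = 0.
Proof.
move=> ht Cf; have [r h] := test_box ht.
have Ch : Cn_on 1 setT (fun x => phi x * f x).
  by apply: Cn_on_mul; [exact: openT|exact: test_smooth|].
rewrite -[RHS](@integral_partial0 R k _ r Ch); last by move=> x /h ->; rewrite mul0r.
congr Rintegral; apply/funext => x; apply/esym/partialP.
by apply: is_derive_mul; [exact: (Cn_on_derive _ (test_smooth ht 1%N))|exact: (Cn_on_derive _ Cf)].
Qed.

Lemma intg_cont_test phi f : test_function phi -> continuous f -> intg (fun x => phi x * f x).
Proof.
move=> ht cf; have [r h] := test_box ht; apply: (@integrable_cont_supp R r).
  by move=> x; apply: cvgM; [exact: test_cont|exact: cf].
by move=> x /h ->; rewrite mul0r.
Qed.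

(** By the equation the integrand is the divergence of phi times the stress [s], and the integral of
    each of its terms vanishes by [I2_ibp]. *)
Lemma classical_weak (C0 : 'I_2 -> 'I_2 -> 'I_2 -> R) (u : 'I_2 -> R * R -> R) (u0 : R * R -> R) (kap : R) phi :
  (forall l, Cn_on 2 setT (u l)) -> continuous u0 ->
  (forall x, \sum_j \sum_k \sum_l partial j (fun y => C0 j k l * partial k (u l) y) x + kap * u0 x = 0) ->
  test_function phi ->
  let f x := \sum_j \sum_k \sum_l C0 j k l * partial j phi x * partial k (u l) x - kap * phi x * u0 x in
  intg f /\ I2 f = 0.
Proof.
move=> Cu cu0 eqn ht f; have oT := @openT (R * R)%type.
pose s j x := \sum_k \sum_l C0 j k l * partial k (u l) x.
have Cs j : Cn_on 1 setT (s j).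
  by do 2!(apply: Cn_on_sum => // ?); apply: Cn_on_scale => //; exact: Cn_on_partial.
have ds j x : partial j (s j) x = \sum_k \sum_l partial j (fun y => C0 j k l * partial k (u l) y) x.
  apply: partialP; apply: is_derive_fsum => k; apply: is_derive_fsum => l.
  by apply: (@Cn_on_derive R 0 setT) => //; apply: Cn_on_scale => //; exact: Cn_on_partial.
have E : f = fun x => \sum_j (partial j phi x * s j x + phi x * partial j (s j) x).
  apply/funext => x; rewrite /f big_split /= -mulr_sumr.
  have -> : \sum_i partial i (s i) x = - (kap * u0 x).
    by apply/eqP; rewrite -addr_eq0; apply/eqP; rewrite -[RHS](eqn x); congr (_ + _); apply: eq_bigr.
  rewrite mulrN mulrCA mulrA; congr (_ - _); apply: eq_bigr => j _.
  rewrite /s mulr_sumr; apply: eq_bigr => k _; rewrite mulr_sumr; apply: eq_bigr => l _.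
  by rewrite mulrCA mulrA.
have ii j : intg (fun x => partial j phi x * s j x + phi x * partial j (s j) x).
  apply: intgD; apply: intg_cont_test => //; first exact: test_partial.
    by move=> x; exact: (Cn_on_cont (Cs j) (x := x)).
  by move=> x; exact: (Cn_on_cont (Cn_on_partial j (Cs j)) (x := x)).
rewrite E; split; first exact: intg_sum.
by rewrite I2_sum //; apply: big1 => j _; exact: I2_ibp.
Qed.

Lemma coef_cst (c : R) : coef (fun=> c).
Proof. by apply: coef_cont => x; exact: cvg_cst. Qed.

Lemma coef_indic (A : set P) : measurable A -> coef (\1_A : R * R -> R).
Proof.
move=> mA; split; first exact: measurable_indic.
move=> r; exists 1 => // x _; rewrite indicE ger0_norm //.
by case: (_ \in _).
Qed.

(** v vanishes on U, while H chi_m and its gradient vanish off U, where the nonnegative chi_m has a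
    minimum. Hence the pairing with v is zero for each m. Since chi_m tends to the indicator of U,
    dominated convergence with bound |H w| gives the claim, whatever the boundary of U looks
    like. *)
Lemma weak_gradient_vanishes (U : set (R * R)) (k : 'I_2) (v w : R * R -> R) :
  open U -> L2loc_real v -> L2loc_real w ->
  (forall phi, test_function phi -> I2 (fun x => partial k phi x * v x) = - I2 (fun x => phi x * w x)) ->
  {ae mu2, forall x, U x -> v x = 0} ->
  forall H, test_function H -> intg (fun x => \1_U x * H x * w x) /\ I2 (fun x => \1_U x * H x * w x) = 0.
Proof.
move=> oU Lv Lw hw v0 H tH.
have mU : measurable (U : set P) by exact: open_measurable2.
have iU : intg (fun x => \1_U x * H x * w x) by apply: intg_test => //; exact: coef_indic.
split => //.
have [chi [schi chi01 chi0 chi1]] := smooth_exhaustion oU.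
have tHc m : test_function (fun x => H x * chi m x) by exact: test_mul.
have Z m : I2 (fun x => H x * chi m x * w x) = 0.
  apply/eqP; rewrite -oppr_eq0 -hw //; apply/eqP.
  have i0 : intg (fun=> 0) by exact: intg0.
  have [||_ <-] := @I2_ae (fun=> 0) (fun x => partial k (fun x => H x * chi m x) x * v x) i0; last exact: I20.
    apply: measurable_funM; last by case: Lv.
    by apply: continuous_measurable2; exact: test_cont (test_partial k (tHc m)).
  apply: filterS v0 => x v0; have [Ux|nU] := pselect (U x); first by rewrite v0 // mulr0.
  have -> : partial k (fun x => H x * chi m x) x = 0; last by rewrite mul0r.
  have dH : is_derive x (basis_vec k) H (partial k H x) by exact: (Cn_on_derive _ (test_smooth tH 1%N)).
  have dc : is_derive x (basis_vec k) (chi m) (partial k (chi m) x) by exact: (Cn_on_derive _ (schi m 1%N)).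
  rewrite (partialP (is_derive_mul dH dc)) chi0 // (partial_at_zero k (schi m)) ?mulr0 ?addr0 //.
    by move=> y; case/andP: (chi01 m y).
  exact: chi0.
have iH : intg (fun x => H x * w x).
  have := intg_test tH (coef_cst 1) Lw.
  by have -> : (fun x => 1 * H x * w x) = (fun x => H x * w x) by apply/funext => x; rewrite mul1r.
have mH : measurable_fun [set: P] (H : P -> R) by apply: continuous_measurable2; exact: test_cont.
have mw : measurable_fun [set: P] (w : P -> R) by case: Lw.
have mHw : measurable_fun [set: P] (fun x : P => H x * w x : R) by exact: measurable_funM.
have im m : intg (fun x => H x * chi m x * w x).
  have := intg_test (tHc m) (coef_cst 1) Lw.
  by have -> : (fun x => 1 * (H x * chi m x) * w x) = (fun x => H x * chi m x * w x) by apply/funext => x; rewrite mul1r.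
have [|||||_ _ D] := @dominated_convergence _ P R mu2 setT measurableT
  (fun m x => (H x * chi m x * w x)%:E) (fun x => (\1_U x * H x * w x)%:E) (fun x => `|(H x * w x)%:E|%E).
- by move=> m; case/integrableP: (im m).
- by case/integrableP: iU.
- apply: aeW => x _; have [Ux|nU] := pselect (U x).
    have [N HN] := chi1 x Ux; apply: cvg_near_cst; exists N => // m /= Nm.
    by rewrite HN // mulr1 indicE mem_set // mul1r.
  apply: cvg_near_cst; exists 0%N => // m _ /=.
  by rewrite chi0 // mulr0 indicE memNset // !mul0r.
- exact: (integrable_abse iH).
- apply: aeW => x m _; rewrite !abse_EFin lee_fin !normrM mulrAC ler_piMr ?mulr_ge0 //.
  by case/andP: (chi01 m x) => a b; rewrite ger0_norm.
have Z0 : (fun m => \int[mu2]_x (H x * chi m x * w x)%:E)%E = cst 0%E.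
  apply/funext => m; have := Z m; rewrite /I2 /Rintegral => /(congr1 (@EFin R)); rewrite fineK //.
  by apply: integrable_fin_num => //; exact: im.
move: D; rewrite [X in X @ _]Z0 => D.
have D' : (cst 0%E : nat -> \bar R) @ \oo --> (0 : \bar R)%E by exact: cvg_cst.
have E := cvg_unique (@ereal_hausdorff R) D D'.
by rewrite /I2 /Rintegral E.
Qed.

(** At an exterior point the tensor is c = C0, the density is the factor 1 and v = z = 0. There the
    transmission integrand collapses to the pairing of F - C0 : grad psi with w = g - q. *)
Lemma outside_pairing (c : 'I_2 -> 'I_2 -> 'I_2 -> 'I_2 -> R) (p g q F dF : 'I_2 -> 'I_2 -> R)
    (s a z : 'I_2 -> R) (kap : R) : (forall l, z l = 0) ->
  \sum_k \sum_l (F k l - \sum_i \sum_j c i j k l * p j i) * (g k l - q k l) =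
  \sum_i (- (\sum_j \sum_k \sum_l c i j k l * p j i * g k l) + kap * 1 * s i * (a i + z i) +
    (\sum_j \sum_k \sum_l c i j k l * p j i * q k l - kap * s i * a i)) +
  \sum_k \sum_l (dF k l * z l + F k l * (g k l - q k l)).
Proof. by move=> z0; rewrite !sum2 !z0; ring. Qed.

Section Transmission.
Variables (u v : 'I_2 -> R * R -> R) (G : 'I_2 -> 'I_2 -> R * R -> R)
  (C : tensor_field R) (C0 : tensor R) (rho : R * R -> R) (kappa : R) (Dc : set (R * R)).
Hypothesis closed_Dc : closed Dc.
Hypothesis L2v : forall l, L2loc_real (v l).
Hypothesis L2G : forall k l, L2loc_real (G k l).
Hypothesis C2u : forall l, Cn_on 2 setT (u l).
Hypothesis coefC : forall i j k l, coef (fun x => C x i j k l).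
Hypothesis coef_rho : coef rho.
Hypothesis C_out : forall x, ~ Dc x -> C x = C0.
Hypothesis rho_out : forall x, ~ Dc x -> rho x = 1.
Hypothesis v_out : {ae mu2, forall x, ~ Dc x -> forall l, v l x = 0}.
Hypothesis weakG : forall k l phi, test_function phi ->
  I2 (fun x => partial k phi x * (u l x + v l x)) = - I2 (fun x => phi x * G k l x).
Hypothesis weak_eq : forall i phi, test_function phi ->
  - I2 (fun x => \sum_j \sum_k \sum_l C x i j k l * partial j phi x * G k l x) +
  I2 (fun x => kappa ^+ 2 * rho x * phi x * (u i x + v i x)) = 0.
Hypothesis classical_eq : forall i x,
  \sum_j \sum_k \sum_l partial j (fun y => C0 i j k l * partial k (u l) y) x + kappa ^+ 2 * u i x = 0.

Let w k l x := G k l x - partial k (u l) x.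

Let cu l : continuous (u l).
Proof. by move=> x; exact: (Cn_on_cont (C2u l) (x := x)). Qed.

Let cdu k l : continuous (partial k (u l)).
Proof. by move=> x; exact: (Cn_on_cont (Cn_on_partial k (C2u l)) (x := x)). Qed.

Let L2w k l : L2loc_real (w k l).
Proof. by apply: L2loc_sub => //; exact: L2loc_continuous. Qed.

Let intg1 phi f : test_function phi -> L2loc_real f -> intg (fun x => phi x * f x).
Proof.
move=> ht Lf; have := intg_test ht (coef_cst 1) Lf.
by have -> : (fun x => 1 * phi x * f x) = (fun x => phi x * f x) by apply/funext => x; rewrite mul1r.
Qed.

(** w is the weak gradient of v: the classical gradient of u is subtracted from the weak gradient of
    u + v. *)
Let weakw k l phi : test_function phi ->
  I2 (fun x => partial k phi x * v l x) = - I2 (fun x => phi x * w k l x).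
Proof.
move=> ht; have h1 := weakG k l ht; have h2 := I2_ibp k ht (Cn_on_le (C2u l)).
have tp := test_partial k ht.
have iu : intg (fun x => partial k phi x * u l x) by apply: intg1 => //; exact: L2loc_continuous.
have iv : intg (fun x => partial k phi x * v l x) by exact: intg1.
have idu : intg (fun x => phi x * partial k (u l) x) by apply: intg1 => //; exact: L2loc_continuous.
have iG : intg (fun x => phi x * G k l x) by exact: intg1.
have e1 : I2 (fun x => partial k phi x * (u l x + v l x)) =
    I2 (fun x => partial k phi x * u l x) + I2 (fun x => partial k phi x * v l x).
  by rewrite -I2D //; congr I2; apply/funext => x; rewrite mulrDr.
have e2 : I2 (fun x => phi x * w k l x) = I2 (fun x => phi x * G k l x) - I2 (fun x => phi x * partial k (u l) x).
  by rewrite -I2B //; congr I2; apply/funext => x; rewrite mulrBr.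
move: h1 h2; rewrite e1 e2 I2D //; lra.
Qed.

Variables (psi : 'I_2 -> R * R -> R) (F : 'I_2 -> 'I_2 -> R * R -> R).
Hypothesis psi_test : forall i, test_function (psi i).
Hypothesis F_test : forall k l, test_function (F k l).

(** The sum of three integrands whose integrals over the plane vanish: the weak equation for the
    total field, the tested equation for the incident one, and the statement that w is the weak
    gradient of v, tested with a free matrix F. The freedom in F is used later to cancel the most
    singular factor of w. *)
Definition transmission_integrand (x : R * R) : R :=
  \sum_i (- (\sum_j \sum_k \sum_l C x i j k l * partial j (psi i) x * G k l x) +
     kappa ^+ 2 * rho x * psi i x * (u i x + v i x) +
     (\sum_j \sum_k \sum_l C0 i j k l * partial j (psi i) x * partial k (u l) x -
       kappa ^+ 2 * psi i x * u i x)) +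
  \sum_k \sum_l (partial k (F k l) x * v l x + F k l x * w k l x).

Let T := transmission_integrand.

Let a i x := \sum_j \sum_k \sum_l C x i j k l * partial j (psi i) x * G k l x.
Let b i x := kappa ^+ 2 * rho x * psi i x * (u i x + v i x).
Let c i x := \sum_j \sum_k \sum_l C0 i j k l * partial j (psi i) x * partial k (u l) x -
       kappa ^+ 2 * psi i x * u i x.
Let d k l x := partial k (F k l) x * v l x + F k l x * w k l x.

Let ia i : intg (a i).
Proof.
do 3!(apply: intg_sum => ?); apply: intg_test => //; exact: test_partial.
Qed.

Let ib i : intg (b i).
Proof.
apply: (@intg_test (fun x => kappa ^+ 2 * rho x) (psi i)) => //.
  by apply: coef_mul => //; exact: coef_cst.
by apply: L2loc_add => //; exact: L2loc_continuous.
Qed.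

Let ic i : intg (c i) /\ I2 (c i) = 0.
Proof. exact: (classical_weak C2u (@cu i) (classical_eq i) (psi_test i)). Qed.

Let id_ k l : intg (d k l).
Proof. by apply: intgD; apply: intg1 => //; exact: test_partial. Qed.

Let iT : intg T /\ I2 T = 0.
Proof.
have iab i : intg (fun x => - a i x + b i x + c i x).
  apply: intgD; last by case: (ic i).
  apply: intgD; last exact: ib.
  have := intgZ (-1) (ia i).
  by have -> : (fun x => -1 * a i x) = (fun x => - a i x) by apply/funext => x; rewrite mulN1r.
have e i : I2 (fun x => - a i x + b i x + c i x) = 0.
  have [ci c0] := ic i.
  have ina : intg (fun x => - a i x).
    have := intgZ (-1) (ia i).
    by have -> : (fun x => -1 * a i x) = (fun x => - a i x) by apply/funext => x; rewrite mulN1r.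
  rewrite I2D //; last by apply: intgD.
  rewrite c0 addr0 I2D // -[RHS](weak_eq i (psi_test i)); congr (_ + _).
  have := I2B intg0 (ia i); rewrite I20 sub0r => <-.
  by congr I2; apply/funext => x; rewrite sub0r.
have dk k l : I2 (d k l) = 0.
  rewrite I2D; [|by apply: intg1 => //; exact: test_partial|exact: intg1].
  by rewrite weakw // addNr.
have i1 := intg_sum iab; have i2 := intg_sum (fun k => intg_sum (id_ k)).
split; first exact: (intgD i1 i2).
have -> : I2 T = I2 (fun x => \sum_i (- a i x + b i x + c i x)) + I2 (fun x => \sum_k \sum_l d k l x).
  exact: (I2D i1 i2).
rewrite (I2_sum iab) big1 // add0r (I2_sum (fun k => intg_sum (id_ k))).
by apply: big1 => k _; rewrite (I2_sum (id_ k)); apply: big1.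
Qed.

(** The integral over the plane is zero. Off [Dc] the integrand is almost everywhere a pairing of w
    with test functions, of integral zero because the weak gradient of v vanishes there. The
    difference is the integral over [Dc]; no boundary trace is taken. *)
Theorem transmission_identity :
  intg (fun x => \1_Dc x * transmission_integrand x) /\
  I2 (fun x => \1_Dc x * transmission_integrand x) = 0.
Proof.
have [hT hT0] := iT.
have mDc : measurable (Dc : set P).
  by rewrite -[X in measurable X]setCK; apply: measurableC; apply: open_measurable2; exact: closed_openC.
have oU : open (~` Dc) by exact: closed_openC.
have mT : measurable_fun [set: P] (T : P -> R) by have /integrableP[/measurable_EFinP] := hT.
have mi : measurable_fun [set: P] (\1_Dc : P -> R) by exact: measurable_indic.
have hDT : intg (fun x => \1_Dc x * T x).
  apply: le_integrable hT => //.
    by apply/measurable_EFinP; exact: measurable_funM.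
  move=> x _; rewrite !abse_EFin lee_fin normrM ler_piMl //.
  by rewrite indicE; case: (_ \in _); rewrite ?normr1 ?normr0.
split => //.
pose H k l x := F k l x - \sum_i \sum_j C0 i j k l * partial j (psi i) x.
have tH k l : test_function (H k l).
  apply: test_sub => //; do 2!(apply: test_sum => ?); apply: test_scale; exact: test_partial.
pose V x := \sum_k \sum_l \1_(~` Dc) x * H k l x * w k l x.
have HV k l : intg (fun x => \1_(~` Dc) x * H k l x * w k l x) /\
    I2 (fun x => \1_(~` Dc) x * H k l x * w k l x) = 0.
  apply: (weak_gradient_vanishes oU (L2v l) (L2w k l) (weakw k l)) => //.
  by apply: filterS v_out => x h /h.
have iV : intg V by apply: intg_sum => k; apply: intg_sum => l; case: (HV k l).
have V0 : I2 V = 0.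
  rewrite I2_sum; last by move=> k; apply: intg_sum => l; case: (HV k l).
  apply: big1 => k _; rewrite I2_sum; last by move=> l; case: (HV k l).
  by apply: big1 => l _; case: (HV k l).
have iB : intg (fun x => T x - \1_Dc x * T x) by exact: intgB.
have [_ E] : intg (fun x => T x - \1_Dc x * T x) /\ I2 V = I2 (fun x => T x - \1_Dc x * T x).
  apply: I2_ae => //; first by have /integrableP[/measurable_EFinP] := iB.
  apply: filterS v_out => x vx.
  have [Dx|nDx] := pselect (Dc x).
    rewrite indicE mem_set // mul1r subrr /V big1 // => k _; rewrite big1 // => l _.
    by rewrite indicE memNset ?mul0r //= => /(_ Dx).
  rewrite [X in _ = _ - X * _]indicE memNset // mul0r subr0 /V /T /transmission_integrand.
  have vx' l : v l x = 0 by exact: vx.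
  rewrite C_out // rho_out //.
  under eq_bigr do under eq_bigr do rewrite indicE mem_set // mul1r.
  exact: (outside_pairing C0 (fun j i => partial j (psi i) x) (fun k l => G k l x) (fun k l => partial k (u l) x) (fun k l => F k l x) (fun k l => partial k (F k l) x) (fun i => psi i x) (fun i => u i x) (kappa ^+ 2) vx').
move: E; rewrite V0 I2B // hT0 sub0r => /eqP; rewrite eq_sym oppr_eq0 => /eqP.
exact.
Qed.

End Transmission.

End Identity.

(** * Integrals over strips above a graph *)

Section Strip.
Context {R : realType}.
Local Notation Re := complex.Re.
Local Notation Im := complex.Im.
Local Notation leb := (@lebesgue_measure R).
Local Notation P := (measurableTypeR R * measurableTypeR R)%type.

Lemma continuous_sqr (T : topologicalType) (f : T -> R) x : {for x, continuous f} -> {for x, continuous (fun y => f y ^+ 2)}.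
Proof. by move=> cf; have := cvgM cf cf; exact. Qed.

Lemma continuous_pairing (T : topologicalType) (f g : T -> R) x :
  {for x, continuous f} -> {for x, continuous g} -> {for x, continuous (fun y => (f y, g y))}.
Proof. by move=> cf cg; exact: (@cvg_pair T R R (nbhs x) (nbhs (f x)) (nbhs (g x)) _ _ _ f g cf cg). Qed.

Definition strip (delta H : R) (phi : R -> R) : set (R * R) :=
  [set y | [/\ `|y.1| <= delta, phi y.1 <= y.2 & y.2 <= H]].

Lemma closed_strip delta H phi : continuous phi -> closed (strip delta H phi).
Proof.
move=> cp.
have -> : strip delta H phi = (fun y : R * R => `|y.1|) @^-1` [set t | t <= delta] `&`
   ((fun y : R * R => phi y.1 - y.2) @^-1` [set t | t <= 0] `&` (fun y : R * R => y.2) @^-1` [set t | t <= H]).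
  apply/seteqP; split => y /=; first by case=> ? ? ?; rewrite subr_le0.
  by rewrite subr_le0 => -[? [? ?]].
have c1 : continuous (fun y : R * R => y.1) by move=> y; exact: cvg_fst.
have c2 : continuous (fun y : R * R => y.2) by move=> y; exact: cvg_snd.
apply: closedI; last apply: closedI; (apply: closed_comp; last exact: closed_le).
- by move=> y _; apply: continuous_comp; [exact: c1|exact: norm_continuous].
- by move=> y _; apply: cvgB; [apply: continuous_comp; [exact: c1|exact: cp]|exact: c2].
- by move=> y _; exact: c2.
Qed.

Lemma strip_box delta H phi : continuous phi -> exists r, strip delta H phi `<=` box r.
Proof.
move=> cp.
have [M MH] : exists M, forall t, `|t| <= delta -> `|phi t| <= M.
  have [M _ HM] := @bounded_on_box R delta (fun y => phi y.1) (fun y _ => continuous_comp (@cvg_fst _ _ _ _ _) (cp y.1)).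
  exists M => t td; apply: (HM (t, 0)); apply/boxP; rewrite /= normr0; split => //.
  exact: le_trans td.
exists (`|delta| + `|M| + `|H|) => y [y1 y2 y3]; apply/boxP.
have h1 := ler_norm delta; have h2 := normr_ge0 M; have h3 := normr_ge0 H; have h4 := normr_ge0 delta.
split; first lra.
have := MH _ y1; rewrite ler_norml => /andP[a b]; have := ler_norm M; have := ler_norm H.
by move=> *; rewrite ler_norml; apply/andP; split; lra.
Qed.

Lemma measurable_strip delta H phi : continuous phi -> measurable (strip delta H phi : set P).
Proof.
move=> cp; rewrite -[X in measurable X]setCK; apply: measurableC; apply: open_measurable2.
by apply: closed_openC; exact: closed_strip.
Qed.

Lemma strip_integrable (U : set (R * R)) delta H phi (g : R * R -> R) : continuous phi ->
  open U -> strip delta H phi `<=` U -> (forall y, U y -> {for y, continuous g}) ->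
  intg (fun y => \1_(strip delta H phi) y * g y).
Proof.
move=> cp oU SU cg; set S := strip _ _ _ in SU *.
have mS : measurable (S : set P) by exact: measurable_strip.
have [r Sr] := strip_box delta H cp.
have cS : compact S by apply: subclosed_compact Sr; [exact: closed_strip|exact: compact_box].
have [M MH] : exists M, forall y, S y -> `|g y| <= M.
  have [[s0 Ss0]|nS] := pselect (S !=set0); last by exists 0 => y Sy; case: nS; exists y.
  have [||c _ Hc] := compact_EVT_max (f := fun x => `|g x|) _ cS; first by exists s0.
    apply: continuous_in_subspaceT => x /set_mem Sx.
    by apply: continuous_comp; [exact: cg (SU _ Sx)|exact: norm_continuous].
  by exists `|g c| => y Sy; apply: Hc; exact: mem_set.
apply: (@integrable_bounded_supp R r _ `|M|).
- have -> : (fun y => \1_S y * g y) = g \_ S by apply/funext => y; rewrite patchE indicE; case: (_ \in _); rewrite ?mul1r ?mul0r.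
  apply/(measurable_restrictT _ mS).
  apply: (@measurable_funS _ _ P R (U : set P)) => //; first exact: open_measurable2.
  exact: within_measurable2.
- by move=> x nb; rewrite indicE memNset ?mul0r // => /Sr.
- move=> x; rewrite indicE; have [Sx|nS] := pselect (S x).
    by rewrite mem_set // mul1r (le_trans (MH _ Sx)) // ler_norm.
  by rewrite memNset // mul0r normr0.
Qed.

(** Fubini with the vertical variable innermost, then the fundamental theorem of calculus from the
    graph up to the height H. *)
Lemma strip_integral (U : set (R * R)) delta H phi (G g : R * R -> R) : 0 < delta -> continuous phi ->
  (forall t, `|t| <= delta -> phi t < H) ->
  open U -> strip delta H phi `<=` U -> (forall y, U y -> {for y, continuous g}) ->
  (forall y, strip delta H phi y -> is_derive y.2 1 (fun t => G (y.1, t)) (g y)) ->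
  I2 (fun y => \1_(strip delta H phi) y * g y) =
    \int[leb]_(t in `[- delta, delta]) (G (t, H) - G (t, phi t)).
Proof.
move=> d0 cp pH oU SU cg dG; set S := strip _ _ _ in SU dG *.
have iS : intg (fun y => \1_S y * g y) by exact: strip_integrable SU cg.
rewrite /I2 /Rintegral; congr (fine _).
rewrite /mu2 -(integral12_prod_meas1 iS) /=.
rewrite [RHS]integral_mkcond; apply: eq_integral => x _.
rewrite patchE; case: ifPn => [/set_mem|xd].
  rewrite /= in_itv /= -ler_norml => xd.
  have cgx : {within `[phi x, H], continuous (fun t => g (x, t))}.
    apply: continuous_in_subspaceT => y /set_mem; rewrite /= in_itv /= => /andP[a b].
    apply: (@continuous_comp _ _ _ (fun s : R => (x, s)) g); first exact: continuous_pair2.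
    exact: cg (SU _ _).
  have dGx t : phi x <= t <= H -> is_derive t 1 (fun t => G (x, t)) (g (x, t)).
    by move=> /andP[a b]; exact: (dG (x, t)).
  have <- := integral_derive (pH _ xd) dGx cgx.
  rewrite [RHS]integral_mkcond; apply: eq_integral => y _; rewrite patchE /= indicE.
  have -> : ((x, y) \in S) = (y \in `[phi x, H]%classic).
    by apply/idP/idP => /set_mem; [case=> /= _ a b|rewrite /= in_itv /= => /andP[a b]]; apply/mem_set; rewrite ?/S /= ?in_itv /= ?a ?b.
  by case: (_ \in _); rewrite ?mul1r ?mul0r.
rewrite /fubini_F (eq_integral (cst 0%E)) ?integral0 // => y _ /=; rewrite indicE memNset ?mul0r //.
case=> /= xd' _ _; case/negP: xd; apply/mem_set; by rewrite /= in_itv /= -ler_norml.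
Qed.

Lemma itv_integrable (a b : R) (f : R -> R) : {within `[a, b], continuous f} ->
  leb.-integrable `[a, b] (EFin \o f).
Proof. by apply: continuous_compact_integrable; exact: segment_compact. Qed.

(** The two sides of the corner have to be added before they are estimated: each is of logarithmic
    order, and what decides is the difference coming from the two slopes. *)
Lemma fold_integral (delta : R) (f : R -> R) : 0 < delta ->
  (forall t, `|t| <= delta -> {for t, continuous f}) ->
  \int[leb]_(t in `[- delta, delta]) f t = \int[leb]_(t in `[0, delta]) (f t + f (- t)).
Proof.
move=> d0 cf.
have cw (a b : R) : - delta <= a -> b <= delta -> {within `[a, b], continuous f}.
  move=> da bd; apply: continuous_in_subspaceT => x /set_mem; rewrite /= in_itv /= => /andP[ax xb].
  by apply: cf; rewrite ler_norml; apply/andP; split; lra.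
have i0 := itv_integrable (cw (- delta) delta (lexx _) (lexx _)).
have c1 : {within `[0, delta], continuous f} by apply: cw; rewrite ?lexx // oppr_le0 ltW.
have i1 := itv_integrable c1.
have E : \int[leb]_(t in `[- delta, 0]) f t = \int[leb]_(t in `[0, delta]) f (- t).
  rewrite /Rintegral; congr (fine _).
  have := @integration_by_substitution_oppr R f 0 delta (ltW d0); rewrite oppr0.
  by apply; apply: cw; rewrite ?lexx // ltW.
have c3 : {within `[0, delta], continuous (fun t => f (- t))}.
  apply: continuous_in_subspaceT => x /set_mem; rewrite /= in_itv /= => /andP[a b].
  apply: continuous_comp; first exact: opp_continuous.
  by apply: cf; rewrite normrN ler_norml; apply/andP; split; lra.
rewrite RintegralD //; last exact: itv_integrable.
have i2 : leb.-integrable `]0, delta] (EFin \o f).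
  by apply: integrableS i1 => // x /=; rewrite !in_itv /= => /andP[/ltW -> ->].
rewrite -E addrC -(@Rintegral_itv_obnd_cbnd R 0 (BRight delta) f) //.
have <- := @Rintegral_itvB R f (BLeft (- delta)) (BRight delta) 0 i0.
- by rewrite addrC subrK.
- by rewrite bnd_simp; lra.
- by rewrite bnd_simp ltW.
Qed.

Lemma fold_integrable (delta : R) (f : R -> R) :
  (forall t, `|t| <= delta -> {for t, continuous f}) ->
  leb.-integrable `[0, delta] (EFin \o (fun t => f t + f (- t))).
Proof.
move=> cf; apply: itv_integrable.
apply: continuous_in_subspaceT => x /set_mem; rewrite /= in_itv /= => /andP[a b].
apply: cvgD; first by apply: cf; rewrite ger0_norm.
apply: (@continuous_comp _ _ _ -%R f); first exact: opp_continuous.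
by apply: cf; rewrite normrN ger0_norm.
Qed.

Lemma ln_integral (delta e : R) : 0 < delta -> 0 < e ->
  \int[leb]_(t in `[0, delta]) (t + e)^-1 = ln (delta + e) - ln e.
Proof.
move=> d0 e0.
have D x : 0 <= x <= delta -> is_derive x 1 (fun t => ln (t + e)) (x + e)^-1.
  move=> /andP[x0 _].
  have dl : is_derive (x + e) 1 (@ln R) (x + e)^-1 by apply: is_derive1_ln; lra.
  have ds : is_derive x 1 (fun t : R => t + e) 1 by apply: is_derive_eq; rewrite addr0.
  by have := @is_derive1_comp R (@ln R) (fun t => t + e) x _ _ dl ds; rewrite mulr1.
have c : {within `[0, delta], continuous (fun t : R => (t + e)^-1)}.
  apply: continuous_in_subspaceT => x /set_mem; rewrite /= in_itv /= => /andP[x0 _].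
  by apply: cvgV; [rewrite gt_eqF // ltr_wpDl|apply: cvgD; [exact: cvg_id|exact: cvg_cst]].
by rewrite /Rintegral (integral_derive d0 D c) /= add0r.
Qed.

(** - e / (t + e) is an antiderivative, so the bound does not depend on e: errors of this shape
    never reach logarithmic size. *)
Lemma sqr_integral_le (delta e : R) : 0 < delta -> 0 < e ->
  \int[leb]_(t in `[0, delta]) (e * (t + e)^-1 ^+ 2) <= 1.
Proof.
move=> d0 e0.
have D x : 0 <= x <= delta -> is_derive x 1 (fun t => - e * (t + e)^-1) (e * (x + e)^-1 ^+ 2).
  move=> /andP[x0 _].
  have n0 : x + e != 0 by rewrite gt_eqF // ltr_wpDl.
  have ds : is_derive x 1 (fun t : R => t + e) 1 by apply: is_derive_eq; rewrite addr0.
  have := is_deriveZ (- e) (@is_deriveV R (fun t => t + e) x 1 1 n0 ds).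
  by move=> Hd; apply: (is_derive_eq Hd); rewrite -[_ *: _]/(_ * (_ * _)) mulr1 mulrN mulNr opprK exprVn.
have c : {within `[0, delta], continuous (fun t : R => e * (t + e)^-1 ^+ 2)}.
  apply: continuous_in_subspaceT => x /set_mem; rewrite /= in_itv /= => /andP[x0 _].
  apply: cvgMr; apply: (@continuous_sqr _ (fun t : R => (t + e)^-1)).
  by apply: cvgV; [rewrite gt_eqF // ltr_wpDl|apply: cvgD; [exact: cvg_id|exact: cvg_cst]].
rewrite /Rintegral (integral_derive d0 D c) /=.
by rewrite add0r !mulNr opprK mulfV ?gt_eqF // gerDr oppr_le0 mulr_ge0 ?invr_ge0 ?addr_ge0 // ltW.
Qed.

Lemma lip_continuous (phi : R -> R) (L : R) : 0 <= L ->
  (forall t u, `|phi t - phi u| <= L * `|t - u|) -> continuous phi.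
Proof.
move=> L0 lip t; apply/cvgrPdist_lt => a a0.
have c0 : 0 < a / (L + 1) by rewrite divr_gt0 //; lra.
near=> s; apply: le_lt_trans (lip _ _) _.
have : `|t - s| < a / (L + 1) by near: s; apply: (@cvgr_dist_lt _ R R _ _ (fun s : R => s) t); [exact: cvg_id|].
rewrite ltr_pdivlMr; last lra.
by have := normr_ge0 (t - s); nra.
Unshelve. all: by end_near.
Qed.

(* Above the graph this is comparable to 1 / (|y_1| + |y_2| + e), and it is smooth in y_2. *)
Definition skernel (L e : R) (y : R * R) : R := (y.2 + (L + 1) * `|y.1| + e)^-1.

(** Minus the kernel is a vertical antiderivative of its square. On the graph the kernel is at most
    1 / (|t| + e) by the Lipschitz bound, the value at the top enters with the favourable sign, and
    the two halves of the interval give the factor 2. *)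
Lemma skernel_integral (phi : R -> R) (L delta H e : R) : 0 <= L ->
  (forall t u, `|phi t - phi u| <= L * `|t - u|) -> phi 0 = 0 -> 0 < delta ->
  (forall t, `|t| <= delta -> phi t < H) -> 0 < e ->
  intg (fun y => \1_(strip delta H phi) y * skernel L e y ^+ 2) /\
  I2 (fun y => \1_(strip delta H phi) y * skernel L e y ^+ 2) <= 2 * (ln (delta + e) - ln e).
Proof.
move=> L0 lip p0 d0 pH e0; set S := strip _ _ _.
have cp := lip_continuous L0 lip.
have lp t : `|phi t| <= L * `|t| by have := lip t 0; rewrite p0 !subr0.
pose d (y : R * R) := y.2 + (L + 1) * `|y.1| + e.
have cd : continuous d.
  move=> y; apply: cvgD; last exact: cvg_cst.
  apply: cvgD; first exact: cvg_snd.
  apply: cvgMr; apply: continuous_comp; [exact: cvg_fst|exact: norm_continuous].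
pose U := [set y | 0 < d y].
have oU : open U.
  apply: (@open_comp _ _ d [set t | 0 < t]); last exact: open_gt.
  by move=> y _; exact: cd.
have dS t s : phi t <= s -> `|t| + e <= d (t, s).
  by move=> ps; have := lp t; rewrite ler_norml /d /= => /andP[a _]; nra.
have SU : S `<=` U.
  move=> -[t s] [_ /= h _]; have := dS _ _ h; rewrite /U /=; have := normr_ge0 t; lra.
have ck y : U y -> {for y, continuous (fun y => skernel L e y ^+ 2)}.
  move=> Uy; apply: (@continuous_sqr _ (skernel L e)); apply: cvgV; [by rewrite gt_eqF|exact: cd].
have dG y : S y -> is_derive y.2 1 (fun t => - skernel L e (y.1, t)) (skernel L e y ^+ 2).
  case: y => t s /SU Uy /=.
  have n0 : s + (L + 1) * `|t| + e != 0 by rewrite gt_eqF.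
  have ds : is_derive s 1 (fun s : R => s + (L + 1) * `|t| + e) 1 by apply: is_derive_eq; rewrite !addr0.
  have := is_deriveN (@is_deriveV R (fun s => s + (L + 1) * `|t| + e) s 1 1 n0 ds).
  by move=> Hd; apply: (is_derive_eq Hd); rewrite -[_ *: _]/(_ * _) mulr1 opprK /skernel exprVn.
split; first exact: strip_integrable SU ck.
have -> := strip_integral (G := fun y => - skernel L e y) d0 cp pH oU SU ck dG.
have cf t : `|t| <= delta -> {for t, continuous (fun t => - skernel L e (t, H) - - skernel L e (t, phi t))}.
  move=> td.
  have h s (f : R -> R) : {for t, continuous f} -> phi t <= s -> f t = s -> {for t, continuous (fun t => - skernel L e (t, f t))}.
    move=> cF ps fs; apply: cvgN; apply: cvgV.
      by rewrite /= fs gt_eqF // (lt_le_trans _ (dS _ _ ps)) // ltr_wpDl.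
    apply: cvgD; last exact: cvg_cst.
    apply: cvgD; first exact: cF.
    by apply: cvgMr; exact: norm_continuous.
  apply: cvgB; first by apply: (h H (fun=> H)) => //; [exact: cvg_cst|exact: ltW (pH _ td)].
  by apply: (h (phi t) phi) => //; exact: cp.
rewrite (fold_integral d0 cf) -(ln_integral d0 e0).
have ce : {within `[0, delta], continuous (fun t : R => (t + e)^-1)}.
  apply: continuous_in_subspaceT => x /set_mem; rewrite /= in_itv /= => /andP[x0 _].
  by apply: cvgV; [rewrite gt_eqF // ltr_wpDl|apply: cvgD; [exact: cvg_id|exact: cvg_cst]].
have ie := itv_integrable ce.
rewrite -RintegralZl //; apply: le_Rintegral => //.
- exact: fold_integrable cf.
- by have := integrableZl _ 2 ie; exact.
move=> t /=; rewrite in_itv /= => /andP[t0 td].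
have B s : `|s| = t -> - skernel L e (s, H) - - skernel L e (s, phi s) <= (t + e)^-1.
  move=> st; rewrite opprK addrC lerBlDr -[leLHS]addr0; apply: lerD.
    rewrite lef_pV2 ?posrE; first by rewrite -st; exact: dS.
      by apply: lt_le_trans (dS _ _ (lexx _)); rewrite ltr_wpDl.
    by rewrite ltr_wpDl.
  rewrite invr_ge0; apply: le_trans (dS s H _); first by rewrite addr_ge0 // ltW.
  by apply/ltW/pH; rewrite st.
rewrite mulr_natl mulr2n; apply: lerD; apply: B; by rewrite ?normrN ger0_norm.
Qed.

(* Near the corner the linear form at the boundary point [(t, phi t + e)] is
   [(z0 + m z1) (t + e)] up to [O(sg t + e)]. *)
Lemma linf_graph_approx (z0 z1 : R[i]) (m L : R) : Im (z1 * conjc z0) != 0 -> 0 <= L ->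
  exists2 K, 0 < K & forall sg t h e, 0 <= sg -> 0 <= t -> 0 < e -> `|h| <= L * t -> `|h - m * t| <= sg * t ->
    Normc.normc ((linf z0 z1 (t, h + e))^-1 - ((z0 + m%:C * z1) * (t + e)%:C)^-1) <=
    K * sg / (t + e) + K * (e * (t + e)^-1 ^+ 2).
Proof.
move=> zz L0.
have [M M0 HM] := linf_lower zz.
have kE : z0 + m%:C * z1 = linf z0 z1 (1, m) by rewrite /linf /= mulr1 mulrC [z1 * _]mulrC.
have k0 : linf z0 z1 (1, m) != 0.
  apply/eqP => E; have := HM (1, m); rewrite E Normc.normc0 mulr0 /= normr1.
  by have := normr_ge0 m; lra.
pose c1 := Normc.normc (linf z0 z1 (1, m)); pose c2 := Normc.normc z1.
have c1p : 0 < c1.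
  rewrite lt_neqAle normc_ge0 andbT eq_sym; apply: contra k0 => /eqP/Normc.eq0_normc -> //.
have c20 : 0 <= c2 := normc_ge0 _.
pose B := M * (1 + L) / c1.
have B0 : 0 < B by rewrite divr_gt0 // mulr_gt0 //; lra.
exists (B * (c1 + c2 + 1)); first by rewrite mulr_gt0 //; lra.
move=> sg t h e sg0 t0 e0 hL hm.
have te : 0 < t + e by lra.
set D := linf z0 z1 (t, h + e).
have lowD : t + e <= M * (1 + L) * Normc.normc D.
  have := HM (t, h + e); rewrite /= -/D (ger0_norm t0) => H1.
  have : e <= `|h + e| + `|h|.
    by have := ler_normB (h + e) h; rewrite [h + e - h]addrAC subrr add0r (gtr0_norm e0).
  rewrite [M * (1 + L)]mulrC -mulrA; have := normr_ge0 (h + e); nra.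
have D0 : D != 0.
  apply/eqP => E; move: lowD; rewrite E Normc.normc0 mulr0; lra.
have tec : (t + e)%:C != 0 :> R[i] by rewrite (_ : 0 = 0%:C) // (inj_eq (@complexI R)) gt_eqF.
rewrite kE.
(* Over the common denominator the numerator contains only e and the deviation of h from its
   tangent, by [DE] below. *)
have -> : D^-1 - (linf z0 z1 (1, m) * (t + e)%:C)^-1 =
    (linf z0 z1 (1, m) * e%:C - z1 * (h - m * t + e)%:C) * D^-1 * (linf z0 z1 (1, m))^-1 * ((t + e)%:C)^-1.
  have DE : D = linf z0 z1 (1, m) * t%:C + z1 * (h - m * t + e)%:C.
    by rewrite /D /linf /= !rmorphD /= rmorphN rmorphM /=; ring.
  have : linf z0 z1 (1, m) * t%:C + z1 * (h - m * t + e)%:C != 0 by rewrite -DE.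
  have tE : (t + e)%:C = t%:C + e%:C by rewrite rmorphD.
  rewrite DE tE; rewrite tE in tec.
  move: (linf _ _ _) (t%:C) (e%:C) ((h - m * t + e)%:C) k0 tec => k a b w k0 ab d0; field.
  by rewrite k0 ab d0.
rewrite !Normc.normcM !Normc.normcV.
have nc (a : R) : Normc.normc a%:C = `|a| by rewrite /= expr0n addr0 sqrtr_sqr.
rewrite nc (gtr0_norm te) -/c1.
have num : Normc.normc (linf z0 z1 (1, m) * e%:C - z1 * (h - m * t + e)%:C) <= (c1 + c2) * e + c2 * (sg * t).
  apply: le_trans (le_normcD _ _) _; rewrite normcN !Normc.normcM !nc -/c1 -/c2 (gtr0_norm e0).
  have : `|h - m * t + e| <= sg * t + e by apply: le_trans (ler_normD _ _) _; rewrite (gtr0_norm e0) lerD2r.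
  by nra.
have iD : (Normc.normc D)^-1 <= M * (1 + L) / (t + e).
  have ND : 0 < Normc.normc D by rewrite lt_neqAle normc_ge0 andbT eq_sym; apply: contra D0 => /eqP/Normc.eq0_normc ->.
  by rewrite ler_pdivlMr // mulrC ler_pdivrMr.
apply: (@le_trans _ _ (((c1 + c2) * e + c2 * (sg * (t + e))) * (M * (1 + L) / (t + e)) * c1^-1 * (t + e)^-1)).
  rewrite !ler_wpM2r ?invr_ge0 ?(ltW te) ?(ltW c1p) //.
  apply: ler_pM; rewrite ?normc_ge0 ?invr_ge0 ?normc_ge0 //.
  by apply: le_trans num _; rewrite lerD2l !ler_wpM2l //; lra.
have -> : ((c1 + c2) * e + c2 * (sg * (t + e))) * (M * (1 + L) / (t + e)) * c1^-1 * (t + e)^-1 =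
   B * (c1 + c2) * (e * (t + e)^-1 ^+ 2) + B * c2 * sg / (t + e).
  by rewrite /B; field; rewrite !gt_eqF.
rewrite addrC; apply: lerD.
  by rewrite ler_wpM2r ?invr_ge0 ?(ltW te) // ler_wpM2r // ler_wpM2l ?(ltW B0) //; lra.
apply: ler_wpM2r; first by rewrite mulr_ge0 ?sqr_ge0 ?(ltW e0).
by apply: ler_wpM2l; [exact: ltW|lra].
Qed.

Lemma linf_neq0 (z0 z1 : R[i]) x : Im (z1 * conjc z0) != 0 -> x != 0 -> linf z0 z1 x != 0.
Proof.
move=> zz x0; apply/eqP => E; have [M M0 HM] := linf_lower zz.
have := HM x; rewrite E Normc.normc0 mulr0 => h.
have : `|x.1| + `|x.2| == 0 by rewrite eq_le h addr_ge0.
rewrite paddr_eq0 // !normr_eq0 => /andP[/eqP a /eqP b]; case/eqP: x0.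
by case: x a b {E h} => /= ? ? -> ->.
Qed.

Lemma continuous_linfV (z0 z1 b : R[i]) k x : Im (z1 * conjc z0) != 0 -> x != 0 ->
  {for x, continuous (fun x => Re (b * (linf z0 z1 x)^-1 ^+ k))}.
Proof.
move=> zz x0; have oN := @open_neq0 R.
have C1 : cCn_on 0 [set x : R * R | x != 0] (fun x => (linf z0 z1 x)^-1).
  by apply: cCn_inv; [exact: oN|move=> y; exact: linf_neq0|exact: cCn_linf].
have [C _] := cCn_mul oN (cCn_cst 0 _ b) (cCn_exp k oN C1).
exact: (Cn_on_cont C).
Qed.

Lemma cst_itv_integral (delta c : R) : 0 < delta -> \int[leb]_(t in `[0, delta]) c = c * delta.
Proof.
move=> d0.
have D x : 0 <= x <= delta -> is_derive x 1 (fun t => c * t) c.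
  by move=> _; apply: is_derive_eq; rewrite -[_ *: _]/(_ * _) mulr1.
have cc : {within `[0, delta], continuous (fun t : R => c)} by move=> ?; exact: cvg_cst.
by rewrite /Rintegral (integral_derive d0 D cc) /= mulr0 subr0.
Qed.

(** With W the inverse linear form, - beta W is a vertical antiderivative of beta z1 W^2, so only
    its values on the graph and on the top edge count. Near the corner W on the graph is close to 1
    / ((z0 + mp z1) (t + e)) on the right and, at - t, to - 1 / ((z0 + mm z1) (t + e)) on the left.
    The sum does not cancel because the slopes differ. *)
Lemma corner_integral (z0 z1 : R[i]) (phi : R -> R) (L mp mm : R) : Im (z1 * conjc z0) != 0 ->
  0 <= L -> (forall t u, `|phi t - phi u| <= L * `|t - u|) -> phi 0 = 0 -> mp != mm ->
  (forall sg, 0 < sg -> exists2 d, 0 < d & forall t, 0 <= t <= d ->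
     `|phi t - mp * t| <= sg * t /\ `|phi (- t) + mm * t| <= sg * t) ->
  exists beta, exists2 d, 0 < d & forall delta H, 0 < delta <= d ->
    (forall t, `|t| <= delta -> phi t < H) ->
    exists K, forall e, 0 < e ->
      (ln (delta + e) - ln e) / 2 - K <=
      I2 (fun y => \1_(strip delta H phi) y *
                     Re (beta * z1 * (linf z0 z1 (y.1, y.2 + e))^-1 ^+ 2)).
Proof.
move=> zz L0 lip p0 mpm slopes.
have cp := lip_continuous L0 lip.
have lp t : `|phi t| <= L * `|t| by have := lip t 0; rewrite p0 !subr0.
have [M M0 HM] := linf_lower zz.
have lin0 x := @linf_neq0 z0 z1 x zz.
have zz' : Im (z1 * conjc (- z0)) != 0.
  have -> : conjc (- z0) = - conjc z0 by case: (z0).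
  by rewrite mulrN; case: (z1 * _) zz => a b /=; rewrite oppr_eq0.
have [K1 K10 H1] := linf_graph_approx mp zz L0.
have [K2 K20 H2] := linf_graph_approx (- mm) zz' L0.
have kE m : z0 + m%:C * z1 = linf z0 z1 (1, m) by rewrite /linf /= mulr1 mulrC [z1 * _]mulrC.
have k0 m : z0 + m%:C * z1 != 0.
  rewrite kE; apply: lin0; apply/eqP => -[/eqP]; by rewrite oner_eq0.
have z10 : z1 != 0 by apply: contraNneq zz => ->; rewrite mul0r.
(* The coefficient of 1 / (t + e) after folding; [beta], its inverse, normalises it to 1. *)
pose kappa := (z0 + mp%:C * z1)^-1 - (z0 + mm%:C * z1)^-1.
have ka0 : kappa != 0.
  rewrite subr_eq0; apply/eqP => /invr_inj /addrI /(mulIf z10) /(@complexI R) E.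
  by rewrite E eqxx in mpm.
pose beta := kappa^-1; pose nb := Normc.normc beta.
have nb0 : 0 <= nb := normc_ge0 _.
(* With this tolerance the slope errors of both sides cost at most half of the main coefficient,
   hence the 1/2 in the conclusion. *)
pose sg := (2 * (nb * (K1 + K2) + 1))^-1.
have KK : 0 <= nb * (K1 + K2) by rewrite mulr_ge0 // addr_ge0 // ltW.
have sg0 : 0 < sg by rewrite invr_gt0; lra.
have sgE : nb * (K1 + K2) * sg <= 2^-1.
  by rewrite /sg invfM mulrCA ler_piMr // ?invr_ge0 // ler_pdivrMr ?mul1r; lra.
have [d d0 Hd] := slopes sg sg0.
exists beta; exists d => // delta H /andP[de0 ded] pH.
have H0 : 0 < H by have := pH 0; rewrite normr0 p0; apply; exact: ltW.
(* [K3] multiplies e / (t + e)^2, of integral at most 1; [K4] bounds the two values on the top edge,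
   where the inverse linear form is at most M / H. *)
pose K3 := nb * (K1 + K2); pose K4 := 2 * nb * M / H.
exists (K3 + K4 * delta) => e e0.
pose W (y : R * R) := (linf z0 z1 (y.1, y.2 + e))^-1.
pose G (y : R * R) := Re (- beta * W y).
set S := strip _ _ _.
pose sh (y : R * R) : R * R := (y.1, y.2 + e).
have csh : continuous sh.
  move=> y; apply: continuous_pairing; first exact: cvg_fst.
  by apply: cvgD; [exact: cvg_snd|exact: cvg_cst].
pose U := [set y | sh y != 0].
have oU : open U by apply: (@open_comp _ _ sh [set x | x != 0]); [move=> y _; exact: csh|exact: open_neq0].
have SU : S `<=` U.
  move=> -[t s] [_ /= ps _]; apply/eqP => -[t0 se]; move: ps; rewrite t0 p0; lra.
pose g z := Re (beta * z1 * (linf z0 z1 z)^-1 ^+ 2).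
have cg y : U y -> {for y, continuous (fun y => g (sh y))}.
  move=> Uy; apply: (@continuous_comp _ _ _ sh g); first exact: csh.
  exact: continuous_linfV zz Uy.
have dG y : S y -> is_derive y.2 1 (fun t => G (y.1, t)) (g (sh y)).
  case: y => t s /SU Uy /=.
  have ds : is_derive s 1 (fun s : R => s + e) 1 by apply: is_derive_eq; rewrite addr0.
  have dl := is_derive_slice2 (is_derive_linfV 1 (lin0 _ Uy) (- beta)).
  have := @is_derive1_comp R _ (fun s : R => s + e) s _ _ dl ds.
  by rewrite mulr1 opprK.
have -> := strip_integral (G := G) de0 cp pH oU SU cg dG.
have cG t s : sh (t, s) != 0 -> {for (t, s), continuous G}.
  move=> sn; apply: (@continuous_comp _ _ _ sh (fun z => Re (- beta * (linf z0 z1 z)^-1))); first exact: csh.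
  exact: (@continuous_linfV z0 z1 (- beta) 1 _ zz sn).
have nz t s : `|s| <= L * `|t| -> sh (t, s) != 0.
  by move=> st; apply/eqP => -[t0 se]; move: st; rewrite t0 normr0 mulr0 normr_le0 => /eqP; lra.
have nH t : sh (t, H) != 0 by apply/eqP => -[_]; lra.
pose f t := G (t, H) - G (t, phi t).
have cf t : `|t| <= delta -> {for t, continuous f}.
  move=> td; apply: cvgB.
    apply: (@continuous_comp _ _ _ (fun t => (t, H)) G); last exact: cG.
    exact: continuous_pair1.
  apply: (@continuous_comp _ _ _ (fun t => (t, phi t)) G); last by apply: cG; exact: nz.
  by apply: (@continuous_pairing _ id phi); [exact: cvg_id|exact: cp].
rewrite (fold_integral de0 cf).
have ci (c : R) : {within `[0, delta], continuous (fun t : R => c)} by move=> ?; exact: cvg_cst.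
have cv : {within `[0, delta], continuous (fun t : R => (t + e)^-1)}.
  apply: continuous_in_subspaceT => x /set_mem; rewrite /= in_itv /= => /andP[x0 _].
  by apply: cvgV; [rewrite gt_eqF // ltr_wpDl|apply: cvgD; [exact: cvg_id|exact: cvg_cst]].
have cv2 : {within `[0, delta], continuous (fun t : R => e * (t + e)^-1 ^+ 2)}.
  apply: continuous_in_subspaceT => x /set_mem; rewrite /= in_itv /= => /andP[x0 _].
  apply: cvgMr; apply: (@continuous_sqr _ (fun t : R => (t + e)^-1)).
  by apply: cvgV; [rewrite gt_eqF // ltr_wpDl|apply: cvgD; [exact: cvg_id|exact: cvg_cst]].
have iv := itv_integrable cv; have iv2 := itv_integrable cv2; have i4 := itv_integrable (ci K4).
pose low t := 2^-1 * (t + e)^-1 - K3 * (e * (t + e)^-1 ^+ 2) - K4.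
have ihv : leb.-integrable `[0, delta] (EFin \o (fun t => 2^-1 * (t + e)^-1)) by have := integrableZl _ 2^-1 iv; exact.
have ik3 : leb.-integrable `[0, delta] (EFin \o (fun t => K3 * (e * (t + e)^-1 ^+ 2))) by have := integrableZl _ K3 iv2; exact.
have i12 : leb.-integrable `[0, delta] (EFin \o (fun t => 2^-1 * (t + e)^-1 - K3 * (e * (t + e)^-1 ^+ 2))) by have := integrableB _ ihv ik3; exact.
have ilow : leb.-integrable `[0, delta] (EFin \o low) by have := integrableB _ i12 i4; exact.
apply: (@le_trans _ _ (\int[leb]_(t in `[0, delta]) low t)).
  rewrite /low RintegralB // RintegralB // RintegralZl // RintegralZl // ln_integral //.
  rewrite cst_itv_integral //.
  rewrite mulrC -addrA lerD2l -opprD lerN2 lerD2r.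
  by rewrite -[leRHS]mulr1 ler_wpM2l // sqr_integral_le.
apply: le_Rintegral => //; first exact: fold_integrable.
move=> t /=; rewrite in_itv /= => /andP[t0 td].
have /Hd[s1 s2] : 0 <= t <= d by rewrite t0 (le_trans td).
have te : 0 < t + e by rewrite ltr_wpDl.
have WH s : `|Re (- beta * W (s, H))| <= nb * M / H.
  apply: le_trans (Re_le_normc _) _; rewrite Normc.normcM normcN -/nb -mulrA ler_wpM2l //.
  rewrite Normc.normcV.
  have := HM (s, H + e) => /= h.
  have h' : H <= M * Normc.normc (linf z0 z1 (s, H + e)).
    by apply: le_trans h; rewrite (ger0_norm (ltW (addr_gt0 H0 e0))) -[leLHS]add0r lerD // lerDl ltW.
  have n0 : 0 < Normc.normc (linf z0 z1 (s, H + e)).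
    by rewrite -(pmulr_rgt0 _ M0); exact: lt_le_trans h'.
  by rewrite ler_pdivlMr // mulrC ler_pdivrMr.
have A1 : Normc.normc (W (t, phi t) - ((z0 + mp%:C * z1) * (t + e)%:C)^-1) <=
    K1 * sg / (t + e) + K1 * (e * (t + e)^-1 ^+ 2).
  by have := lp t; rewrite (ger0_norm t0) => lt; exact: H1 (ltW sg0) t0 e0 lt s1.
have A2 : Normc.normc (W (- t, phi (- t)) - ((- z0 + (- mm)%:C * z1) * (t + e)%:C)^-1) <=
    K2 * sg / (t + e) + K2 * (e * (t + e)^-1 ^+ 2).
  have -> : W (- t, phi (- t)) = (linf (- z0) z1 (t, phi (- t) + e))^-1.
    by rewrite /W /linf /= rmorphN mulrN mulNr.
  have := lp (- t); rewrite normrN (ger0_norm t0) => lt.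
  by apply: H2 (ltW sg0) t0 e0 lt _; rewrite mulNr opprK.
have lowW w a r : Normc.normc (w - a) <= r -> Re (beta * a) - nb * r <= Re (beta * w).
  move=> h; rewrite lerBlDr -lerBlDl.
  have -> : Re (beta * a) - Re (beta * w) = - Re (beta * (w - a)) by rewrite mulrBr raddfB opprB.
  apply: le_trans (ler_norm _) _; rewrite normrN; apply: le_trans (Re_le_normc _) _.
  by rewrite Normc.normcM ler_wpM2l.
have B1 := lowW _ _ _ A1; have B2 := lowW _ _ _ A2.
have tec : (t + e)%:C != 0 :> R[i] by rewrite (_ : 0 = 0%:C) // (inj_eq (@complexI R)) gt_eqF.
have main : Re (beta * ((z0 + mp%:C * z1) * (t + e)%:C)^-1) +
    Re (beta * ((- z0 + (- mm)%:C * z1) * (t + e)%:C)^-1) = (t + e)^-1.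
  rewrite -ReD -mulrDr.
  have -> : ((- z0 + (- mm)%:C * z1) * (t + e)%:C)^-1 = - ((z0 + mm%:C * z1) * (t + e)%:C)^-1.
    by rewrite rmorphN mulNr -opprD mulNr invrN.
  rewrite !invfM -mulrBl -/kappa mulrA mulVf // mul1r.
  by rewrite -fmorphV.
have r1 : Re (- beta * W (t, phi t)) = - Re (beta * W (t, phi t)) by rewrite mulNr raddfN.
have r2 : Re (- beta * W (- t, phi (- t))) = - Re (beta * W (- t, phi (- t))) by rewrite mulNr raddfN.
rewrite /low /f /G r1 r2 !opprK.
have := WH t; have := WH (- t); rewrite !ler_norml => /andP[w1 _] /andP[w2 _].
have sE : nb * (K1 * sg / (t + e) + K1 * (e * (t + e)^-1 ^+ 2)) + nb * (K2 * sg / (t + e) + K2 * (e * (t + e)^-1 ^+ 2))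
   = (nb * (K1 + K2) * sg) * (t + e)^-1 + K3 * (e * (t + e)^-1 ^+ 2) by rewrite /K3; ring.
have sE2 : (nb * (K1 + K2) * sg) * (t + e)^-1 <= 2^-1 * (t + e)^-1 by rewrite ler_wpM2r // invr_ge0 ltW.
have K4E : K4 = nb * M / H + nb * M / H by rewrite /K4; ring.
clear - B1 B2 main w1 w2 sE sE2 K4E; lra.
Qed.

End Strip.

(** * Boundary corners *)

Section Calculus1.
Context {R : realType}.
Implicit Types (f a b phi : R -> R).

(** Both directions pass through Caratheodory's slope function; this form suits functions given
    piecewise. *)
Lemma is_derive_eps f (x l : R) : is_derive x 1 f l <->
  forall sg, 0 < sg -> exists2 d, 0 < d & forall z, `|z - x| <= d ->
    `|f z - f x - l * (z - x)| <= sg * `|z - x|.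
Proof.
split.
  move=> /is_derive1_caratheodory [g [fE gC gxE]] sg sg0.
  have : \forall z \near x, `|g x - g z| < sg by exact: (@cvgr_dist_lt _ R R _ _ g (g x) gC _ sg0).
  move=> /nbhs_ballP[d /= d0 H]; exists (d / 2); first by rewrite divr_gt0.
  move=> z zd; have : `|g x - g z| < sg.
    apply: H; rewrite /ball /= distrC; apply: le_lt_trans zd _; rewrite /Num.norm /=; lra.
  by rewrite fE -gxE -mulrBl normrM distrC => h; rewrite ler_wpM2r // ltW.
move=> H; apply/is_derive1_caratheodory.
pose g z := if z == x then l else (f z - f x) / (z - x).
exists g; rewrite /g eqxx; split => //.
  move=> z; case: eqVneq => [->|zx]; first by rewrite !subrr mulr0.
  by rewrite divfK // subr_eq0.
apply/cvgrPdist_lt => e e0.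
have e20 : 0 < e / 2 by rewrite divr_gt0.
have [d d0 Hd] := H _ e20.
apply/nbhs_ballP; exists d => //= z; rewrite /ball /= eqxx => zd.
have [E|zx] := eqVneq z x; first by rewrite subrr normr0.
have zx0 : z - x != 0 by rewrite subr_eq0.
have /Hd : `|z - x| <= d by rewrite distrC; exact: ltW.
rewrite [X in _ -> X < _]distrC.
have -> : f z - f x - l * (z - x) = ((f z - f x) / (z - x) - l) * (z - x) by field.
rewrite normrM ler_pM2r ?normr_gt0 // => h; apply: le_lt_trans h _; lra.
Qed.

Lemma is_derive1_cont f (x l : R) : is_derive x 1 f l -> {for x, continuous f}.
Proof. by move=> [df _]; apply: differentiable_continuous; apply/derivable1_diffP. Qed.

Lemma C1_fun_derive f (x : R) : C1_fun f -> is_derive x 1 f (derive1 f x).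
Proof. by move=> [df _]; rewrite derive1E; exact: derivableP. Qed.

Lemma C1_funP f (df : R -> R) : (forall x : R, is_derive x 1 f (df x)) -> continuous df -> C1_fun f.
Proof.
move=> Df cdf; split => [t|]; first by case: (Df t).
by have -> : derive1 f = df by apply/funext => t; rewrite derive1E; case: (Df t).
Qed.

Lemma near_itv0 (P : R -> Prop) : (\forall t \near (0 : R), P t) -> exists2 d, 0 < d & forall t, `|t| <= d -> P t.
Proof.
move=> /nbhs_ballP[d /= d0 H]; exists (d / 2); first by rewrite divr_gt0.
move=> t td; apply: H; rewrite /ball /= sub0r normrN; apply: le_lt_trans td _; lra.
Qed.

(** Near 0 the function a is strictly increasing with a C^1 inverse, and b composed with this
    inverse is [Phi]. It is defined on both sides of 0 since a and b are C^1 on the line, but it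
    agrees with phi only for y >= 0, where the parameter lies on the arc. *)
Lemma graph_arc a b phi (eta : R) : C1_fun a -> C1_fun b -> a 0 = 0 -> 0 < derive1 a 0 -> 0 < eta ->
  (forall t, 0 <= t <= eta -> b t = phi (a t)) ->
  exists2 d, 0 < d & exists Phi psi : R -> R,
    [/\ (forall y : R, `|y| <= d -> is_derive y 1 Phi (psi y)),
        (forall y : R, `|y| <= d -> {for y, continuous psi}) &
        (forall y : R, 0 <= y <= d -> phi y = Phi y /\ exists2 t, 0 <= t <= eta & a t = y)].
Proof.
move=> C1a C1b a0 da0 eta0 bphi.
have ca x : {for x, continuous a} := is_derive1_cont (C1_fun_derive x C1a).
have [e1 e10 He1] : exists2 d, 0 < d & forall t, `|t| <= d -> 0 < derive1 a t.
  apply: near_itv0; have := C1a.2 0 => /(_ [set y | 0 < y]); apply.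
  exact: (open_nbhs_nbhs (conj (@open_gt _ 0) da0)).
pose e := Num.min e1 eta.
have e0 : 0 < e by rewrite lt_min e10.
have ee1 : e <= e1 by rewrite ge_min lexx.
have eeta : e <= eta by rewrite ge_min lexx orbT.
have inc s t : - e <= s -> s < t -> t <= e -> a s < a t.
  move=> es st te.
  have cw : {within `[s, t], continuous a} by apply: continuous_in_subspaceT => x _; exact: ca.
  have [c] := MVT st (fun x _ => C1_fun_derive x C1a) cw.
  rewrite in_itv /= => /andP[sc ct] E.
  by rewrite -subr_gt0 E mulr_gt0 ?subr_gt0 // He1 // ler_norml; apply/andP; split; lra.
(* The local inverse of a, taking the default 0 outside a([-e, e]); the final radius d stays inside
   that range. *)
pose f y := xget 0 [set t | `|t| <= e /\ a t = y].
have fK t : `|t| <= e -> f (a t) = t.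
  move=> te; have [fe fa] : [set s | `|s| <= e /\ a s = a t] (f (a t)) by apply: xgetPex; exists t.
  move: te fe; rewrite !ler_norml => /andP[t1 t2] /andP[f1 f2].
  case: (ltgtP (f (a t)) t) => // h; exfalso.
    by have := inc _ _ f1 h t2; rewrite fa ltxx.
  by have := inc _ _ t1 h f2; rewrite fa ltxx.
have nK t : `|t| < e -> {near t, cancel a f}.
  move=> te; near=> s; apply: fK; apply/ltW.
  near: s; have := @norm_continuous _ R t => /(_ [set y | y < e]); apply.
  exact: (open_nbhs_nbhs (conj (@open_lt _ e) te)).
have df t : `|t| < e -> is_derive (a t) 1 f (derive1 a t)^-1.
  move=> te; apply: is_derive_inverse; first exact: nK.
  - by near=> s; exact: ca.
  - exact: C1_fun_derive.
  - by rewrite gt_eqF // He1 // (le_trans (ltW te)).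
have surj y : a (- (e / 2)) <= y <= a (e / 2) -> exists2 t, `|t| < e & a t = y /\ `|t| <= e / 2.
  move=> yb; have le : - (e / 2) <= e / 2 by lra.
  have cw : {within `[- (e / 2), e / 2], continuous a} by apply: continuous_in_subspaceT => x _; exact: ca.
  have ll : a (- (e / 2)) <= a (e / 2) by apply/ltW/inc; lra.
  have [|t] := IVT le cw (v := y); first by rewrite min_l // max_r.
  rewrite in_itv /= => th tE; exists t; last by split => //; rewrite ler_norml.
  by rewrite ltr_norml; apply/andP; split; lra.
have am : a (- (e / 2)) < 0 by rewrite -a0; apply: inc; lra.
have ap : 0 < a (e / 2) by rewrite -a0; apply: inc; lra.
pose d := Num.min (- a (- (e / 2))) (a (e / 2)).
have d0 : 0 < d by rewrite lt_min ap andbT oppr_gt0.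
have dd1 : d <= - a (- (e / 2)) by rewrite ge_min lexx.
have dd2 : d <= a (e / 2) by rewrite ge_min lexx orbT.
have sd y : `|y| <= d -> exists2 t, `|t| < e & a t = y /\ `|t| <= e / 2.
  by rewrite ler_norml => /andP[y1 y2]; apply: surj; apply/andP; split; lra.
exists d => //; exists (fun y => b (f y)), (fun y => derive1 b (f y) * (derive1 a (f y))^-1); split.
- move=> y /sd[t te [<- _]].
  have D := @is_derive1_comp R b f (a t) _ _ (C1_fun_derive (f (a t)) C1b) (df t te).
  by rewrite fK ?(ltW te) // in D *.
- move=> y /sd[t te [<- _]]; have cf := is_derive1_cont (df t te).
  have fa := fK _ (ltW te).
  apply: cvgM.
    by apply: (continuous_comp cf); exact: C1b.2.
  apply: cvgV; first by rewrite fa gt_eqF // He1 // (le_trans (ltW te)).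
  by apply: (continuous_comp cf); exact: C1a.2.
move=> y /andP[y0 yd]; have [t te [ty _]] := sd y ltac:(by rewrite ger0_norm).
have t0 : 0 <= t.
  rewrite leNgt; apply/negP => tn; move: te; rewrite ltr_norml => /andP[te1 te2].
  by have := inc t 0 (ltW te1) tn (ltW e0); rewrite ty a0 => h; move: y0; rewrite leNgt h.
have th : 0 <= t <= eta.
  rewrite t0 /=; apply: le_trans eeta; apply: ltW; apply: le_lt_trans te; exact: ler_norm.
split; last by exists t.
by rewrite -ty (fK _ (ltW te)) bphi.
Unshelve. all: by end_near.
Qed.

(** The function is prolonged by its tangent lines at 0 and d, which keeps it C^1; with the clamp
    [cl] onto [0, d] this is a single formula. *)
Lemma linear_extension (d : R) (Phi psi : R -> R) : 0 < d ->
  (forall y : R, 0 <= y <= d -> is_derive y 1 Phi (psi y)) ->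
  (forall y : R, 0 <= y <= d -> {for y, continuous psi}) ->
  exists P dP : R -> R, [/\ forall y : R, is_derive y 1 P (dP y), continuous dP,
    forall y, 0 <= y <= d -> P y = Phi y & forall y, y <= 0 -> P y = Phi 0 + psi 0 * y].
Proof.
move=> d0 D c.
pose cl (y : R) := Num.max 0 (Num.min y d).
have cl01 y : 0 <= cl y <= d by rewrite /cl le_max lexx /= ge_max (ltW d0) ge_min lexx orbT.
have clE y : 0 <= y <= d -> cl y = y by move=> /andP[a b]; rewrite /cl min_l // max_r.
have cl0 y : y <= 0 -> cl y = 0 by move=> a; rewrite /cl min_l ?max_l // (le_trans a) // ltW.
have cld y : d <= y -> cl y = d by move=> a; rewrite /cl min_r // max_r // ltW.
have ccl : continuous cl.
  move=> y; apply: (@continuous_max R R (fun=> 0) (fun y => Num.min y d)); first exact: cvg_cst.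
  by apply: (@continuous_min R R id (fun=> d)); [exact: cvg_id|exact: cvg_cst].
exists (fun y => Phi (cl y) + psi (cl y) * (y - cl y)), (fun y => psi (cl y)); split.
- move=> y; apply/is_derive_eps => sg sg0.
  have sgn z : 0 <= sg * `|z - y| by rewrite mulr_ge0 // ltW.
  have [yn|y0] := ltP y 0.
    exists (- y); first by rewrite oppr_gt0.
    move=> z; rewrite ler_norml => /andP[_ h].
    rewrite !cl0 ?(ltW yn) //; last lra.
    by rewrite [X in `|X| <= _](_ : _ = 0) ?normr0 //; ring.
  have [yd|yd] := ltP d y.
    exists (y - d); first by rewrite subr_gt0.
    move=> z; rewrite ler_norml => /andP[h _].
    rewrite !cld ?(ltW yd) //; last lra.
    by rewrite [X in `|X| <= _](_ : _ = 0) ?normr0 //; ring.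
  have y0d : 0 <= y <= d by rewrite y0 yd.
  have /is_derive_eps /(_ sg sg0) [e e0 He] := D _ y0d.
  (* These radii keep z on the same side of a breakpoint as y, except when y is itself that
     breakpoint; there the tangent line has no error at all. *)
  pose e1 := if 0 < y then y / 2 else 1; pose e2 := if y < d then (d - y) / 2 else 1.
  exists (Num.min e (Num.min e1 e2)).
    by rewrite !lt_min e0 /= /e1 /e2; apply/andP; split; case: ifP => h //; lra.
  move=> z; rewrite !le_min => /and3P[h h1 h2].
  rewrite (clE y) // subrr mulr0 addr0.
  have [zn|z0] := ltP z 0.
    have yE : y = 0.
      apply/eqP; rewrite eq_le y0 andbT leNgt; apply/negP => yp.
      by move: h1; rewrite /e1 yp ler_norml => /andP[]; lra.
    by rewrite cl0 ?(ltW zn) // [X in `|X| <= _](_ : _ = 0) ?normr0 // yE; ring.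
  have [zd|zd] := ltP d z.
    have yE : y = d.
      apply/eqP; rewrite eq_le yd /= leNgt; apply/negP => yp.
      by move: h2; rewrite /e2 yp ler_norml => /andP[]; lra.
    by rewrite cld ?(ltW zd) // [X in `|X| <= _](_ : _ = 0) ?normr0 // yE; ring.
  by rewrite clE ?z0 // subrr mulr0 addr0; exact: He.
- by move=> y; apply: (@continuous_comp _ _ _ cl psi); [exact: ccl|exact: c].
- by move=> y y0; rewrite clE // subrr mulr0 addr0.
- by move=> y y0; rewrite cl0 // subr0.
Qed.

(** The sum of the right extension and the reflected left one counts the tangent at 0 twice: on each
    side the extension from the other side is linear with slope psi1 0, and subtracting that line
    leaves phi. *)
Lemma glue_C1 (d : R) (phi Phi1 psi1 Phi2 psi2 : R -> R) : 0 < d -> phi 0 = 0 ->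
  (forall y : R, 0 <= y <= d -> is_derive y 1 Phi1 (psi1 y)) ->
  (forall y : R, 0 <= y <= d -> {for y, continuous psi1}) ->
  (forall y : R, 0 <= y <= d -> is_derive y 1 Phi2 (psi2 y)) ->
  (forall y : R, 0 <= y <= d -> {for y, continuous psi2}) ->
  (forall y, 0 <= y <= d -> phi y = Phi1 y /\ phi (- y) = Phi2 y) ->
  psi1 0 = - psi2 0 ->
  exists2 phi' : R -> R, C1_fun phi' & forall y, `|y| <= d -> phi' y = phi y.
Proof.
move=> d0 p0 D1 c1 D2 c2 E psi0.
have [P1 [dP1 [DP1 cP1 E1 F1]]] := linear_extension d0 D1 c1.
have [P2 [dP2 [DP2 cP2 E2 F2]]] := linear_extension d0 D2 c2.
have z0 : 0 <= (0 : R) <= d by rewrite lexx ltW.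
have [e1 e2] := E _ z0; rewrite oppr0 p0 in e1 e2.
exists (fun y => P1 y + P2 (- y) - psi1 0 * y).
  apply: (@C1_funP _ (fun y => dP1 y - dP2 (- y) - psi1 0)).
    move=> y; have dN : is_derive y 1 (fun y : R => - y) (-1) by apply: is_derive_eq.
    have dZ : is_derive y 1 (fun y : R => psi1 0 * y) (psi1 0).
      by apply: is_derive_eq; rewrite -[_ *: _]/(_ * _) mulr1.
    have H := is_deriveB (is_deriveD (DP1 y) (@is_derive1_comp R P2 (fun y => - y) y _ _ (DP2 (- y)) dN)) dZ.
    by apply: (is_derive_eq H); rewrite mulrN1.
  move=> y; apply: cvgB; last exact: cvg_cst.
  apply: cvgB; first exact: cP1.
  by apply: (@continuous_comp _ _ _ -%R dP2); [exact: opp_continuous|exact: cP2].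
move=> y; rewrite ler_norml => /andP[yd1 yd2].
have [y0|y0] := leP 0 y.
  have yy : 0 <= y <= d by rewrite y0.
  rewrite E1 // F2; last by rewrite oppr_le0.
  by rewrite -e2 (E _ yy).1 psi0; ring.
have yy : 0 <= - y <= d by rewrite oppr_ge0 (ltW y0) /=; lra.
rewrite F1 ?(ltW y0) // E2 // -e1 -(E _ yy).2 opprK; ring.
Qed.

Lemma slopes_from_derivatives (d : R) (phi Phi1 psi1 Phi2 psi2 : R -> R) : 0 < d -> phi 0 = 0 ->
  is_derive (0 : R) 1 Phi1 (psi1 0) -> is_derive (0 : R) 1 Phi2 (psi2 0) ->
  (forall y, 0 <= y <= d -> phi y = Phi1 y /\ phi (- y) = Phi2 y) ->
  forall sg, 0 < sg -> exists2 e, 0 < e & forall t, 0 <= t <= e ->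
    `|phi t - psi1 0 * t| <= sg * t /\ `|phi (- t) + - psi2 0 * t| <= sg * t.
Proof.
move=> d0 p0 /is_derive_eps D1 /is_derive_eps D2 E sg sg0.
have [e1 e10 H1] := D1 _ sg0; have [e2 e20 H2] := D2 _ sg0.
have z0 : 0 <= (0 : R) <= d by rewrite lexx ltW.
have [f1 f2] := E _ z0; rewrite oppr0 p0 in f1 f2.
exists (Num.min d (Num.min e1 e2)); first by rewrite !lt_min d0 e10.
move=> t; rewrite !le_min => /and4P[t0 td te1 te2].
have tt : 0 <= t <= d by rewrite t0.
have [-> ->] := E _ tt.
have := H1 t; rewrite subr0 (ger0_norm t0) -f1 subr0 => /(_ te1) h1.
have := H2 t; rewrite subr0 (ger0_norm t0) -f2 subr0 => /(_ te2) h2.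
by rewrite mulNr.
Qed.

End Calculus1.

(** * The corner frame and the arcs seen in it *)

Section Frame.
Context {R : realType}.
Variables (D : set (R * R)) (x0 : R * R) (r c s : R) (phi : R -> R) (L : R).

Definition frame (x : R * R) : R * R := Defs.rot c s (x - x0).
Definition unframe (y : R * R) : R * R :=
  x0 + (c * y.1 + s * y.2, - s * y.1 + c * y.2).

Hypothesis cs1 : c ^+ 2 + s ^+ 2 = 1.

Lemma unframeK y : frame (unframe y) = y.
Proof.
case: y => a b; rewrite /frame /unframe addrAC subrr add0r /Defs.rot /=.
by congr (_, _); rewrite -[RHS]mul1r -cs1; ring.
Qed.

Lemma frameK x : unframe (frame x) = x.
Proof.
rewrite /frame /unframe /Defs.rot; case: x x0 => a b [p q] /=.
have e1 : c * (c * (a - p) - s * (b - q)) + s * (s * (a - p) + c * (b - q)) = (c ^+ 2 + s ^+ 2) * (a - p) by ring.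
have e2 : - s * (c * (a - p) - s * (b - q)) + c * (s * (a - p) + c * (b - q)) = (c ^+ 2 + s ^+ 2) * (b - q) by ring.
by rewrite e1 e2 cs1 !mul1r -[LHS]/(p + (a - p), q + (b - q)); congr (_, _); rewrite addrC subrK.
Qed.

Lemma frame0 : frame x0 = 0.
Proof. by rewrite /frame subrr /Defs.rot /= !mulr0 subr0 addr0. Qed.

Lemma enorm_frame x : enorm (frame x) = enorm (x - x0).
Proof.
rewrite /enorm /frame /Defs.rot /=; congr Num.sqrt.
by rewrite -[RHS]mul1r -cs1; ring.
Qed.

Lemma continuous_frame : continuous frame.
Proof.
have c1 : continuous (fun y : R * R => (y - x0).1) by move=> y; apply: cvgB; [exact: cvg_fst|exact: cvg_cst].
have c2 : continuous (fun y : R * R => (y - x0).2) by move=> y; apply: cvgB; [exact: cvg_snd|exact: cvg_cst].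
move=> x; apply: (@continuous_pairing R (R * R)%type (fun y => c * (y - x0).1 - s * (y - x0).2) (fun y => s * (y - x0).1 + c * (y - x0).2) x).
  by apply: cvgB; apply: cvgMr; [exact: c1|exact: c2].
by apply: cvgD; apply: cvgMr; [exact: c1|exact: c2].
Qed.

Lemma continuous_unframe : continuous unframe.
Proof.
have c1 : continuous (fun y : R * R => y.1) by move=> y; exact: cvg_fst.
have c2 : continuous (fun y : R * R => y.2) by move=> y; exact: cvg_snd.
move=> x; apply: cvgD; first exact: cvg_cst.
apply: (@continuous_pairing R _ (fun y : R * R => c * y.1 + s * y.2) (fun y => - s * y.1 + c * y.2)).
  by apply: cvgD; apply: cvgMr; [exact: c1|exact: c2].
by apply: cvgD; apply: cvgMr; [exact: c1|exact: c2].
Qed.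

Hypothesis L0 : 0 <= L.
Hypothesis lip : forall t u, `|phi t - phi u| <= L * `|t - u|.

(** In the frame the arc (a, b) lies on the graph of phi, so |b| <= L |a|. If a'(0) vanished then
    b'(0) would vanish too, against the nonzero tangent. Hence the arc leaves x0 strictly to one
    side, given by the sign [sg], and is a C^1 graph over that side. *)
Lemma lipschitz_arc_side (g : R -> R * R) (r0 : R) : C1_arc_from x0 g -> 0 < r0 -> phi 0 = 0 ->
  (forall t, 0 <= t <= 1 -> disk x0 r0 (g t) -> (frame (g t)).2 = phi (frame (g t)).1) ->
  exists2 sg, (sg = 1 \/ sg = -1) & exists2 d, 0 < d & exists Phi psi : R -> R,
    [/\ (forall y : R, `|y| <= d -> is_derive y 1 Phi (psi y)),
        (forall y : R, `|y| <= d -> {for y, continuous psi}) &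
        (forall y : R, 0 <= y <= d -> phi (sg * y) = Phi y /\
           exists2 t, 0 <= t <= 1 & frame (g t) = (sg * y, phi (sg * y)))].
Proof.
move=> [g0 C1 C2 inj nz] r00 p0 on_graph.
have cg : continuous g.
  move=> t; have -> : g = fun t => ((g t).1, (g t).2) by apply/funext => u; case: (g u).
  by apply: (@continuous_pairing R R (fun t => (g t).1) (fun t => (g t).2)); exact: (is_derive1_cont (C1_fun_derive _ _)).
have [eta0 eta00 Heta] : exists2 d, 0 < d & forall t, `|t| <= d -> disk x0 r0 (g t).
  apply: near_itv0; apply: cg; apply: (open_nbhs_nbhs (conj (@open_disk R x0 r0) _)).
  by rewrite g0 /disk /= subrr /enorm /= expr0n addr0 sqrtr0.
pose eta := Num.min eta0 1.
have eta_gt0 : 0 < eta by rewrite lt_min eta00 ltr01.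
pose a t := (frame (g t)).1; pose b t := (frame (g t)).2.
have ab t : 0 <= t <= eta -> b t = phi (a t).
  rewrite /eta le_min => /and3P[t0 t1 t2]; apply: on_graph; first by rewrite t0.
  by apply: Heta; rewrite ger0_norm.
have fE t : frame (g t) = (a t, b t) by rewrite /a /b; case: (frame _).
have a0 : a 0 = 0 by rewrite /a g0 frame0.
have b0 : b 0 = 0 by rewrite /b g0 frame0.
pose da t := c * derive1 (fun t => (g t).1) t - s * derive1 (fun t => (g t).2) t.
pose db t := s * derive1 (fun t => (g t).1) t + c * derive1 (fun t => (g t).2) t.
have D1 t := C1_fun_derive t C1; have D2 t := C1_fun_derive t C2.
have dZ (k : R) f (t l p : R) : is_derive t 1 f l -> is_derive t 1 (fun t => k * (f t - p)) (k * l).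
  move=> df; have H := is_deriveZ k (is_deriveB df (is_derive_cst p t 1)).
  by apply: (is_derive_eq H); rewrite subr0.
have Da (t : R) : is_derive t 1 a (da t) by exact: (is_deriveB (dZ c _ t _ x0.1 (D1 t)) (dZ s _ t _ x0.2 (D2 t))).
have Db (t : R) : is_derive t 1 b (db t) by exact: (is_deriveD (dZ s _ t _ x0.1 (D1 t)) (dZ c _ t _ x0.2 (D2 t))).
have cda : continuous da by move=> t; apply: cvgB; apply: cvgMr; [exact: C1.2|exact: C2.2].
have cdb : continuous db by move=> t; apply: cvgD; apply: cvgMr; [exact: C1.2|exact: C2.2].
have da0 : da 0 != 0.
  apply/eqP => da0.
  have db0 : db 0 = 0.
    apply/eqP; rewrite -normr_eq0 eq_le normr_ge0 andbT; apply/ler_addgt0Pl => e e0; rewrite addr0.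
    have L2 : 0 < L + 2 by rewrite ltr_wpDl.
    have e20 : 0 < e / (L + 2) by rewrite divr_gt0.
    have /is_derive_eps /(_ _ e20) [d1 d10 H1] := Da 0.
    have /is_derive_eps /(_ _ e20) [d2 d20 H2] := Db 0.
    pose t := Num.min eta (Num.min d1 d2).
    have t0 : 0 < t by rewrite lt_min eta_gt0 lt_min d10.
    have te : t <= eta by rewrite ge_min lexx.
    have td1 : t <= d1 by rewrite /t minCA ge_min lexx.
    have td2 : t <= d2 by rewrite /t minA [X in X <= _]minC ge_min lexx.
    have := H1 t; rewrite subr0 (gtr0_norm t0) a0 da0 subr0 mul0r subr0 => /(_ td1) h1.
    have := H2 t; rewrite subr0 (gtr0_norm t0) b0 subr0 => /(_ td2) h2.
    have hb : `|b t| <= L * `|a t|.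
      by rewrite ab ?(ltW t0) //; have := lip (a t) 0; rewrite p0 !subr0.
    rewrite -(ler_pM2r t0) -{1}(gtr0_norm t0) -normrM.
    have -> : db 0 * t = b t - (b t - db 0 * t) by ring.
    apply: le_trans (ler_normB _ _) _.
    have -> : e * t = L * (e / (L + 2) * t) + e / (L + 2) * t + e / (L + 2) * t by field; rewrite gt_eqF.
    have : L * `|a t| <= L * (e / (L + 2) * t) by rewrite ler_wpM2l.
    have : 0 <= e / (L + 2) * t by rewrite mulr_ge0 // ltW.
    lra.
  have := nz 0; rewrite lexx ler01 => /(_ isT) /eqP; apply.
  move: da0 db0; rewrite /da /db; set A := derive1 _ _; set B := derive1 _ _ => e1 e2.
  have eA : A = c * (c * A - s * B) + s * (s * A + c * B) by rewrite -[LHS]mul1r -cs1; ring.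
  have eB : B = - s * (c * A - s * B) + c * (s * A + c * B) by rewrite -[LHS]mul1r -cs1; ring.
  rewrite e1 e2 !mulr0 addr0 in eA; rewrite e1 e2 !mulr0 addr0 in eB.
  by rewrite eA eB.
pose sg : R := if 0 < da 0 then 1 else -1.
have sgda : 0 < sg * da 0.
  rewrite /sg; case: ifPn; first by rewrite mul1r.
  by rewrite -leNgt mulN1r oppr_gt0 lt_neqAle da0.
have sg2 : sg * sg = 1 by rewrite /sg; case: ifP; rewrite ?mulr1 // mulN1r opprK.
have Dsa (t : R) : is_derive t 1 (fun t => sg * a t) (sg * da t) by have H := is_deriveZ sg (Da t); exact: (is_derive_eq H).
have C1a : C1_fun (fun t => sg * a t).
  by apply: C1_funP Dsa _ => t; apply: cvgMr; exact: cda.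
have C1b : C1_fun b by apply: C1_funP Db cdb.
exists sg; first by rewrite /sg; case: ifP; [left|right].
have dsa0 : derive1 (fun t => sg * a t) 0 = sg * da 0 by rewrite derive1E; case: (Dsa 0).
have [||||d d0 [Phi [psi [Dp Cp E]]]] := @graph_arc R (fun t => sg * a t) b (fun y => phi (sg * y)) eta C1a C1b.
- by rewrite a0 mulr0.
- by rewrite dsa0.
- exact: eta_gt0.
- by move=> t te; rewrite mulrA sg2 mul1r ab.
exists d => //; exists Phi, psi; split => // y yd; have [e1 [t te ty]] := E y yd.
split => //; exists t.
  by case/andP: te => t0 te; rewrite t0 (le_trans te) // /eta ge_min lexx orbT.
by rewrite fE ab // -ty mulrA sg2 mul1r.
Qed.

Hypothesis D_open : open D.
Hypothesis r_gt0 : 0 < r.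
Hypothesis D_graph : D `&` disk x0 r = [set x | phi (frame x).1 < (frame x).2] `&` disk x0 r.

Let cphi : continuous phi. Proof. exact: lip_continuous L0 lip. Qed.

Let DP x : disk x0 r x -> D x <-> phi (frame x).1 < (frame x).2.
Proof.
move=> dx; have := D_graph => /(congr1 (fun A => A x)) /= E.
split => h; first by have : (D `&` disk x0 r) x by []; rewrite D_graph => -[].
by have : ([set x | phi (frame x).1 < (frame x).2] `&` disk x0 r) x by []; rewrite -D_graph => -[].
Qed.

(** Below the graph is an open condition; conversely a point on or above the graph is moved into D
    by an arbitrarily small upward shift. *)
Lemma frame_closure x : disk x0 r x -> closure D x <-> phi (frame x).1 <= (frame x).2.
Proof.
move=> dx; split.
  move=> clx; rewrite leNgt; apply/negP => lt.
  pose f (z : R * R) := phi (frame z).1 - (frame z).2.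
  have cf : continuous f.
    move=> z; apply: cvgB.
      apply: (@continuous_comp _ _ _ (fun z => (frame z).1) phi); last exact: cphi.
      by apply: (@continuous_comp _ _ _ frame fst); [exact: continuous_frame|exact: cvg_fst].
    by apply: (@continuous_comp _ _ _ frame snd); [exact: continuous_frame|exact: cvg_snd].
  have oA : open (f @^-1` [set t | 0 < t] `&` disk x0 r).
    apply: openI; last exact: open_disk.
    by apply: open_comp; [move=> z _; exact: cf|exact: open_gt].
  have Ax : (f @^-1` [set t | 0 < t] `&` disk x0 r) x by split => //=; rewrite /f subr_gt0.
  have [z [Dz [/= fz dz]]] := clx _ (open_nbhs_nbhs (conj oA Ax)).
  by move/(DP dz): Dz; rewrite ltNge => /negP; apply; move: fz; rewrite subr_gt0 => /ltW.
move=> le B nB.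
pose p t := unframe ((frame x).1, (frame x).2 + t).
have p0 : p 0 = x by rewrite /p addr0 -surjective_pairing frameK.
have cp : {for 0, continuous p}.
  apply: (@continuous_comp _ _ _ (fun t : R => ((frame x).1, (frame x).2 + t)) unframe); last exact: continuous_unframe.
  apply: (@continuous_pairing R R (fun=> (frame x).1) (fun t => (frame x).2 + t)); first exact: cvg_cst.
  by apply: cvgD; [exact: cvg_cst|exact: cvg_id].
have nb : nbhs (p 0) (B `&` disk x0 r).
  by rewrite p0; apply: filterI => //; exact: (open_nbhs_nbhs (conj (@open_disk R x0 r) dx)).
have [d d0 Hd] := near_itv0 (cp _ nb).
have [|Bp dp] := Hd d; first by rewrite ger0_norm // ltW.
exists (p d); split => //; apply/(DP dp); rewrite /p unframeK /=.
by apply: le_lt_trans le _; rewrite ltrDl.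
Qed.

Lemma frame_bdry x : disk x0 r x -> bdry D x <-> (frame x).2 = phi (frame x).1.
Proof.
move=> dx; have iD : interior D = D by apply/interior_id.
rewrite /bdry iD; split.
  move=> [/(frame_closure dx) h nD]; apply/eqP; rewrite eq_le h andbT leNgt; apply/negP => h'.
  by apply: nD; apply/(DP dx).
move=> E; split; first by apply/(frame_closure dx); rewrite E.
by move/(DP dx); rewrite E ltxx.
Qed.

End Frame.

(** * Distinct one-sided slopes where the boundary is not C^1 *)

Section Corner.
Context {R : realType}.
Variables (D : set (R * R)) (x0 : R * R).
Hypothesis D_open : open D.

Lemma above_graph_0 (r c s L : R) (phi : R -> R) : 0 <= L ->
  (forall t u, `|phi t - phi u| <= L * `|t - u|) -> bdry D x0 -> above_graph D x0 r c s phi -> phi 0 = 0.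
Proof.
move=> L0 lip bx [r0 cs1 E]; have dx : disk x0 r x0.
  by rewrite /disk /= subrr /enorm /= expr0n addr0 sqrtr0.
have /(frame_bdry cs1 L0 lip D_open E dx) := bx.
by rewrite frame0 /= => /esym.
Qed.

(** The Lipschitz graph supplies the frame, the two C^1 arcs its two halves. The slope to the left
    is written as mm, so phi (- t) is close to - mm t, and mp = mm would mean differentiability at
    0. *)
Theorem corner_frame : lipschitz_boundary D -> piecewise_C1_boundary D -> bdry D x0 ->
  ~ C1_boundary_near D x0 ->
  exists r c s L mp mm (phi : R -> R),
    [/\ 0 < r, c ^+ 2 + s ^+ 2 = 1, 0 <= L, (forall t u, `|phi t - phi u| <= L * `|t - u|) & phi 0 = 0] /\
    [/\ mp != mm,
      (forall sg, 0 < sg -> exists2 d, 0 < d & forall t, 0 <= t <= d ->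
        `|phi t - mp * t| <= sg * t /\ `|phi (- t) + mm * t| <= sg * t) &
      (forall x, disk x0 r x -> closure D x <-> phi (frame x0 c s x).1 <= (frame x0 c s x).2)].
Proof.
move=> Dlip Dpw bx nC1.
have [r1 [c [s [phi [[L' lip'] AG]]]]] := Dlip x0 bx.
pose L := `|L'|; have L0 : 0 <= L by exact: normr_ge0.
have lip t u : `|phi t - phi u| <= L * `|t - u|.
  by apply: le_trans (lip' t u) _; rewrite ler_wpM2r // ler_norm.
have p0 := above_graph_0 L0 lip bx AG.
have [r10 cs1 DE] := AG.
have [r2 [g [h [r20 Ag Ah gh cover]]]] := Dpw x0 bx.
pose r := Num.min r1 r2; have r0 : 0 < r by rewrite lt_min r10.
have subd p : disk x0 r p -> disk x0 r1 p /\ disk x0 r2 p by rewrite /disk /= lt_min => /andP[].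
have arc k : (arc_set k `<=` arc_set g `|` arc_set h) -> forall t, 0 <= t <= 1 -> disk x0 r (k t) ->
    (frame x0 c s (k t)).2 = phi (frame x0 c s (k t)).1.
  move=> kgh t t01 /subd[d1 d2]; apply/(frame_bdry cs1 L0 lip D_open DE d1).
  have : ((arc_set g `|` arc_set h) `&` disk x0 r2) (k t).
    by split => //; apply: kgh; exists t => //=; rewrite in_itv.
  by rewrite -cover => -[].
have [sg1 sg1E [d1 d10 [Phi1 [psi1 [D1 C1 E1]]]]] :=
  lipschitz_arc_side cs1 L0 lip Ag r0 p0 (arc g (@subsetUl _ _ _)).
have [sg2 sg2E [d2 d20 [Phi2 [psi2 [D2 C2 E2]]]]] :=
  lipschitz_arc_side cs1 L0 lip Ah r0 p0 (arc h (@subsetUr _ _ _)).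
pose d := Num.min d1 d2; have d0 : 0 < d by rewrite lt_min d10.
have dd1 : d <= d1 by rewrite ge_min lexx.
have dd2 : d <= d2 by rewrite ge_min lexx orbT.
(* On the same side both arcs would contain the graph point of abscissa sg1 * d, whereas they meet
   only at x0. *)
have sgn : sg1 != sg2.
  apply/eqP => sgE.
  have [_ [t t01 Et]] := E1 d ltac:(by rewrite (ltW d0)).
  have [_ [u u01 Eu]] := E2 d ltac:(by rewrite (ltW d0)).
  have gu : g t = h u.
    by rewrite -(frameK x0 cs1 (g t)) -(frameK x0 cs1 (h u)) Et Eu sgE.
  have : (arc_set g `&` arc_set h) (g t).
    by split; [exists t|rewrite gu; exists u] => //=; rewrite in_itv.
  rewrite gh /= => gx; move: Et; rewrite gx frame0 => -[/esym/eqP].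
  rewrite mulf_eq0 (gt_eqF d0) orbF => /eqP sg0.
  by case: sg1E; rewrite sg0 => /eqP; rewrite ?[0 == 1]eq_sym ?oner_eq0 // eq_sym oppr_eq0 oner_eq0.
have finish (P1 p1 P2 p2 : R -> R) :
    (forall y : R, `|y| <= d -> is_derive y 1 P1 (p1 y)) -> (forall y : R, `|y| <= d -> {for y, continuous p1}) ->
    (forall y : R, `|y| <= d -> is_derive y 1 P2 (p2 y)) -> (forall y : R, `|y| <= d -> {for y, continuous p2}) ->
    (forall y, 0 <= y <= d -> phi y = P1 y /\ phi (- y) = P2 y) ->
    exists mp mm, mp != mm /\ (forall sg, 0 < sg -> exists2 d, 0 < d & forall t, 0 <= t <= d ->
        `|phi t - mp * t| <= sg * t /\ `|phi (- t) + mm * t| <= sg * t).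
  move=> Q1 q1 Q2 q2 E; exists (p1 0), (- p2 0).
  have z0 : `|0 : R| <= d by rewrite normr0 ltW.
  have nn y : 0 <= y <= d -> `|y| <= d by case/andP=> y0 yd; rewrite ger0_norm.
  split; last exact: (slopes_from_derivatives d0 p0 (Q1 _ z0) (Q2 _ z0) E).
  (* Equal slopes let the halves be glued to a C^1 function that agrees with phi for abscissae up to
     d, so its graph bounds D in the disk of radius min (r1, d). *)
  apply/eqP => pE; apply: nC1.
  have [phi' C1p pp] := glue_C1 d0 p0 (fun y h => Q1 y (nn y h)) (fun y h => q1 y (nn y h))
    (fun y h => Q2 y (nn y h)) (fun y h => q2 y (nn y h)) E pE.
  exists (Num.min r1 d), c, s, phi'; split => //; split => //; first by rewrite lt_min r10.
  apply/seteqP; split => x [h1 h2]; split => //; move: h2; rewrite /disk /= lt_min => /andP[h2 h3].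
    rewrite pp; last by apply: ltW; apply: le_lt_trans h3; rewrite -(enorm_frame x0 cs1); exact: (enorm_ge1 (frame x0 c s x)).
    by have : (D `&` disk x0 r1) x by []; rewrite DE => -[].
  move: h1 => /=; rewrite pp; last by apply: ltW; apply: le_lt_trans h3; rewrite -(enorm_frame x0 cs1); exact: (enorm_ge1 (frame x0 c s x)).
  move=> h1; have : ([set x | phi (Defs.rot c s (x - x0)).1 < (Defs.rot c s (x - x0)).2] `&` disk x0 r1) x by [].
  by rewrite -DE => -[].
have l1 y : `|y| <= d -> `|y| <= d1 by move=> h1; exact: le_trans h1 dd1.
have l2 y : `|y| <= d -> `|y| <= d2 by move=> h1; exact: le_trans h1 dd2.
have m1 y : 0 <= y <= d -> 0 <= y <= d1 by case/andP=> -> h1; exact: le_trans h1 dd1.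
have m2 y : 0 <= y <= d -> 0 <= y <= d2 by case/andP=> -> h1; exact: le_trans h1 dd2.
have [mp [mm [mpm slopes]]] : exists mp mm, mp != mm /\ (forall sg, 0 < sg -> exists2 d, 0 < d & forall t, 0 <= t <= d ->
        `|phi t - mp * t| <= sg * t /\ `|phi (- t) + mm * t| <= sg * t).
  case: sg1E sg2E sgn E1 E2 => -> [] ->; rewrite ?eqxx // => _ E1 E2.
    apply: (finish Phi1 psi1 Phi2 psi2) => y h1.
    - by apply: D1; exact: l1.
    - by apply: C1; exact: l1.
    - by apply: D2; exact: l2.
    - by apply: C2; exact: l2.
    by have [e1 _] := E1 y (m1 _ h1); have [e2 _] := E2 y (m2 _ h1); rewrite -e1 -e2 mul1r mulN1r.
  apply: (finish Phi2 psi2 Phi1 psi1) => y h1.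
  - by apply: D2; exact: l2.
  - by apply: C2; exact: l2.
  - by apply: D1; exact: l1.
  - by apply: C1; exact: l1.
  by have [e1 _] := E1 y (m1 _ h1); have [e2 _] := E2 y (m2 _ h1); rewrite -e1 -e2 mul1r mulN1r.
exists r1, c, s, L, mp, mm, phi; split; split => //.
by move=> x dx; exact: (frame_closure cs1 L0 lip DE dx).
Qed.

End Corner.

(** * Cut-off fields and kernel estimates *)

Section Cutoffs.
Context {R : realType}.
Implicit Types (f g : R * R -> R).

Lemma is_derive_shift f (p x v : R * R) (l : R) : is_derive (x - p) v f l ->
  is_derive x v (fun y => f (y - p)) l.
Proof.
have E : (fun h : R => h^-1 *: (((fun y => f (y - p)) \o shift x) (h *: v) - f (x - p))) =
         (fun h : R => h^-1 *: ((f \o shift (x - p)) (h *: v) - f (x - p))).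
  by apply/funext => h /=; rewrite addrA.
move=> [df dv]; split; first by rewrite /derivable E.
by rewrite /derive E.
Qed.

Lemma Cn_on_shift n f (p : R * R) : Cn_on n setT f -> Cn_on n setT (fun y => f (y - p)).
Proof.
have cs g : (forall x : R * R, setT x -> {for x, continuous g}) ->
    forall x : R * R, setT x -> {for x, continuous (fun y : R * R => g (y - p))}.
  by move=> cg x _; have h1 := @continuous_sub_cst R p x; exact: (continuous_comp h1 (cg _ I)).
elim: n f => [|n IH] f H; first by split => //; apply: cs; case: H.
have D i x : is_derive x (basis_vec i) (fun y => f (y - p)) (partial i f (x - p)).
  by apply: is_derive_shift; exact: (Cn_on_derive _ H).
split; first by apply: cs; case: H.
move=> i; split; first by move=> x _; case: (D i x).
have -> : partial i (fun y => f (y - p)) = (fun y => partial i f (y - p)).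
  by apply/funext => x; exact: partialP.
by apply: IH; exact: Cn_on_partial.
Qed.

Definition sqn (x : R * R) : R := x.1 ^+ 2 + x.2 ^+ 2.

Lemma Cn_on_sqn n U : open U -> Cn_on n U sqn.
Proof. by move=> oU; apply: Cn_on_add => //; apply: Cn_on_exp => //; [exact: Cn_on_fst|exact: Cn_on_snd]. Qed.

Lemma continuous_sqn : continuous sqn.
Proof. by move=> x; exact: (Cn_on_cont (Cn_on_sqn 0 openT)). Qed.

(** Zero for |x| <= a / 2 and 1 for |x|^2 >= a^2 / 2, so the singularity is removed without altering
    the field at distance a or more. *)
Definition pole_cut (a : R) (x : R * R) : R := step (4 / a ^+ 2 * sqn x - 1).

Lemma pole_cut1 a x : 0 < a -> a ^+ 2 <= sqn x -> pole_cut a x = 1.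
Proof.
move=> a0 h; apply: step_ge1.
have a2 : 0 < a ^+ 2 by rewrite exprn_gt0.
have : 4 / a ^+ 2 * a ^+ 2 <= 4 / a ^+ 2 * sqn x by rewrite ler_wpM2l // divr_ge0 // ltW.
by rewrite divfK ?gt_eqF //; lra.
Qed.

Lemma Cn_on_pole_cut n a f : 0 < a -> Cn_on n [set x : R * R | x != 0] f ->
  Cn_on n setT (fun x => pole_cut a x * f x).
Proof.
move=> a0 Cf; have oN := @open_neq0 R.
pose V := [set x : R * R | 4 / a ^+ 2 * sqn x - 1 < 0].
have oV : open V.
  apply: (@open_comp _ _ (fun x => 4 / a ^+ 2 * sqn x - 1) [set t | t < 0]); last exact: open_lt.
  by move=> x _; apply: cvgB; [apply: cvgMr; exact: continuous_sqn|exact: cvg_cst].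
have Cc U : open U -> Cn_on n U (pole_cut a).
  move=> oU; apply: Cn_on_step => //; apply: Cn_on_sub => //; last exact: Cn_on_cst.
  by apply: Cn_on_scale => //; exact: Cn_on_sqn.
have -> : setT = [set x : R * R | x != 0] `|` V.
  apply/esym/seteqP; split => // x _; have [->|x0] := eqVneq x 0; [right|by left].
  by rewrite /V /= /sqn /= expr0n addr0 mulr0; lra.
apply: Cn_on_union; first by apply: Cn_on_mul => //; exact: Cc.
apply: (@Cn_on_congr _ _ _ (fun=> 0)) => //; last exact: Cn_on_cst.
by move=> x /= xV; rewrite /pole_cut step_le0 ?mul0r // ltW.
Qed.

(** 1 while |x - p|^2 <= r^2 / 2 and 0 once |x - p|^2 >= 3 r^2 / 4. *)
Definition disk_cut (p : R * R) (r : R) (x : R * R) : R := step (3 - 4 / r ^+ 2 * sqn (x - p)).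

Lemma Cn_on_disk_cut n p r : Cn_on n setT (disk_cut p r).
Proof.
have C : Cn_on n setT (fun x => step (3 - 4 / r ^+ 2 * sqn x)).
  apply: Cn_on_step; first exact: openT.
  apply: Cn_on_sub; [exact: openT|exact: Cn_on_cst|].
  by apply: Cn_on_scale; [exact: openT|exact: Cn_on_sqn openT].
exact: (Cn_on_shift p C).
Qed.

Lemma disk_cut1 p r x : 0 < r -> 2 * sqn (x - p) <= r ^+ 2 -> disk_cut p r x = 1.
Proof.
move=> r0 h; apply: step_ge1.
have a2 : 0 < r ^+ 2 by rewrite exprn_gt0.
have : 4 / r ^+ 2 * sqn (x - p) <= 2.
  rewrite mulrAC ler_pdivrMr //; lra.
by lra.
Qed.

Lemma disk_cut0 p r x : 0 < r -> 3 * r ^+ 2 <= 4 * sqn (x - p) -> disk_cut p r x = 0.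
Proof.
move=> r0 h; apply: step_le0.
have a2 : 0 < r ^+ 2 by rewrite exprn_gt0.
by rewrite subr_le0 mulrAC ler_pdivlMr.
Qed.

Lemma enorm_sqn (x : R * R) : enorm x ^+ 2 = sqn x.
Proof. by rewrite /enorm sqr_sqrtr // addr_ge0 ?sqr_ge0. Qed.

Definition l1 (x : R * R) : R := `|x.1| + `|x.2|.

Lemma l1_ge0 x : 0 <= l1 x. Proof. by rewrite addr_ge0. Qed.

Lemma sqn_le_l1 x : sqn x <= l1 x ^+ 2.
Proof.
rewrite /sqn /l1 -(real_normK (num_real x.1)) -(real_normK (num_real x.2)).
by have := normr_ge0 x.1; have := normr_ge0 x.2; nra.
Qed.

Lemma l1_le_sqn x : l1 x ^+ 2 <= 2 * sqn x.
Proof.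
rewrite /sqn /l1 -(real_normK (num_real x.1)) -(real_normK (num_real x.2)).
have := sqr_ge0 (`|x.1| - `|x.2|); lra.
Qed.

Lemma mean_value_le (f df : R -> R) (K a b : R) : (forall t : R, is_derive t 1 f (df t)) ->
  (forall t, Num.min a b <= t <= Num.max a b -> `|df t| <= K) -> `|f b - f a| <= K * `|b - a|.
Proof.
move=> D; wlog ab : a b / a <= b.
  move=> H h; have [ab|ba] := leP a b; first exact: H.
  by rewrite distrC [`|b - a|]distrC; apply: H; [exact: ltW|rewrite minC maxC].
rewrite min_l // max_r // => h.
have c : {within `[a, b], continuous f} by apply: continuous_in_subspaceT => x _; exact: is_derive1_cont (D x).
have [t tab ->] := MVT_segment ab (fun x _ => D x) c.
by rewrite normrM ler_wpM2r // h //; move: tab; rewrite in_itv.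
Qed.

(** From p to x along two axis-parallel segments, on which the partial derivatives are bounded by
    compactness of a box. *)
Lemma lipschitz_at f (p : R * R) (r : R) : Cn_on 1 setT f -> exists2 K, 0 <= K &
  forall x, disk p r x -> `|f x - f p| <= K * l1 (x - p).
Proof.
move=> Cf.
have cp k : continuous (partial k f) by move=> x; exact: (Cn_on_cont (Cn_on_partial k Cf) (x := x)).
pose r' := `|p.1| + `|p.2| + `|r|.
have [K1 K10 H1] := bounded_on_box (fun x (_ : box r' x) => cp 0 x).
have [K2 K20 H2] := bounded_on_box (fun x (_ : box r' x) => cp 1 x).
have D k x : is_derive x (basis_vec k) f (partial k f x) by exact: (Cn_on_derive _ Cf).
exists (K1 + K2); first exact: addr_ge0.
move=> [a b] xr; case: p xr @r' H1 H2 => p q /= xr H1 H2.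
have a1 : `|a - p| < r by apply: le_lt_trans xr; exact: (enorm_ge1 (a - p, b - q)).
have b1 : `|b - q| < r by apply: le_lt_trans xr; exact: (enorm_ge2 (a - p, b - q)).
have r0 := ler_norm r.
have bd (u v t w : R) : `|u - v| < r -> Num.min v u <= t <= Num.max v u -> 0 <= w -> `|t| <= `|v| + w + `|r|.
  rewrite ltr_norml => /andP[h1 h2]; have := ler_norm v; have := ler_norm (- v); rewrite normrN.
  rewrite ge_min le_max => h3 h4 /andP[h5 h6] w0.
  by rewrite ler_norml; apply/andP; split; [case/orP: h5|case/orP: h6] => h7; lra.
have e1 : `|f (a, q) - f (p, q)| <= K1 * `|a - p|.
  apply: (@mean_value_le (fun t => f (t, q)) (fun t => partial 0 f (t, q))).
    by move=> t; apply: is_derive_slice1; exact: D.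
  move=> t th; apply: H1; apply/boxP; split => /=; first exact: bd a1 th (normr_ge0 _).
  by have := normr_ge0 p; have := normr_ge0 r; lra.
have e2 : `|f (a, b) - f (a, q)| <= K2 * `|b - q|.
  apply: (@mean_value_le (fun t => f (a, t)) (fun t => partial 1 f (a, t))).
    by move=> t; apply: is_derive_slice2; exact: D.
  move=> t th; apply: H2; apply/boxP; split => /=.
    by apply: (bd a p) => //; rewrite ge_min le_max !lexx !orbT.
  by have := bd _ _ _ _ b1 th (normr_ge0 p); lra.
have -> : f (a, b) - f (p, q) = (f (a, b) - f (a, q)) + (f (a, q) - f (p, q)) by rewrite addrA subrK.
apply: le_trans (ler_normD _ _) _; rewrite /l1 /=.
by have := normr_ge0 (a - p); have := normr_ge0 (b - q); nra.
Qed.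

End Cutoffs.

(** * Singular fields cut off near the pole and away from x0 *)

Section TestFields.
Context {R : realType}.
Variables (x0 : R * R) (r : R) (pole : R * R) (a : R) (f : R * R -> R) (df : 'I_2 -> R * R -> R).
Hypothesis r0 : 0 < r.
Hypothesis a0 : 0 < a.
Hypothesis Cf : forall n, Cn_on n [set x : R * R | x != 0] f.
Hypothesis Df : forall k x, x != 0 -> is_derive x (basis_vec k) f (df k x).

Definition cut_field (x : R * R) : R := disk_cut x0 r x * (pole_cut a (x - pole) * f (x - pole)).

Lemma sub_neq0 x : a ^+ 2 < sqn (x - pole) -> x - pole != 0.
Proof.
move=> h; apply/eqP => E; move: h; rewrite E /sqn /= expr0n addr0 ltNge => /negP; apply.
exact: sqr_ge0.
Qed.

Let smooth_cut : smooth cut_field.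
Proof.
move=> n; apply: Cn_on_mul; [exact: openT|exact: Cn_on_disk_cut|].
exact: (Cn_on_shift pole (Cn_on_pole_cut a0 (Cf n))).
Qed.

Lemma cut_field_test : test_function cut_field.
Proof.
apply: (@box_test R _ (`|x0.1| + `|x0.2| + r)) => //.
apply: disk_supp_box => x; rewrite /disk /= => /negP; rewrite -leNgt => h.
rewrite /cut_field disk_cut0 ?mul0r // -enorm_sqn.
have : r ^+ 2 <= enorm (x - x0) ^+ 2 by rewrite lerXn2r ?nnegrE ?(ltW r0) ?(le_trans (ltW r0)).
by have := sqr_ge0 r; lra.
Qed.

Lemma cut_field_far x : r <= enorm (x - x0) -> cut_field x = 0 /\ forall k, partial k cut_field x = 0.
Proof.
move=> h.
pose V := [set z : R * R | 3 * r ^+ 2 < 4 * sqn (z - x0)].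
have oV : open V.
  apply: (@open_comp _ _ (fun z : R * R => 4 * sqn (z - x0)) [set t | 3 * r ^+ 2 < t]); last exact: open_gt.
  move=> z _; apply: cvgMr; have h1 := @continuous_sub_cst R x0 z.
  exact: (continuous_comp h1 (@continuous_sqn R (z - x0))).
have Vx : V x.
  rewrite /V /= -enorm_sqn.
  have : r ^+ 2 <= enorm (x - x0) ^+ 2 by rewrite lerXn2r ?nnegrE ?(ltW r0) ?(le_trans (ltW r0)).
  have r2 : 0 < r ^+ 2 by rewrite exprn_gt0.
  lra.
have V0 z : V z -> cut_field z = 0 by move=> Vz; rewrite /cut_field disk_cut0 ?mul0r // ltW.
split; first exact: V0.
move=> k; rewrite (@partial_congr R k cut_field (fun=> 0)); last exact: near_open oV Vx V0.
by apply: partialP; exact: is_derive_cst.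
Qed.

Lemma cut_field_near x : a ^+ 2 < sqn (x - pole) ->
  cut_field x = disk_cut x0 r x * f (x - pole) /\
  forall k, partial k cut_field x =
    partial k (disk_cut x0 r) x * f (x - pole) + disk_cut x0 r x * df k (x - pole).
Proof.
move=> h.
pose V := [set z : R * R | a ^+ 2 < sqn (z - pole)].
have oV : open V.
  apply: (@open_comp _ _ (fun z : R * R => sqn (z - pole)) [set t | a ^+ 2 < t]); last exact: open_gt.
  move=> z _; have h1 := @continuous_sub_cst R pole z.
  exact: (continuous_comp h1 (@continuous_sqn R (z - pole))).
have VE z : V z -> cut_field z = disk_cut x0 r z * f (z - pole).
  by move=> Vz; rewrite /cut_field pole_cut1 ?mul1r // ltW.
split; first exact: VE.
move=> k; rewrite (@partial_congr R k cut_field (fun z => disk_cut x0 r z * f (z - pole))); last exact: near_open oV h VE.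
apply: partialP; apply: is_derive_mul; first exact: (Cn_on_derive _ (Cn_on_disk_cut 1 x0 r)).
by apply: is_derive_shift; apply: Df; exact: sub_neq0.
Qed.

End TestFields.

(** The letters stand for: t and v, the modulus of the first and the value of the second frame
    coordinate; N, the reciprocal kernel; l0 and lX, the distances to x0 and to the pole; q, the
    squared Euclidean distance to the pole. The last bound holds since lX >= e / (2 (L + 1)) and q
    >= lX^2 / 2. *)
Lemma kernel_arith (R : realFieldType) (L e t v N l0 lX q : R) : 0 <= L -> 0 < e -> 0 <= t -> - (L * t) <= v -> N = v + (L + 1) * t + e ->
  0 <= lX -> t + `|v + e| <= 2 * lX -> l0 <= 2 * (t + `|v|) -> lX ^+ 2 <= 2 * q ->
  [/\ t + e <= N, l0 <= 2 * (L + 2) * N, N <= 2 * (L + 1) * lX & (e / (4 * (L + 1))) ^+ 2 < q].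
Proof.
move=> L0 e0 t0 yL NE lX0 hX h0 hq.
have N1 : t + e <= N by rewrite NE; lra.
have N0 : 0 <= N by lra.
have LN : L * t <= L * N by rewrite ler_wpM2l //; lra.
have LN0 : 0 <= L * N by rewrite mulr_ge0.
have Lt : 0 <= L * t by rewrite mulr_ge0.
have y2N : v <= N by rewrite NE; lra.
have y2 : `|v| <= (L + 1) * N by rewrite ler_norml; apply/andP; split; lra.
have NX : N <= 2 * (L + 1) * lX.
  rewrite [2 * _]mulrC -mulrA.
  apply: (@le_trans _ _ ((L + 1) * (t + `|v + e|))); last by rewrite ler_wpM2l //; lra.
  have h1 := ler_norm (v + e); have h2 : 0 <= L * `|v + e| by rewrite mulr_ge0.
  by rewrite NE; lra.
split => //; first by lra.
have L10 : 0 < L + 1 by lra.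
have h1 : e / (4 * (L + 1)) <= lX / 2.
  by rewrite ler_pdivrMr; [lra|rewrite mulr_gt0].
have p0 : 0 < e / (4 * (L + 1)) by rewrite divr_gt0 // mulr_gt0.
move: (e / _) p0 h1 => u p0 h1; nra.
Qed.

(** * Distances to x0 and to the pole in the corner frame *)

Section FrameEstimates.
Context {R : realType}.
Variables (x0 : R * R) (c s L e : R).
Hypothesis cs1 : c ^+ 2 + s ^+ 2 = 1.
Hypothesis L0 : 0 <= L.
Hypothesis e0 : 0 < e.

Let pole := unframe x0 c s (0, - e).

Lemma sub_pole x : x - pole =
  (c * (frame x0 c s x).1 + s * ((frame x0 c s x).2 + e),
   - s * (frame x0 c s x).1 + c * ((frame x0 c s x).2 + e)).
Proof.
rewrite -{1}(frameK x0 cs1 x) /pole /unframe.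
rewrite opprD addrACA subrr add0r.
by rewrite -[LHS]/(_ - _, _ - _) /=; congr (_, _); ring.
Qed.

(** Rotating the variables rotates the coefficient pair (1, tau); the pole becomes the shift by e in
    the vertical frame coordinate. *)
Lemma linf_sub_pole (tau : R[i]) x : linf 1 tau (x - pole) =
  linf (c%:C - s%:C * tau) (s%:C + c%:C * tau) ((frame x0 c s x).1, (frame x0 c s x).2 + e).
Proof. by rewrite sub_pole /linf /= !rmorphD /= !rmorphM /= !rmorphN /= rmorphD; ring. Qed.

Lemma sqn_rot_le (a b : R) : a ^+ 2 <= 2 * b ^+ 2 -> 0 <= b -> a <= 2 * b.
Proof. by move=> h b0; rewrite leNgt; apply/negP => lt; nra. Qed.

(** Above the graph the distance to the pole is at least a multiple of N, and the distance to x0 at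
    most a multiple of N. A factor that vanishes at x0 therefore gains one power of the kernel. *)
Lemma kernel_estimates x : let y := frame x0 c s x in let N := y.2 + (L + 1) * `|y.1| + e in
  - (L * `|y.1|) <= y.2 ->
  [/\ `|y.1| + e <= N, l1 (x - x0) <= 2 * (L + 2) * N, N <= 2 * (L + 1) * l1 (x - pole) &
      (e / (4 * (L + 1))) ^+ 2 < sqn (x - pole)].
Proof.
move=> y N yL.
have sqX : sqn (x - pole) = y.1 ^+ 2 + (y.2 + e) ^+ 2.
  rewrite sub_pole -/y /sqn /= -[RHS]mul1r -cs1; ring.
have sq0 : sqn (x - x0) = sqn y by rewrite -!enorm_sqn /y (enorm_frame x0 cs1).
apply: (kernel_arith (v := y.2) L0 e0) => //; first exact: l1_ge0.
- apply: sqn_rot_le; last exact: l1_ge0.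
  apply: le_trans (l1_le_sqn (y.1, y.2 + e)) _; rewrite /sqn /= -sqX.
  by rewrite ler_wpM2l // sqn_le_l1.
- apply: (@sqn_rot_le (l1 (x - x0)) (l1 y)); last exact: l1_ge0.
  by apply: le_trans (l1_le_sqn _) _; rewrite sq0 ler_wpM2l // sqn_le_l1.
exact: l1_le_sqn.
Qed.

End FrameEstimates.

(** * Error terms *)

Section PointwiseEstimate.
Context {R : realType}.
Variables (c c0 c1 : tensor R) (e f : 'I_2 -> R) (Psi q w g h A : 'I_2 -> 'I_2 -> R) (u v : 'I_2 -> R)
  (eta rho kap : R).

Let Ax i j := \sum_k \sum_l (c i j k l - c0 i j k l) * q k l.

Definition test_value : R :=
  \sum_i (- (\sum_j \sum_k \sum_l c i j k l * (e j * f i + eta * Psi i j) * (q k l + w k l)) +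
     kap * rho * (eta * f i) * (u i + v i) +
     (\sum_j \sum_k \sum_l c0 i j k l * (e j * f i + eta * Psi i j) * q k l -
       kap * (eta * f i) * u i)) +
  \sum_k \sum_l ((e k * g k l + eta * h k l) * v l + (eta * g k l) * w k l).

(** Each summand has a factor that is small at x0, namely Ax - A, c - c1 or the cut-off gradient e,
    or it contains f, which is one order less singular than Psi. *)
Definition error_value : R :=
  \sum_i \sum_j (- (eta * (Ax i j - A i j) * Psi i j) - Ax i j * e j * f i) -
  \sum_i \sum_j \sum_k \sum_l (eta * (c i j k l - c1 i j k l) * Psi i j + c i j k l * e j * f i) * w k l +
  \sum_i kap * eta * f i * (rho * (u i + v i) - u i) +
  \sum_k \sum_l e k * g k l * v l.

Hypothesis gE : forall k l, g k l = \sum_i \sum_j c1 i j k l * Psi i j.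
Hypothesis h0 : forall l, \sum_k h k l = 0.

Lemma test_valueE : test_value = - (eta * \sum_i \sum_j A i j * Psi i j) + error_value.
Proof.
have e1 i : - (\sum_j \sum_k \sum_l c i j k l * (e j * f i + eta * Psi i j) * (q k l + w k l)) +
    \sum_j \sum_k \sum_l c0 i j k l * (e j * f i + eta * Psi i j) * q k l =
    - (\sum_j (e j * f i + eta * Psi i j) * Ax i j) -
    \sum_j \sum_k \sum_l c i j k l * (e j * f i + eta * Psi i j) * w k l.
  by rewrite /Ax !sum2; ring.
have e2 : \sum_k \sum_l ((e k * g k l + eta * h k l) * v l + (eta * g k l) * w k l) =
   \sum_k \sum_l e k * g k l * v l + \sum_k \sum_l (eta * \sum_i \sum_j c1 i j k l * Psi i j) * w k l.
  have h1 l : h 1 l = - h 0 l by have := h0 l; rewrite sum2 => /eqP; rewrite addrC addr_eq0 => /eqP.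
  have -> : \sum_k \sum_l (eta * \sum_i \sum_j c1 i j k l * Psi i j) * w k l = \sum_k \sum_l eta * g k l * w k l.
    by apply: eq_bigr => k _; apply: eq_bigr => l _; rewrite gE.
  by rewrite !sum2 !h1; ring.
rewrite /test_value e2.
rewrite (eq_bigr (fun i => - (\sum_j (e j * f i + eta * Psi i j) * Ax i j) -
    \sum_j \sum_k \sum_l c i j k l * (e j * f i + eta * Psi i j) * w k l +
   kap * eta * f i * (rho * (u i + v i) - u i))); last first.
  move=> i _; rewrite -e1; ring.
rewrite /error_value; move: (Ax) => B; rewrite !sum2; ring.
Qed.

Variables (a k d : R).
Hypothesis a1 : 1 <= a.
Hypothesis k0 : 0 <= k.
Hypothesis dk : 0 <= d /\ d * k <= a.
Hypothesis eta01 : 0 <= eta <= 1.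
Hypothesis kap_le : 0 <= kap <= a.
Hypothesis rho_le : `|rho| <= a.
Hypothesis u_le : forall i, `|u i| <= a.
Hypothesis Psi_le : forall i j, `|Psi i j| <= a * k ^+ 2.
Hypothesis f_le : forall i, `|f i| <= a * k.
Hypothesis e_le : forall j, `|e j| <= a * d /\ `|e j| <= a.
Hypothesis Ax_le : forall i j, `|Ax i j - A i j| <= a * d /\ `|Ax i j| <= a.
Hypothesis c_le : forall i j m l, `|c i j m l - c1 i j m l| <= a * d /\ `|c i j m l| <= a.
Hypothesis c1_le : forall i j m l, `|c1 i j m l| <= a.

Let norm_sum_le n (F G : 'I_n -> R) : (forall i, `|F i| <= G i) -> `|\sum_(i < n) F i| <= \sum_(i < n) G i.
Proof. by move=> H; apply: le_trans (ler_norm_sum _ _ _) _; apply: ler_sum => i _. Qed.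

(** Here k is the kernel and d the distance to x0, so d k <= a lowers d k^2 to a multiple of k. The
    factor 16 dominates the counts 12, 10 and 8 with which 1, |v l| and |w m l| occur. *)
Lemma error_le : `|error_value| <=
  16 * a ^+ 4 * (k * (1 + \sum_l `|v l| + \sum_m \sum_l `|w m l|)).
Proof.
have a0 : 0 <= a by apply: le_trans a1.
have [d0 dka] := dk; have [/andP[n0 n1]] := (eta01, kap_le).
move=> /andP[kp0 kpa].
have ak0 : 0 <= a * k by rewrite mulr_ge0.
have ad0 : 0 <= a * d by rewrite mulr_ge0.
have ak2 : 0 <= a * k ^+ 2 by rewrite mulr_ge0 // sqr_ge0.
have a34 : a ^+ 3 * k <= a ^+ 4 * k.
  by rewrite ler_wpM2r // [leRHS]exprS ler_peMl // exprn_ge0.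
pose P := a ^+ 4 * k.
have P0 : 0 <= P by rewrite mulr_ge0 // exprn_ge0.
have dka3 x : a * d * (a * k ^+ 2) * x <= P * x \/ x < 0.
  have [x0|x0] := leP 0 x; [left|by right].
  rewrite ler_wpM2r //; apply: le_trans a34.
  have -> : a * d * (a * k ^+ 2) = (a ^+ 2 * k) * (d * k) by ring.
  have -> : a ^+ 3 * k = (a ^+ 2 * k) * a by ring.
  by rewrite ler_wpM2l // mulr_ge0 // sqr_ge0.
have D1 : a * d * (a * k ^+ 2) <= P by case: (dka3 1) => [|]; rewrite ?mulr1 // ltNge ler01.
have D2 : a * a * (a * k) <= P by apply: le_trans a34; rewrite le_eqVlt; apply/orP; left; apply/eqP; ring.
have nM (x y X Y : R) : `|x| <= X -> `|y| <= Y -> `|x * y| <= X * Y.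
  by move=> h1 h2; rewrite normrM; apply: ler_pM.
have nEta x X : `|x| <= X -> `|eta * x| <= X.
  by move=> h1; rewrite normrM (ger0_norm n0) -[leRHS]mul1r; apply: ler_pM.
have t1 i j : `|- (eta * (Ax i j - A i j) * Psi i j) - Ax i j * e j * f i| <= 2 * P.
  have [h1 h2] := Ax_le i j; have [h3 h4] := e_le j.
  apply: le_trans (ler_normB _ _) _; rewrite normrN mulr_natl mulr2n; apply: lerD.
    apply: le_trans D1; rewrite -mulrA; apply: (nEta); exact: nM.
  by apply: le_trans D2; apply: (nM) => //; exact: nM.
have t3 i j m l : `|(eta * (c i j m l - c1 i j m l) * Psi i j + c i j m l * e j * f i) * w m l| <= 2 * P * `|w m l|.
  have [h1 h2] := c_le i j m l; have [h3 h4] := e_le j.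
  apply: (nM) => //; apply: le_trans (ler_normD _ _) _; rewrite mulr_natl mulr2n; apply: lerD.
    apply: le_trans D1; rewrite -mulrA; apply: (nEta); exact: nM.
  by apply: le_trans D2; apply: (nM) => //; exact: nM.
have t4 i : `|kap * eta * f i * (rho * (u i + v i) - u i)| <= 2 * P * (1 + `|v i|).
  have h1 : `|kap * eta * f i| <= a * (a * k).
    rewrite -mulrA; apply: (nM); first by rewrite ger0_norm.
    exact: nEta.
  have h2 : `|rho * (u i + v i) - u i| <= a * (a + `|v i|) + a.
    apply: le_trans (ler_normB _ _) _; apply: lerD => //; apply: nM => //.
    by apply: le_trans (ler_normD _ _) _; rewrite lerD2r.
  apply: le_trans (nM _ _ _ _ h1 h2) _.
  have h3 : a * (a + `|v i|) + a <= 2 * a ^+ 2 * (1 + `|v i|).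
    have := normr_ge0 (v i) => v0.
    have aa : a <= a ^+ 2 by rewrite expr2 ler_peMl.
    have av : a * `|v i| <= a ^+ 2 * `|v i| by rewrite ler_wpM2r.
    have av0 : 0 <= a ^+ 2 * `|v i| by rewrite mulr_ge0 // sqr_ge0.
    by rewrite mulrDr -expr2; lra.
  apply: le_trans (ler_wpM2l _ h3) _; first by rewrite mulr_ge0.
  by rewrite le_eqVlt; apply/orP; left; apply/eqP; rewrite /P; ring.
have gl m l : `|g m l| <= 4 * a * (a * k ^+ 2).
  rewrite gE; have -> : 4 * a * (a * k ^+ 2) = \sum_(i < 2) \sum_(j < 2) a * (a * k ^+ 2) by rewrite !sum2; ring.
  by apply: norm_sum_le => i; apply: norm_sum_le => j; apply: (nM).
have t5 m l : `|e m * g m l * v l| <= 4 * P * `|v l|.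
  apply: (nM) => //; have [h1 _] := e_le m.
  apply: le_trans (nM _ _ _ _ h1 (gl m l)) _.
  have -> : a * d * (4 * a * (a * k ^+ 2)) = 4 * ((a ^+ 3 * k) * (d * k)) by ring.
  have -> : 4 * P = 4 * ((a ^+ 3 * k) * a) by rewrite /P; ring.
  by rewrite ler_pM2l // ler_wpM2l // mulr_ge0 // exprn_ge0.
have s1 := norm_sum_le (fun i => norm_sum_le (t1 i)).
have s3 := norm_sum_le (fun i => norm_sum_le (fun j => norm_sum_le (fun m => norm_sum_le (t3 i j m)))).
have s4 := norm_sum_le t4; have s5 := norm_sum_le (fun m => norm_sum_le (t5 m)).
rewrite /error_value; apply: le_trans (ler_normD _ _) _.
apply: (@le_trans _ _ (_ + _)); first by apply: lerD s5; apply: le_trans (ler_normD _ _) (lerD (le_trans (ler_normB _ _) (lerD s1 s3)) s4).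
have -> : 16 * a ^+ 4 * (k * (1 + \sum_l `|v l| + \sum_m \sum_l `|w m l|)) =
   16 * P * (1 + \sum_l `|v l| + \sum_m \sum_l `|w m l|) by rewrite /P; ring.
move: P P0 {D1 D2 dka3 t1 t3 t4 t5 s1 s3 s4 s5} => P P0; rewrite !sum2.
have pv l : 0 <= P * `|v l| by rewrite mulr_ge0.
have pw m l : 0 <= P * `|w m l| by rewrite mulr_ge0.
have := pv 0; have := pv 1; have := pw 0 0; have := pw 0 1; have := pw 1 0; have := pw 1 1.
lra.
Qed.

End PointwiseEstimate.

Lemma young_le (R : realFieldType) (s k x : R) : 0 < s -> k * x <= s * k ^+ 2 + x ^+ 2 / (4 * s).
Proof.
move=> s0; rewrite -subr_ge0.
have -> : s * k ^+ 2 + x ^+ 2 / (4 * s) - k * x = (2 * s * k - x) ^+ 2 / (4 * s).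
  by field; rewrite gt_eqF.
by rewrite divr_ge0 ?sqr_ge0 // mulr_ge0 // ltW.
Qed.

(** * Uniform bounds, change of frame and scaling *)

Section Tools.
Context {R : realType}.
Local Notation Re := complex.Re.
Local Notation Im := complex.Im.
Local Notation P := (measurableTypeR R * measurableTypeR R)%type.

Lemma uniform_bound (I : finType) (Q : I -> R -> Prop) :
  (forall i K K', K <= K' -> Q i K -> Q i K') -> (forall i, exists2 K, 0 <= K & Q i K) ->
  exists2 K, 0 <= K & forall i, Q i K.
Proof.
move=> mono ex.
have H i : {K | 0 <= K /\ Q i K} by apply: cid; have [K K0 QK] := ex i; exists K.
exists (\sum_i sval (H i)); first by apply: sumr_ge0 => i _; case: (H i) => K [].
move=> i; apply: (mono _ (sval (H i))); last by case: (H i) => K [].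
by rewrite (bigD1 i) //= lerDl sumr_ge0 // => j _; case: (H j) => K [].
Qed.

Definition C1_bound (p : R * R) (r : R) (h : R * R -> R) (K : R) :=
  forall x, disk p r x -> `|h x - h p| <= K * l1 (x - p) /\ `|h x| <= K.

Lemma C1_bound_mono p r h K K' : K <= K' -> C1_bound p r h K -> C1_bound p r h K'.
Proof.
move=> KK H x /H[h1 h2]; split; last exact: le_trans KK.
by apply: le_trans h1 _; rewrite ler_wpM2r // l1_ge0.
Qed.

Lemma C1_bound_ex p r h : Cn_on 1 setT h -> exists2 K, 0 <= K & C1_bound p r h K.
Proof.
move=> /(lipschitz_at p r)[K K0 HK].
exists (K + (`|h p| + K * (2 * `|r|))); first by rewrite !(addr_ge0, mulr_ge0).
move=> x xr; have h1 := HK x xr; split.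
  apply: le_trans h1 _; rewrite ler_wpM2r ?l1_ge0 // lerDl.
  by rewrite !(addr_ge0, mulr_ge0).
have lr : l1 (x - p) <= 2 * `|r|.
  have r1 : enorm (x - p) <= `|r| by apply: le_trans (ltW xr) (ler_norm r).
  by have := enorm_ge1 (x - p); have := enorm_ge2 (x - p); rewrite /l1; lra.
have -> : h x = h p + (h x - h p) by rewrite addrC subrK.
apply: le_trans (ler_normD _ _) _.
have : K * l1 (x - p) <= K * (2 * `|r|) by rewrite ler_wpM2l.
by have := normr_ge0 (h p); lra.
Qed.

Lemma C1_bounds (p : R * R) r (I : finType) (h : I -> R * R -> R) :
  (forall i, Cn_on 1 setT (h i)) -> exists2 K, 0 <= K & forall i, C1_bound p r (h i) K.
Proof.
move=> H; apply: uniform_bound => [i K K'|i]; first exact: C1_bound_mono.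
exact: C1_bound_ex.
Qed.

Lemma I2_le (f g : R * R -> R) : intg f -> intg g -> (forall x, f x <= g x) -> I2 f <= I2 g.
Proof. by move=> hf hg h; apply: le_Rintegral. Qed.

Lemma I2Z (c : R) (f : R * R -> R) : intg f -> I2 (fun x => c * f x) = c * I2 f.
Proof. by move=> hf; exact: RintegralZl. Qed.

Lemma intg_box_sqr (f : R * R -> R) r : L2loc_real f -> intg (fun x => \1_(box r) x * f x ^+ 2).
Proof.
move=> Lf; have := L2loc_box_integrable r Lf.
move/(integrable_mkcond _ (measurable_box r)).
apply: eq_integrable => // x _; rewrite patchE /= indicE.
by case: (_ \in _); rewrite ?mul1r ?mul0r.
Qed.

Lemma frame_preserves (x0 : R * R) (c s : R) : c ^+ 2 + s ^+ 2 = 1 -> preserves (frame x0 c s).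
Proof.
move=> cs; have := preserves_comp (preserves_rot cs) (preserves_translation x0).
exact.
Qed.

Lemma I2_frame (x0 : R * R) (c s : R) (f : R * R -> R) : c ^+ 2 + s ^+ 2 = 1 -> intg f ->
  intg (fun x => f (frame x0 c s x)) /\ I2 (fun x => f (frame x0 c s x)) = I2 f.
Proof.
move=> cs hf; have p := frame_preserves x0 cs; split; first exact: (preserves_integrable p hf).
by rewrite /I2 /Rintegral; congr (fine _); exact: (preserves_integral p hf).
Qed.

Lemma corner_integrable (z0 z1 b : R[i]) (phi : R -> R) (L delta H e : R) : Im (z1 * conjc z0) != 0 ->
  0 <= L -> (forall t u, `|phi t - phi u| <= L * `|t - u|) -> phi 0 = 0 -> 0 < e ->
  intg (fun y => \1_(strip delta H phi) y * Re (b * (linf z0 z1 (y.1, y.2 + e))^-1 ^+ 2)).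
Proof.
move=> zz L0 lip p0 e0; have cp := lip_continuous L0 lip.
pose sh (y : R * R) : R * R := (y.1, y.2 + e).
have csh : continuous sh.
  move=> y; apply: (@continuous_pairing R (R * R)%type fst (fun y => y.2 + e)); first exact: cvg_fst.
  by apply: cvgD; [exact: cvg_snd|exact: cvg_cst].
pose U := [set y | sh y != 0].
have oU : open U by apply: (@open_comp _ _ sh [set x | x != 0]); [move=> y _; exact: csh|exact: open_neq0].
apply: (strip_integrable (g := fun y => Re (b * (linf z0 z1 (sh y))^-1 ^+ 2)) cp oU).
  move=> -[t s] [_ /= ps _]; apply/eqP => -[t0 se]; move: ps; rewrite t0 p0; lra.
move=> y Uy; apply: (@continuous_comp _ _ _ sh (fun z => Re (b * (linf z0 z1 z)^-1 ^+ 2))); first exact: csh.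
exact: continuous_linfV.
Qed.

(** All conditions on (p, q) are linear over the complex numbers, so b can be given any prescribed
    phase and size. *)
Lemma Phi_scale (tau th : R[i]) (p q : 'I_2 -> R[i]) :
  (forall (C : tensor R) l, \sum_i \sum_j \sum_k (C i j k l)%:C * (th * q i * zc tau j * zc tau k) =
     th * \sum_i \sum_j \sum_k (C i j k l)%:C * (q i * zc tau j * zc tau k)) /\
  (forall (C : tensor R) l, \sum_i \sum_j \sum_k (C i j k l)%:C *
       (th * p i * zc tau j * zc tau k - th * q i * (nc j * zc tau k + zc tau j * nc k)) =
     th * \sum_i \sum_j \sum_k (C i j k l)%:C * (p i * zc tau j * zc tau k - q i * (nc j * zc tau k + zc tau j * nc k))) /\
  (forall A : 'I_2 -> 'I_2 -> R, \sum_i \sum_j (A i j)%:C * (th * q i * zc tau j) =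
     th * \sum_i \sum_j (A i j)%:C * (q i * zc tau j)) /\
  (forall A : 'I_2 -> 'I_2 -> R, \sum_i \sum_j (A i j)%:C * (th * q i * nc j - th * p i * zc tau j) =
     th * \sum_i \sum_j (A i j)%:C * (q i * nc j - p i * zc tau j)).
Proof. by split; [|split; [|split]] => *; rewrite !sum2; ring. Qed.

End Tools.

(** * The test fields with pole at distance e *)

Section CornerFields.
Context {R : realType}.
Local Notation Re := complex.Re.
Local Notation Im := complex.Im.
Variables (x0 : R * R) (r c s L e : R) (tau : R[i]) (p q : 'I_2 -> R[i]) (C1 : tensor R).
Hypothesis tau_im : Im tau != 0.
Hypothesis r0 : 0 < r.
Hypothesis cs1 : c ^+ 2 + s ^+ 2 = 1.
Hypothesis L0 : 0 <= L.
Hypothesis e0 : 0 < e.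

Definition cpole : R * R := unframe x0 c s (0, - e).
(** The radius of the last bound of [kernel_estimates]: points on or above the graph are farther
    than this from the pole, hence unaffected by the cut-off. *)
Definition crad : R := e / (4 * (L + 1)).
Definition stress (k l : 'I_2) (X : R * R) : R := \sum_i \sum_j C1 i j k l * Re (Psi tau p q i j X).
Definition dstress (k l m : 'I_2) (X : R * R) : R :=
  \sum_i \sum_j C1 i j k l * partial m (cRe (Psi tau p q i j)) X.
Definition psi_field (i : 'I_2) : R * R -> R := cut_field x0 r cpole crad (cRe (Phi tau p q i)).
Definition F_field (k l : 'I_2) : R * R -> R := cut_field x0 r cpole crad (stress k l).

Lemma crad_gt0 : 0 < crad.
Proof. by rewrite divr_gt0 // mulr_gt0 // ltr_wpDl. Qed.

Lemma Phi_smooth i n : Cn_on n [set x : R * R | x != 0] (cRe (Phi tau p q i)).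
Proof. by case: (cCn_Phi p q tau_im n i). Qed.

Lemma Psi_smooth i j n : Cn_on n [set x : R * R | x != 0] (cRe (Psi tau p q i j)).
Proof. by case: (cCn_Psi p q tau_im n i j). Qed.

Lemma stress_smooth k l n : Cn_on n [set x : R * R | x != 0] (stress k l).
Proof.
have oN := @open_neq0 R.
do 2!(apply: Cn_on_sum => // ?); apply: Cn_on_scale => //; exact: Psi_smooth.
Qed.

Lemma Phi_derive i k x : x != 0 -> is_derive x (basis_vec k) (cRe (Phi tau p q i)) (Re (Psi tau p q i k x)).
Proof. by move=> x0'; case: (cder_Phi p q tau_im i k x0'). Qed.

Lemma stress_derive k l m x : x != 0 -> is_derive x (basis_vec m) (stress k l) (dstress k l m x).
Proof.
move=> x0'; do 2!(apply: is_derive_fsum => ?); apply: is_derive_cmul.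
exact: (Cn_on_derive _ (Psi_smooth _ _ 1)).
Qed.

Lemma psi_field_test i : test_function (psi_field i).
Proof. exact: (cut_field_test _ _ r0 crad_gt0 (Phi_smooth i)). Qed.

Lemma F_field_test k l : test_function (F_field k l).
Proof. exact: (cut_field_test _ _ r0 crad_gt0 (stress_smooth k l)). Qed.

Lemma psi_field_far i x : r <= enorm (x - x0) -> psi_field i x = 0 /\ forall k, partial k (psi_field i) x = 0.
Proof. exact: cut_field_far. Qed.

Lemma F_field_far k l x : r <= enorm (x - x0) -> F_field k l x = 0 /\ forall m, partial m (F_field k l) x = 0.
Proof. exact: cut_field_far. Qed.

Lemma psi_field_near i x : crad ^+ 2 < sqn (x - cpole) ->
  psi_field i x = disk_cut x0 r x * Re (Phi tau p q i (x - cpole)) /\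
  forall k, partial k (psi_field i) x = partial k (disk_cut x0 r) x * Re (Phi tau p q i (x - cpole)) +
     disk_cut x0 r x * Re (Psi tau p q i k (x - cpole)).
Proof. exact: (cut_field_near x0 r crad_gt0 (Phi_derive i)). Qed.

Lemma F_field_near k l x : crad ^+ 2 < sqn (x - cpole) ->
  F_field k l x = disk_cut x0 r x * stress k l (x - cpole) /\
  forall m, partial m (F_field k l) x = partial m (disk_cut x0 r) x * stress k l (x - cpole) +
     disk_cut x0 r x * dstress k l m (x - cpole).
Proof. exact: (cut_field_near x0 r crad_gt0 (stress_derive k l)). Qed.

End CornerFields.

Lemma sum_dominates (R : realFieldType) (x1 x2 x3 x4 x5 x6 x7 x8 x9 : R) :
  0 <= x1 -> 0 <= x2 -> 0 <= x3 -> 0 <= x4 -> 0 <= x5 -> 0 <= x6 -> 0 <= x7 -> 0 <= x8 -> 0 <= x9 ->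
  let a := 1 + x1 + x2 + x3 + x4 + x5 + x6 + x7 + x8 + x9 in
  [/\ 1 <= a, x1 <= a, x2 <= a, x3 <= a & x4 <= a] /\ [/\ x5 <= a, x6 <= a, x7 <= a, x8 <= a & x9 <= a].
Proof. by move=> h1 h2 h3 h4 h5 h6 h7 h8 h9 a; rewrite /a; split; split; lra. Qed.

(** * Pointwise bound, uniform in the distance of the pole *)

Section PointwiseBound.
Context {R : realType}.
Local Notation Re := complex.Re.
Local Notation Im := complex.Im.
Variables (u v : 'I_2 -> R * R -> R) (G : 'I_2 -> 'I_2 -> R * R -> R)
  (C Ct : tensor_field R) (C0 : tensor R) (rho : R * R -> R) (kappa : R) (Dc : set (R * R)).
Variables (x0 : R * R) (r c s L : R) (phi : R -> R) (tau : R[i]) (p q : 'I_2 -> R[i]) (b : R[i]).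

Let w k l x := G k l x - partial k (u l) x.
Let A x i j := \sum_k \sum_l (Ct x i j k l - C0 i j k l) * partial k (u l) x.
Let T e := transmission_integrand u v G C C0 rho kappa
   (psi_field x0 r c s L e tau p q) (F_field x0 r c s L e tau p q (Ct x0)).

(** What matters is that K is chosen before e. The bounds on Ct, u and the disk cut-off do not see
    the pole, and those on [Phi] and [Psi] are homogeneous in the distance to it. *)
Lemma corner_pointwise_bound : Im tau != 0 -> 0 < r -> c ^+ 2 + s ^+ 2 = 1 -> 0 <= L ->
  (forall t, `|phi t| <= L * `|t|) ->
  (forall x, disk x0 r x -> Dc x -> phi (frame x0 c s x).1 <= (frame x0 c s x).2) ->
  (forall l, Cn_on 2 setT (u l)) -> (forall i j k l, Cn_on 1 setT (fun x => Ct x i j k l)) ->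
  (forall x, Dc x -> C x = Ct x) -> (exists M, forall x, `|rho x| <= M) ->
  (forall l, \sum_i \sum_j \sum_k (Ct x0 i j k l)%:C * (q i * zc tau j * zc tau k) = 0) ->
  (forall l, \sum_i \sum_j \sum_k (Ct x0 i j k l)%:C *
     (p i * zc tau j * zc tau k - q i * (nc j * zc tau k + zc tau j * nc k)) = 0) ->
  \sum_i \sum_j (A x0 i j)%:C * (q i * zc tau j) = 0 ->
  \sum_i \sum_j (A x0 i j)%:C * (q i * nc j - p i * zc tau j) = b ->
  exists2 K, 0 < K & forall e, 0 < e -> forall x, Dc x -> disk x0 r x ->
    `|T e x + disk_cut x0 r x * Re (b * (linf (c%:C - s%:C * tau) (s%:C + c%:C * tau)
         ((frame x0 c s x).1, (frame x0 c s x).2 + e))^-1 ^+ 2)| <=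
    K * (skernel L e (frame x0 c s x) *
         (1 + \sum_l `|v l x| + \sum_k \sum_l `|w k l x|)).
Proof.
move=> tau_im r0 cs1 L0 lp Dgraph C2u C1Ct Cin [M HM] S1 S2 Aq Ab.
have C1u l : Cn_on 1 setT (u l) by exact: Cn_on_le.
have C1du k l : Cn_on 1 setT (partial k (u l)) by exact: Cn_on_partial.
have C1A i j : Cn_on 1 setT (fun x => A x i j).
  have oT : open [set: R * R] by exact: openT.
  apply: (Cn_on_sum oT) => k; apply: (Cn_on_sum oT) => l; apply: (Cn_on_mul oT); last exact: C1du.
  by apply: (Cn_on_sub oT); [exact: C1Ct|exact: Cn_on_cst].
pose I4 := ('I_2 * 'I_2 * 'I_2 * 'I_2)%type.
have [K1 K10 H1] := C1_bounds x0 r (fun z : I4 => C1Ct z.1.1.1 z.1.1.2 z.1.2 z.2).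
have [K2 K20 H2] := C1_bounds x0 r (fun z : 'I_2 * 'I_2 => C1A z.1 z.2).
have [K3 K30 H3] := C1_bounds x0 r C1u.
have [K4 K40 H4] := C1_bounds x0 r (fun k : 'I_2 => Cn_on_partial k (Cn_on_disk_cut 2 x0 r)).
have [K5 K50 H5] : exists2 K, 0 <= K & forall (z : 'I_2 * 'I_2) (x : R * R), x != 0 ->
    `|Re (Psi tau p q z.1 z.2 x)| <= K / l1 x ^+ 2.
  apply: uniform_bound => [z K K' KK h x xn|z].
    by apply: le_trans (h x xn) _; rewrite ler_wpM2r // invr_ge0 exprn_ge0 // l1_ge0.
  by have [K /ltW K0 h] := Psi_bound p q tau_im z.1 z.2; exists K.
have [K6 K60 H6] : exists2 K, 0 <= K & forall (i : 'I_2) (x : R * R), x != 0 ->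
    `|Re (Phi tau p q i x)| <= K / l1 x.
  apply: uniform_bound => [z K K' KK h x xn|z].
    by apply: le_trans (h x xn) _; rewrite ler_wpM2r // invr_ge0 l1_ge0.
  by have [K /ltW K0 h] := Phi_bound p q tau_im z; exists K.
have M0 : 0 <= M by apply: le_trans (HM x0).
have kk0 : 0 <= kappa ^+ 2 by exact: sqr_ge0.
pose L2 := 2 * (L + 1); have L20 : 0 <= L2 by rewrite mulr_ge0 // addr_ge0.
have L40 : 0 <= 2 * (L + 2) by rewrite mulr_ge0 // addr_ge0.
(* One constant for all the hypotheses of [error_le]. The factor L2 converts an inverse distance to
   the pole into the kernel, and 2 (L + 2) bounds the distance to x0 times the kernel. *)
pose a := 1 + K1 + K2 + K3 + K4 + K5 * L2 ^+ 2 + K6 * L2 + M + kappa ^+ 2 + 2 * (L + 2).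
have K50' : 0 <= K5 * L2 ^+ 2 by rewrite mulr_ge0 // sqr_ge0.
have K60' : 0 <= K6 * L2 by rewrite mulr_ge0.
have [[a1 aK1 aK2 aK3 aK4] [aK5 aK6 aM ak aL]] := sum_dominates K10 K20 K30 K40 K50' K60' M0 kk0 L40; rewrite -/a in a1 aK1 aK2 aK3 aK4 aK5 aK6 aM ak aL.
exists (16 * a ^+ 4); first by rewrite mulr_gt0 // exprn_gt0 // (lt_le_trans ltr01).
move=> e e0 x Dx dx.
pose y := frame x0 c s x; pose N := y.2 + (L + 1) * `|y.1| + e.
have yL : - (L * `|y.1|) <= y.2.
  apply: le_trans (Dgraph x dx Dx); have := lp y.1; rewrite ler_norml => /andP[h _]; exact: h.
have [N1 N2 N3 N4] := kernel_estimates cs1 L0 e0 yL.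
have N0 : 0 < N by apply: lt_le_trans N1; rewrite ltr_wpDl.
have Np := N0; have X0 := sub_neq0 N4.
set X := x - _ in N3 N4 X0.
have k0 : 0 <= skernel L e y by rewrite invr_ge0 ltW.
have lX : 0 < l1 X.
  rewrite -(pmulr_rgt0 _ (_ : 0 < 2 * (L + 1))); first exact: lt_le_trans N3.
  by rewrite mulr_gt0 // ltr_wpDl.
have lXV : (l1 X)^-1 <= L2 * skernel L e y.
  by rewrite ler_pdivlMr // mulrC ler_pdivrMr.
pose k := skernel L e y; rewrite -/k in k0 lXV *.
pose eta := disk_cut x0 r x.
pose fX i := Re (Phi tau p q i X); pose PX i j := Re (Psi tau p q i j X).
pose gX m l := stress tau p q (Ct x0) m l X; pose hX m l := dstress tau p q (Ct x0) m l m X.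
pose eX j := partial j (disk_cut x0 r) x.
(* By [N4] the point x lies outside the ball around the pole in which the fields are modified, so
   the product formulas for their derivatives hold. *)
have E : T e x = test_value (Ct x) C0 eX fX PX (fun m l => partial m (u l) x) (fun m l => w m l x) gX hX
    (fun i => u i x) (fun i => v i x) eta (rho x) (kappa ^+ 2).
  have gE m l : G m l x = partial m (u l) x + w m l x by rewrite /w addrC subrK.
  have Pn i := psi_field_near r p q tau_im L0 e0 i N4.
  have Fn m l := F_field_near r p q (Ct x0) tau_im L0 e0 m l N4.
  rewrite /T /transmission_integrand /test_value Cin //; congr (_ + _).
    apply: eq_bigr => i _; have [P1 P2] := Pn i; rewrite P1; congr (- _ + _ + (_ - _)).
      by do 3!(apply: eq_bigr => ? _); rewrite P2 gE.
    by do 3!(apply: eq_bigr => ? _); rewrite P2.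
  apply: eq_bigr => m _; apply: eq_bigr => l _; have [P1 P2] := Fn m l.
  by rewrite P1 P2.
have gE m l : gX m l = \sum_i \sum_j Ct x0 i j m l * PX i j by [].
have h0 l : \sum_m hX m l = 0.
  rewrite -[RHS](Psi_solves tau_im l X0 S1 S2) /hX /dstress exchange_big; apply: eq_bigr => i _.
  exact: exchange_big.
have AE : \sum_i \sum_j A x0 i j * PX i j = Re (b * (linf (c%:C - s%:C * tau) (s%:C + c%:C * tau)
         ((frame x0 c s x).1, (frame x0 c s x).2 + e))^-1 ^+ 2).
  by rewrite (Psi_pairing p X Aq) Ab /Wf /X linf_sub_pole.
rewrite E (test_valueE _ _ _ _ _ _ (A x0) _ _ _ _ _ gE h0) AE addrAC addNr add0r.
have x0d : disk x0 r x0 by rewrite /disk /= subrr /enorm /= expr0n addr0 sqrtr0.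
apply: (error_le _ _ gE (d := l1 (x - x0))) => //.
- split; first exact: l1_ge0.
  apply: (@le_trans _ _ (2 * (L + 2))); last exact: aL.
  by rewrite ler_pdivrMr.
- by rewrite /eta /disk_cut step_ge0 step_le1.
- by rewrite kk0.
- exact: le_trans (HM x) _.
- by move=> i; have [_ h] := H3 i x dx; exact: le_trans h _.
- move=> i j; apply: le_trans (H5 (i, j) X X0) _.
  apply: (@le_trans _ _ (K5 * (L2 * k) ^+ 2)).
    by rewrite -exprVn ler_wpM2l // lerXn2r // nnegrE ?invr_ge0 ?(ltW lX) // mulr_ge0.
  by rewrite exprMn mulrA ler_wpM2r ?sqr_ge0.
- move=> i; apply: le_trans (H6 i X X0) _.
  apply: (@le_trans _ _ (K6 * (L2 * k))); first by rewrite ler_wpM2l.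
  by rewrite mulrA ler_wpM2r.
- move=> j; have [h1 h2] := H4 j x dx.
  (* The cut-off is constant near x0; its gradient vanishes there and is thus bounded by a multiple
     of the distance, as [error_le] asks. *)
  have z0 : partial j (disk_cut x0 r) x0 = 0.
    rewrite (@partial_congr R j (disk_cut x0 r) (fun=> 1)); first by apply: partialP; exact: is_derive_cst.
    have oV : open [set z : R * R | 2 * sqn (z - x0) < r ^+ 2].
      apply: (@open_comp _ _ (fun z : R * R => 2 * sqn (z - x0)) [set t | t < r ^+ 2]); last exact: open_lt.
      move=> z _; apply: cvgMr; have h3 := @continuous_sub_cst R x0 z.
      exact: (continuous_comp h3 (@continuous_sqn R (z - x0))).
    apply: (near_open oV).
      by rewrite /= subrr /sqn /= expr0n addr0 mulr0 exprn_gt0.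
    by move=> z zV; apply: disk_cut1 => //; exact: ltW.
  rewrite z0 subr0 in h1; split; last exact: le_trans h2 _.
  by apply: le_trans h1 _; rewrite ler_wpM2r ?l1_ge0.
- move=> i j; have [h1 h2] := H2 (i, j) x dx; split; last exact: le_trans h2 _.
  by apply: le_trans h1 _; rewrite ler_wpM2r ?l1_ge0.
- move=> i j m l; have [h1 h2] := H1 (i, j, m, l) x dx; split; last exact: le_trans h2 _.
  by apply: le_trans h1 _; rewrite ler_wpM2r ?l1_ge0.
- by move=> i j m l; have [_ h2] := H1 (i, j, m, l) x0 x0d; exact: le_trans h2 _.
Qed.

End PointwiseBound.

(** * Blow-up at the corner *)

(** The main term contributes l / 2, the errors at most 8^-1 times 2 l; a quarter of the logarithm
    is left over. *)
Lemma log_arith (R : realFieldType) (l I K N : R) : l / 2 - K <= 8^-1 * I + N -> I <= 2 * l -> l / 4 <= K + N.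
Proof. by move=> h1 h2; lra. Qed.

Lemma log_unbounded (R : realFieldType) (x t K d : R) : (x + t) / 4 <= K -> 4 * K - d + 1 <= t -> d <= x -> False.
Proof. by move=> h1 h2 h3; lra. Qed.

Lemma half_arith (R : realFieldType) (r : R) : 0 < r -> 2 * (r / 4) < r.
Proof. by move=> r0; lra. Qed.

Lemma quarter_arith (R : realFieldType) (E r : R) : E <= (2 * (r / 4)) ^+ 2 -> 2 * E <= r ^+ 2.
Proof. by have := sqr_ge0 r; nra. Qed.

Lemma disk_sub_box (R : realType) (p : R * R) (r : R) x : disk p r x -> box (`|p.1| + `|p.2| + r) x.
Proof.
move=> dx; apply: contrapT => nbx.
have h (z : R * R) : ~ disk p r z -> (\1_(disk p r) : R * R -> R) z = 0 by move=> nz; rewrite indicE memNset.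
by have := disk_supp_box h nbx; rewrite indicE mem_set // => /eqP; rewrite oner_eq0.
Qed.

(** Seven products k |x|, one for 1, two for v and four for w, each given the share 1/56 of k^2, so
    that the total is 1/8. Young's inequality with weight 1 / (56 K) then costs 14 K^2 x^2. *)
Lemma field_young (R : realFieldType) (v : 'I_2 -> R) (w : 'I_2 -> 'I_2 -> R) (k K : R) : 0 < K ->
  K * (k * (1 + \sum_l `|v l| + \sum_m \sum_l `|w m l|)) <=
  8^-1 * k ^+ 2 + 14 * K ^+ 2 * (1 + \sum_l v l ^+ 2 + \sum_m \sum_l w m l ^+ 2).
Proof.
move=> K0.
have Y x : K * (k * `|x|) <= 56^-1 * k ^+ 2 + 14 * K ^+ 2 * x ^+ 2.
  have s0 : 0 < (56 * K)^-1 by rewrite invr_gt0 mulr_gt0.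
  have h := young_le k `|x| s0; rewrite real_normK ?num_real // in h.
  have -> : 56^-1 * k ^+ 2 + 14 * K ^+ 2 * x ^+ 2 = K * ((56 * K)^-1 * k ^+ 2 + x ^+ 2 / (4 * (56 * K)^-1)).
    by field; rewrite gt_eqF.
  by rewrite ler_pM2l.
have y1 := Y 1; rewrite normr1 expr1n in y1.
have := Y (v 0); have := Y (v 1); have := Y (w 0 0); have := Y (w 0 1); have := Y (w 1 0); have := Y (w 1 1).
rewrite !sum2; lra.
Qed.

Lemma field_le (R : realFieldType) (v : 'I_2 -> R) (w : 'I_2 -> 'I_2 -> R) :
  1 + \sum_l `|v l| + \sum_m \sum_l `|w m l| <= 7 * (1 + \sum_l v l ^+ 2 + \sum_m \sum_l w m l ^+ 2).
Proof.
have Y (x : R) : `|x| <= 1 + x ^+ 2 /\ 0 <= x ^+ 2.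
  by rewrite -(real_normK (num_real x)); split; [have := sqr_ge0 (`|x| - 1); have := normr_ge0 x; nra|exact: sqr_ge0].
have := Y (v 0); have := Y (v 1); have := Y (w 0 0); have := Y (w 0 1); have := Y (w 1 0); have := Y (w 1 1).
by rewrite !sum2 => -[? ?] [? ?] [? ?] [? ?] [? ?] [? ?]; lra.
Qed.

Lemma inside_arith (R : realFieldType) (T Q B k K4 K5 Z : R) : `|T + 1 * Q| <= B -> B <= 8^-1 * k ^+ 2 + K4 * Z ->
  0 <= K5 * Z -> Q <= - T + 8^-1 * k ^+ 2 + (K4 + K5) * Z.
Proof. by rewrite mul1r => /(le_trans (ler_norm _)) h1 h2 h3; lra. Qed.

(** Away from the strip the kernel is at most 1 / d, so every term, the main one included, is a
    multiple of the energy density Z. *)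
Lemma outside_arith (R : realFieldType) (T eta Q K k M Z d K4 K5 : R) : `|T + eta * Q| <= K * (k * M) -> 0 <= eta <= 1 ->
  `|Q| <= K4 -> 0 < K -> 0 <= k <= d^-1 -> 0 <= M -> M <= 7 * Z -> 1 <= Z -> 0 <= K5 -> T <= (K5 + K4 + 7 * (K / d)) * Z.
Proof.
move=> h1 /andP[n0 n1] hQ K0 /andP[k0 kd] M0 MZ Z1 K50.
have h2 : K * (k * M) <= K / d * (7 * Z).
  rewrite -mulrA ler_pM2l //; apply: ler_pM => //.
have h3 : `|eta * Q| <= K4 * Z.
  rewrite normrM (ger0_norm n0); apply: (@le_trans _ _ (1 * K4)); first exact: ler_pM.
  by rewrite mul1r ler_peMr // (le_trans _ hQ).
have h4 : T <= `|T + eta * Q| + `|eta * Q|.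
  by have := ler_norm (T + eta * Q); have := ler_norm (- (eta * Q)); rewrite normrN; lra.
have h5 : 0 <= K5 * Z by rewrite mulr_ge0 // (le_trans ler01).
lra.
Qed.

Lemma frame_arith (R : realFieldType) (v L t e : R) : 0 <= L -> v + (L + 1) * t + e <= (L + 1) * (t + `|v + e|).
Proof. by move=> L0; have := ler_norm (v + e); have := normr_ge0 (v + e); nra. Qed.

Section CornerArgument.
Context {R : realType}.
Local Notation Re := complex.Re.
Local Notation Im := complex.Im.
Local Notation P := (measurableTypeR R * measurableTypeR R)%type.
Variables (u v : 'I_2 -> R * R -> R) (G : 'I_2 -> 'I_2 -> R * R -> R)
  (C Ct : tensor_field R) (C0 : tensor R) (rho : R * R -> R) (kappa : R) (Dc : set (R * R)).
Hypothesis closed_Dc : closed Dc.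
Hypothesis L2v : forall l, L2loc_real (v l).
Hypothesis L2G : forall k l, L2loc_real (G k l).
Hypothesis C2u : forall l, Cn_on 2 setT (u l).
Hypothesis coefC : forall i j k l, coef (fun x => C x i j k l).
Hypothesis coef_rho : coef rho.
Hypothesis rho_bounded : exists M, forall x, `|rho x| <= M.
Hypothesis C_out : forall x, ~ Dc x -> C x = C0.
Hypothesis C_in : forall x, Dc x -> C x = Ct x.
Hypothesis C1_Ct : forall i j k l, Cn_on 1 setT (fun x => Ct x i j k l).
Hypothesis rho_out : forall x, ~ Dc x -> rho x = 1.
Hypothesis v_out : {ae mu2, forall x, ~ Dc x -> forall l, v l x = 0}.
Hypothesis weakG : forall k l phi, test_function phi ->
  I2 (fun x => partial k phi x * (u l x + v l x)) = - I2 (fun x => phi x * G k l x).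
Hypothesis weak_eq : forall i phi, test_function phi ->
  - I2 (fun x => \sum_j \sum_k \sum_l C x i j k l * partial j phi x * G k l x) +
  I2 (fun x => kappa ^+ 2 * rho x * phi x * (u i x + v i x)) = 0.
Hypothesis classical_eq : forall i x,
  \sum_j \sum_k \sum_l partial j (fun y => C0 i j k l * partial k (u l) y) x + kappa ^+ 2 * u i x = 0.
Variables (x0 : R * R) (r c s L mp mm cell : R) (phi : R -> R).
Hypothesis major : forall i j k l, Ct x0 i j k l = Ct x0 k l i j.
Hypothesis minor : forall i j k l, Ct x0 i j k l = Ct x0 j i k l.
Hypothesis cell_gt0 : 0 < cell.
Hypothesis elliptic : forall M : 'M[R]_2, M^T = M ->
  cell * (\sum_i \sum_j M i j ^+ 2) <= \sum_i \sum_j \sum_k \sum_l M i j * Ct x0 i j k l * M k l.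

Let w k l x := G k l x - partial k (u l) x.

(** M is the part of the estimate that does not involve the pole. The density Z is handed over with
    its equation and stays opaque in the later arithmetic. *)
Lemma energy_bound (r0 : R) : exists M, exists2 Z : R * R -> R, intg (fun x => \1_(box r0) x * Z x) &
  I2 (fun x => \1_(box r0) x * Z x) = M /\
  forall x, Z x = 1 + \sum_l v l x ^+ 2 + \sum_k \sum_l w k l x ^+ 2.
Proof.
pose Z x := 1 + \sum_l v l x ^+ 2 + \sum_k \sum_l w k l x ^+ 2.
exists (I2 (fun x => \1_(box r0) x * Z x)), Z => //.
have L2w k l : L2loc_real (w k l).
  apply: L2loc_sub => //; apply: L2loc_continuous => x.
  exact: (Cn_on_cont (Cn_on_partial k (C2u l)) (x := x)).
have i1 : intg (fun x => \1_(box r0) x * (1 : R) ^+ 2).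
  by apply: (@intg_box_sqr R (fun=> 1)); apply: L2loc_continuous => x; exact: cvg_cst.
have i2 := intg_sum (fun l => intg_box_sqr r0 (L2v l)).
have i3 := intg_sum (fun k => intg_sum (fun l => intg_box_sqr r0 (L2w k l))).
have := intgD (intgD i1 i2) i3.
congr intg; apply/funext => x; rewrite /Z expr1n !mulrDr !mulr_sumr; congr (_ + _).
by apply: eq_bigr => k _; rewrite mulr_sumr.
Qed.

Theorem stress_jump_vanishes : 0 < r -> c ^+ 2 + s ^+ 2 = 1 -> 0 <= L ->
  (forall t t', `|phi t - phi t'| <= L * `|t - t'|) -> phi 0 = 0 -> mp != mm ->
  (forall sg, 0 < sg -> exists2 d, 0 < d & forall t, 0 <= t <= d ->
     `|phi t - mp * t| <= sg * t /\ `|phi (- t) + mm * t| <= sg * t) ->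
  (forall x, disk x0 r x -> Dc x <-> phi (frame x0 c s x).1 <= (frame x0 c s x).2) ->
  forall i j, \sum_k \sum_l (Ct x0 i j k l - C0 i j k l) * partial k (u l) x0 = 0.
Proof.
move=> r0 cs1 L0 lip p0 mpm slopes DcP i0 j0; apply/eqP/negPn/negP => A0.
pose A i j := \sum_k \sum_l (Ct x0 i j k l - C0 i j k l) * partial k (u l) x0.
have lp t : `|phi t| <= L * `|t| by have := lip t 0; rewrite p0 !subr0.
have [|tau [p [q [tau_im S1 S2 Aq Ab0]]]] := test_field_exists major minor cell_gt0 elliptic (A := A).
  by exists i0, j0.
pose z0 := c%:C - s%:C * tau; pose z1 := s%:C + c%:C * tau.
(* The rotation preserves the determinant of the pair, which is Im tau. *)
have zz : Im (z1 * conjc z0) != 0.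
  suff -> : Im (z1 * conjc z0) = Im tau by [].
  rewrite /z0 /z1; case: (tau) => t1 t2 /=; rewrite -[RHS]mul1r -cs1; ring.
have z10 : z1 != 0 by apply: contraNneq zz => ->; rewrite mul0r.
have [beta [d d0 main]] := corner_integral zz L0 lip p0 mpm slopes.
set b0 := \sum_i \sum_j _ in Ab0.
(* The complex factor that turns the constant b0 of the chosen field into beta z1, the one for which
   the corner integral is bounded below. *)
pose th := beta * z1 / b0.
have [T1 [T2 [T3 T4]]] := Phi_scale tau th p q.
pose p' i := th * p i; pose q' i := th * q i.
have S1' l : \sum_i \sum_j \sum_k (Ct x0 i j k l)%:C * (q' i * zc tau j * zc tau k) = 0.
  by rewrite T1 S1 mulr0.
have S2' l : \sum_i \sum_j \sum_k (Ct x0 i j k l)%:C *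
     (p' i * zc tau j * zc tau k - q' i * (nc j * zc tau k + zc tau j * nc k)) = 0.
  by rewrite T2 S2 mulr0.
have Aq' : \sum_i \sum_j (A i j)%:C * (q' i * zc tau j) = 0 by rewrite T3 Aq mulr0.
have Ab' : \sum_i \sum_j (A i j)%:C * (q' i * nc j - p' i * zc tau j) = beta * z1.
  by rewrite T4 -/b0 /th divfK.
have Dgraph x : disk x0 r x -> Dc x -> phi (frame x0 c s x).1 <= (frame x0 c s x).2 by move=> /DcP ->.
have [K1 K10 bound] := @corner_pointwise_bound R u v G C Ct C0 rho kappa Dc x0 r c s L phi tau p' q' (beta * z1)
  tau_im r0 cs1 L0 lp Dgraph C2u C1_Ct C_in rho_bounded S1' S2' Aq' Ab'.
(* Frame coordinates of size at most H give |x - x0| <= r / 2, where the disk cut-off is 1. The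
   choice delta (L + 2) <= H keeps the graph below H over the strip. *)
pose H := r / 4; have H0 : 0 < H by rewrite divr_gt0.
pose delta := Num.min d (H / (L + 2)).
have L2 : 0 < L + 2 by rewrite ltr_wpDl.
have de0 : 0 < delta by rewrite lt_min d0 divr_gt0.
have ded : delta <= d by rewrite ge_min lexx.
have deH : delta * (L + 2) <= H by rewrite -ler_pdivlMr // ge_min lexx orbT.
have deL : L * delta < H by move: de0 deH L0 => *; nra.
have deH' : delta <= H by move: de0 deH L0 => *; nra.
have pH t : `|t| <= delta -> phi t < H.
  move=> td; apply: le_lt_trans (ler_norm _) _; apply: le_lt_trans (lp t) _.
  by apply: le_lt_trans deL; rewrite ler_wpM2l.
have [K2 HK2] := main delta H ltac:(by rewrite de0) pH.
pose r1 := `|x0.1| + `|x0.2| + r.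
have [M [Z iZ [ZM ZE]]] := energy_bound r1.
pose Q e y := Re (beta * z1 * (linf z0 z1 (y.1, y.2 + e))^-1 ^+ 2).
pose S := strip delta H phi.
(* The pointwise inequality to be integrated, with K3 independent of e. In the strip it is the error
   bound with Young's inequality; in the rest of [Dc] inside the disk the kernel is bounded;
   elsewhere the test fields or the indicators vanish. *)
have [K3 pw] : exists K3, forall e, 0 < e -> forall x,
    \1_S (frame x0 c s x) * Q e (frame x0 c s x) <=
    - (\1_Dc x * transmission_integrand u v G C C0 rho kappa
         (psi_field x0 r c s L e tau p' q') (F_field x0 r c s L e tau p' q' (Ct x0)) x) +
    8^-1 * (\1_S (frame x0 c s x) * skernel L e (frame x0 c s x) ^+ 2) + K3 * (\1_(box r1) x * Z x).
  have [M' M'0 HM'] := linf_lower zz.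
  pose nb := Normc.normc (beta * z1); have nb0 : 0 <= nb := normc_ge0 _.
  pose K4 := nb * (M' * (L + 1) / delta) ^+ 2.
  have K40 : 0 <= K4 by rewrite mulr_ge0 // sqr_ge0.
  have K1d : 0 <= K1 / delta by rewrite divr_ge0 // ltW.
  exists (14 * K1 ^+ 2 + K4 + 7 * (K1 / delta)) => e e0 x.
  have K1s := sqr_ge0 K1.
  set y := frame x0 c s x; pose k := skernel L e y; rewrite -/k.
  pose Mx := 1 + \sum_l `|v l x| + \sum_m \sum_l `|w m l x|.
  have Z1 : 1 <= Z x.
    rewrite ZE -addrA lerDl addr_ge0 //; apply: sumr_ge0 => m _; first exact: sqr_ge0.
    by apply: sumr_ge0 => l _; exact: sqr_ge0.
  have SE : S y -> disk x0 r x /\ disk_cut x0 r x = 1.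
    move=> [y1 y2 y3].
    have a1 : `|y.1| <= H by exact: le_trans deH'.
    have a2 : `|y.2| <= H.
      have := lp y.1; rewrite !ler_norml => /andP[h1 _]; apply/andP; split => //.
      have h2 : L * `|y.1| <= L * delta by rewrite ler_wpM2l.
      by apply: le_trans (le_trans h1 y2); rewrite lerN2 (le_trans h2) // ltW.
    have en : enorm (x - x0) <= 2 * H.
      rewrite -(enorm_frame x0 cs1) -/y; apply: le_trans (enorm_le_sum y) _.
      by rewrite mulr_natl mulr2n lerD.
    split; first by apply: le_lt_trans en _; exact: half_arith.
    apply: disk_cut1 => //; rewrite -enorm_sqn.
    have : enorm (x - x0) ^+ 2 <= (2 * H) ^+ 2 by rewrite lerXn2r ?nnegrE ?sqrtr_ge0 // mulr_ge0 // ltW.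
    exact: quarter_arith.
  have Zbox : disk x0 r x -> \1_(box r1) x * Z x = Z x.
    move=> dx; rewrite indicE mem_set ?mul1r //.
    exact: disk_sub_box.
  have K3Z : 0 <= (14 * K1 ^+ 2 + K4 + 7 * (K1 / delta)) * (\1_(box r1) x * Z x).
    rewrite !mulr_ge0 //; first by rewrite !addr_ge0 // mulr_ge0.
    by rewrite (le_trans ler01).
  have [Dx|nD] := pselect (Dc x); last first.
    rewrite [X in - (X * _)]indicE memNset // mul0r oppr0 add0r.
    have nS : ~ S y by move=> Sy; have [dx _] := SE Sy; apply: nD; apply/(DcP x dx); case: Sy.
    by rewrite !indicE memNset // !mul0r mulr0 add0r.
  rewrite [X in - (X * _)]indicE mem_set // mul1r.
  set T := transmission_integrand _ _ _ _ _ _ _ _ _ _.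
  have [dx|ndx] := pselect (disk x0 r x); last first.
    have nS : ~ S y by move=> /SE[dx _].
    have far : r <= enorm (x - x0) by rewrite leNgt; apply/negP.
    have -> : T = 0.
      rewrite /T /transmission_integrand big1 ?add0r => [|i _].
        apply: big1 => m _; apply: big1 => l _.
        have [P1 P2] := F_field_far c s L e tau p' q' (Ct x0) r0 m l far.
        by rewrite P1 P2 !mul0r addr0.
      have [P1 P2] := psi_field_far c s L e tau p' q' r0 i far.
      rewrite P1 !mulr0 !mul0r subr0 addr0 !big1 ?oppr0 ?addr0 // => m _; apply: big1 => o _; apply: big1 => l _.
        by rewrite P2 mulr0 mul0r.
      by rewrite P2 mulr0 mul0r.
    by rewrite !indicE memNset // !mul0r mulr0 oppr0 !add0r.
  have yge := Dgraph x dx Dx; rewrite -/y in yge.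
  have := bound e e0 x Dx dx; rewrite -/y -/T -/Mx -/k -/(Q e y) => B.
  rewrite Zbox // in K3Z *.
  have Mx7 : Mx <= 7 * Z x by rewrite ZE; exact: field_le.
  have [Sy|nS] := pselect (S y).
    have [_ eta1] := SE Sy; rewrite eta1 in B.
    rewrite indicE mem_set // !mul1r -[14 * K1 ^+ 2 + K4 + _]addrA.
    apply: inside_arith B _ _; first by rewrite ZE; exact: field_young.
    have K7 : 0 <= 7 * (K1 / delta) by exact: mulr_ge0.
    by apply: mulr_ge0; [exact: addr_ge0|exact: le_trans Z1].
  rewrite indicE memNset // !mul0r mulr0 addr0 addrC subr_ge0.
  have y10 : 0 <= `|y.1| by [].
  have yL : - (L * `|y.1|) <= y.2.
    by apply: le_trans yge; have := lp y.1; rewrite ler_norml => /andP[].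
  pose N := y.2 + (L + 1) * `|y.1| + e.
  have [N1 _ _ _] := kernel_estimates cs1 L0 e0 yL; rewrite -/y -/N in N1.
  (* Above the graph but off the strip, either |y.1| > delta or y.2 > H >= delta. *)
  have Nd : delta <= N.
    have [y1|y1] := ltP delta `|y.1|; first by apply: le_trans N1; rewrite -[delta]addr0 lerD // ltW.
    have [y2|y2] := ltP H y.2; last by case: nS.
    apply: le_trans deH' _; apply: (le_trans (ltW y2)).
    by rewrite /N -addrA lerDl addr_ge0 ?mulr_ge0 ?addr_ge0 // ltW.
  have N0 : 0 < N by exact: lt_le_trans Nd.
  have kd : 0 <= k <= delta^-1.
    by rewrite /k /skernel -/N invr_ge0 (ltW N0) /= lef_pV2.
  apply: (outside_arith B) => //.
  - by rewrite /disk_cut step_ge0 step_le1.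
  - rewrite /K4 /Q; apply: le_trans (Re_le_normc _) _; rewrite Normc.normcM -/nb ler_wpM2l // normc_pow Normc.normcV.
    have lw := HM' (y.1, y.2 + e); rewrite /= in lw.
    have wN : N <= (L + 1) * (M' * Normc.normc (linf z0 z1 (y.1, y.2 + e))).
      apply: (@le_trans _ _ ((L + 1) * (`|y.1| + `|y.2 + e|))); last by rewrite ler_wpM2l // addr_ge0.
      exact: frame_arith.
    have w0 : 0 < Normc.normc (linf z0 z1 (y.1, y.2 + e)).
      rewrite -(pmulr_rgt0 _ M'0) -(pmulr_rgt0 _ (_ : 0 < L + 1)); first exact: lt_le_trans wN.
      by rewrite ltr_wpDl.
    rewrite lerXn2r ?nnegrE ?invr_ge0 ?(ltW w0) //; first by rewrite divr_ge0 ?(ltW de0) // mulr_ge0 ?(ltW M'0) // addr_ge0.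
    rewrite ler_pdivlMr // mulrC ler_pdivrMr //; apply: le_trans Nd _.
    by apply: le_trans wN _; rewrite mulrA [_ * M']mulrC.
  - by rewrite /Mx -addrA addr_ge0 // addr_ge0 //; apply: sumr_ge0 => m _ //; apply: sumr_ge0.
  - by rewrite mulr_ge0.
(* Integration of [pw]: the transmission term drops out, the frame preserves the measure, and the
   kernel integral is absorbed as in [log_arith]. *)
have key e : 0 < e -> (ln (delta + e) - ln e) / 4 <= K2 + K3 * M.
  move=> e0.
  have [k1 k2] := skernel_integral L0 lip p0 de0 pH e0.
  have m1 := HK2 e e0.
  have iQ := corner_integrable (beta * z1) delta H zz L0 lip p0 e0.
  have [iQf EQ] := I2_frame x0 cs1 iQ.
  have [ikf Ek] := I2_frame x0 cs1 k1.
  have tpsi i := psi_field_test x0 c s p' q' tau_im r0 L0 e0 i.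
  have tF k l := F_field_test x0 c s p' q' (Ct x0) tau_im r0 L0 e0 k l.
  have [iT T0] := transmission_identity closed_Dc L2v L2G C2u coefC coef_rho C_out rho_out v_out weakG weak_eq classical_eq tpsi tF.
  have imT := intgZ (-1) iT; have iks := intgZ 8^-1 ikf; have iKZ := intgZ K3 iZ.
  have le1 := I2_le iQf (intgD (intgD imT iks) iKZ).
  have : I2 (fun x => \1_S (frame x0 c s x) * Q e (frame x0 c s x)) <= 8^-1 * I2 (fun y => \1_S y * skernel L e y ^+ 2) + K3 * M.
    apply: le_trans (le1 _) _; first by move=> x; rewrite mulN1r; exact: pw.
    by rewrite (I2D (intgD imT iks) iKZ) (I2D imT iks) !I2Z // T0 mulr0 add0r Ek ZM.
  rewrite EQ => le2.
  exact: log_arith (le_trans m1 le2) k2.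
(* With e = exp (- t), - ln e is t, chosen so large that [key] fails. *)
pose t := Num.max 0 (4 * (K2 + K3 * M) - ln delta + 1).
have t0 : 0 <= t by rewrite le_max lexx.
have tt : 4 * (K2 + K3 * M) - ln delta + 1 <= t by rewrite le_max lexx orbT.
have e0 : 0 < expR (- t) :> R by exact: expR_gt0.
have := key _ e0; rewrite expRK opprK => h.
have : ln delta <= ln (delta + expR (- t)) by rewrite ler_ln ?posrE ?addr_gt0 // lerDl ltW.
exact: log_unbounded h tt.
Qed.

End CornerArgument.

(** * Reduction to real fields *)

#[local] Existing Instance ae_mu2_filter.

Section Reduction.
Context {R : realType}.
Local Notation Re := complex.Re.
Local Notation Im := complex.Im.
Local Notation P := (measurableTypeR R * measurableTypeR R)%type.

Lemma coef_add (f g : R * R -> R) : coef f -> coef g -> coef (fun x => f x + g x).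
Proof.
move=> [mf bf] [mg bg]; split; first exact: measurable_funD.
move=> r; have [K K0 HK] := bf r; have [M M0 HM] := bg r; exists (K + M); first exact: addr_ge0.
by move=> x bx; apply: le_trans (ler_normD _ _) _; apply: lerD; [exact: HK|exact: HM].
Qed.

Variables (D : set (R * R)) (kappa lambda mu : R) (rho : R * R -> R) (C Ct : tensor_field R) (x0 : R * R).
Local Notation C0 := (isotropic_tensor lambda mu).
Hypothesis D_open : open D.
Hypothesis D_lipschitz : lipschitz_boundary D.
Hypothesis D_piecewise_C1 : piecewise_C1_boundary D.
Hypothesis rho_density : density D rho.
Hypothesis C_elastic : elastic_tensor D C Ct C0.
Hypothesis x0_bdry : bdry D x0.
Hypothesis bdry_not_C1 : ~ C1_boundary_near D x0.
Variables uinc usc : vector_field R.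
Hypothesis u_incident : incident_wave C0 kappa uinc.
Hypothesis u_scattered : forall i, H1loc (usc i).
Hypothesis u_weak : weak_solution C rho kappa (fun i x => uinc i x + usc i x).
Hypothesis usc_out : {ae mu2, forall x, ~ closure D x -> forall i, usc i x = 0}.

(** The density is bounded only almost everywhere on D, while coefficients are asked to be bounded
    at every point. Truncation at M1 changes it on a null set; M1 >= 1 preserves the value 1 outside
    D. *)
Lemma bounded_density : exists rho', [/\ coef rho', exists M, forall x, `|rho' x| <= M,
  forall x, ~ D x -> rho' x = 1 & {ae mu2, forall x, rho' x = rho x}].
Proof.
have [mr [M HM] _ r1] := rho_density.
pose M1 := Num.max 1 M.
have M11 : 1 <= M1 by rewrite le_max lexx.
pose rho' x := Num.min (Num.max (rho x) (- M1)) M1.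
have bd x : `|rho' x| <= M1.
  rewrite /rho' ler_norml ge_min lexx orbT andbT le_min le_max lexx orbT /=; lra.
have id x : `|rho x| <= M1 -> rho' x = rho x.
  by rewrite ler_norml => /andP[h1 h2]; rewrite /rho' max_l // min_l.
exists rho'; split.
- split; last by move=> r; exists M1; [lra|move=> x _; exact: bd].
  by apply: measurable_minr => //; apply: measurable_maxr.
- by exists M1.
- by move=> x nD; rewrite id r1 // normr1.
apply: filterS HM => x HM; have [Dx|nD] := pselect (D x).
  by apply: id; apply: le_trans (HM Dx) _; rewrite le_max lexx orbT.
by rewrite id // r1 // normr1.
Qed.

Section Part.
Variable pr : R[i] -> R.
Hypothesis pr0 : pr 0 = 0.
Hypothesis prD : forall a b, pr (a + b) = pr a + pr b.
Hypothesis prM : forall (a : R) b, pr (a%:C * b) = a * pr b.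
Hypothesis prN : forall a, pr (- a) = - pr a.
Hypothesis pr_partial : forall i f x, pr (cpartial i f x) = partial i (fun y => pr (f y)) x.
Hypothesis pr_int : forall f, pr (cint f) = I2 (fun x => pr (f x)).
Hypothesis pr_C2 : forall f, cCn_on 2 setT f -> Cn_on 2 setT (fun x => pr (f x)).
Hypothesis pr_L2 : forall f, L2loc f -> L2loc_real (fun x => pr (f x)).

Let pr_sum n (h : 'I_n -> R[i]) : pr (\sum_(i < n) h i) = \sum_(i < n) pr (h i).
Proof.
elim: n h => [|n IH] h; first by rewrite !big_ord0.
by rewrite !big_ord_recl prD IH.
Qed.

(** Tensor, density and test functions are real, so the equations split into real and imaginary
    parts. [pr] stands for either of them, known only through linearity and compatibility with
    derivatives and integrals. *)
Lemma stress_jump_part i j : \sum_k \sum_l (Ct x0 i j k l - C0 i j k l) * partial k (fun x => pr (uinc l x)) x0 = 0.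
Proof.
have [C2u eqn] := u_incident; have [G [HG weq]] := u_weak.
have [Csym [cell cell0 Cell] Csm Cin Cout] := C_elastic.
have [rho' [crho brho rho1 rhoE]] := bounded_density.
have clx0 : closure D x0 by case: x0_bdry.
have [r [c [s [L [mp [mm [phi [[r0 cs1 L0 lip p0] [mpm slopes DcP]]]]]]]]] :=
  corner_frame D_open D_lipschitz D_piecewise_C1 x0_bdry bdry_not_C1.
have mrho : measurable_fun [set: P] (rho : P -> R) by case: rho_density.
have cCt a b k l : continuous (fun x => Ct x a b k l).
  by move=> x; exact: (Cn_on_cont (Csm a b k l 0%N) (x := x)).
pose u l x := pr (uinc l x); pose v l x := pr (usc l x); pose Gr k l x := pr (G k l x).
have Lv l : L2loc_real (v l) by apply: pr_L2; case: (u_scattered l).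
have LG k l : L2loc_real (Gr k l) by apply: pr_L2; case: (HG k l).
have C2 l : Cn_on 2 setT (u l) by apply: pr_C2; exact: C2u.
have Lu l : L2loc_real (u l) by apply: L2loc_continuous => x; exact: (Cn_on_cont (C2 l) (x := x)).
apply: (@stress_jump_vanishes R u v Gr C Ct C0 rho' kappa (closure D) _ Lv LG C2 _ crho brho Cout Cin _ _ _ _ _ _
  x0 r c s L mp mm cell phi _ _ cell0 _ r0 cs1 L0 lip p0 mpm slopes DcP).
- exact: closed_closure.
- move=> a b k l.
  (* C jumps across the boundary, but it is a constant plus an indicator times a continuous
     function, hence measurable and locally bounded. *)
  have -> : (fun x => C x a b k l) = (fun x => C0 a b k l + \1_(closure D) x * (Ct x a b k l - C0 a b k l)).
    apply/funext => x; have [Dx|nD] := pselect (closure D x).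
      by rewrite indicE mem_set // mul1r Cin // addrC subrK.
    by rewrite indicE memNset // mul0r addr0 Cout.
  apply: coef_add; first exact: coef_cst.
  apply: coef_mul.
    apply: coef_indic; rewrite -[X in measurable X]setCK; apply: measurableC; apply: open_measurable2.
    by apply: closed_openC; exact: closed_closure.
  by apply: coef_cont => x; apply: cvgB; [exact: cCt|exact: cvg_cst].
- by move=> a b k l; exact: Csm.
- by move=> x nx; apply: rho1 => Dx; apply: nx; exact: subset_closure.
- by apply: filterS usc_out => x h nx l; rewrite /v h.
- move=> k l f tf; have [_ wk] := HG k l; have := wk f tf => /(congr1 pr).
  rewrite prN !pr_int; under [in X in X = _ -> _]eq_fun do rewrite prM prD.
  by under [in X in _ = - X -> _]eq_fun do rewrite prM.
- move=> a f tf; have := weq a f tf => /(congr1 pr).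
  rewrite pr0 prD prN !pr_int.
  have -> : (fun x => pr (\sum_j0 \sum_k \sum_l (C x a j0 k l * partial j0 f x)%:C * G k l x)) =
     (fun x => \sum_j0 \sum_k \sum_l C x a j0 k l * partial j0 f x * Gr k l x).
    apply/funext => x; rewrite pr_sum; apply: eq_bigr => j0 _; rewrite pr_sum; apply: eq_bigr => k _.
    by rewrite pr_sum; apply: eq_bigr => l _; rewrite prM.
  move=> E; rewrite -[RHS]E; congr (_ + _).
  have i1 : intg (fun x => kappa ^+ 2 * rho' x * f x * (u a x + v a x)).
    apply: (@intg_test R (fun x => kappa ^+ 2 * rho' x) f) => //.
      by apply: coef_mul => //; exact: coef_cst.
    exact: L2loc_add.
  (* The truncated density is exchanged for the given one, equal to it almost everywhere. *)
  have [||_ ->] := @I2_ae R _ (fun x => pr ((kappa ^+ 2 * rho x * f x)%:C * (uinc a x + usc a x))) i1 => //.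
    have -> : (fun x => pr ((kappa ^+ 2 * rho x * f x)%:C * (uinc a x + usc a x))) =
       (fun x => kappa ^+ 2 * rho x * f x * (u a x + v a x)).
      by apply/funext => x; rewrite prM prD.
    apply: measurable_funM; last by have [] := L2loc_add (Lu a) (Lv a).
    apply: measurable_funM; last by apply: continuous_measurable2; exact: test_cont.
    by apply: measurable_funM => //; exact: measurable_cst.
  by apply: filterS rhoE => x ->; rewrite prM prD.
- move=> a x; have := eqn a x => /(congr1 pr); rewrite pr0 prD prM => E; rewrite -[RHS]E; congr (_ + _).
  rewrite /elastic_op pr_sum; apply: eq_bigr => j0 _; rewrite pr_sum; apply: eq_bigr => k _.
  rewrite pr_sum; apply: eq_bigr => l _; rewrite pr_partial; congr (partial _ _ _).
  by apply/funext => y; rewrite prM pr_partial.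
- by move=> a b k l; rewrite -Cin //; case: (Csym x0 a b k l).
- by move=> a b k l; rewrite -Cin //; case: (Csym x0 a b k l).
- by move=> M sM; rewrite -Cin //; case/andP: (Cell x0 M sM).
Qed.

End Part.

Lemma stress_jump_re i j : \sum_k \sum_l (Ct x0 i j k l - C0 i j k l) * partial k (cRe (uinc l)) x0 = 0.
Proof.
refine (@stress_jump_part (@complex.Re R) _ _ _ _ _ _ _ _ i j) => //.
- exact: ReD.
- exact: ReMr.
- exact: ReN.
- exact: (fun f h => proj1 h).
- exact: (fun f h => proj1 h).
Qed.

Lemma stress_jump_im i j : \sum_k \sum_l (Ct x0 i j k l - C0 i j k l) * partial k (cIm (uinc l)) x0 = 0.
Proof.
refine (@stress_jump_part (@complex.Im R) _ _ _ _ _ _ _ _ i j) => //.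
- exact: ImD.
- exact: ImMr.
- exact: ImN.
- exact: (fun f h => proj2 h).
- exact: (fun f h => proj2 h).
Qed.

(** In its frame the normal is a normalised vector; where there is none, the default is 0. Either
    way its coordinates are at most 1. *)
Lemma inward_normal_le x j : `|Defs.coord j (inward_normal D x)| <= 1.
Proof.
have cle n : enorm n <= 1 -> `|Defs.coord j n| <= 1.
  by move=> h; rewrite /Defs.coord; case: ifP => _; apply: le_trans h; [exact: enorm_ge1|exact: enorm_ge2].
rewrite /inward_normal; have [ex|nex] := pselect (exists n, is_inward_normal D x n); last first.
  rewrite xgetPN; last by move=> n hn; apply: nex; exists n.
  by apply: cle; rewrite /enorm /= expr0n addr0 sqrtr0.
have [r [c [s [phi [_ [_ cs1 _] E]]]]] := xgetPex 0 ex; move: (xget _ _) E => n E; apply: cle.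
rewrite -[n]subr0 -(enorm_frame 0 cs1) /frame subr0 E.
set a := derive1 phi 0; have a0 : 0 < 1 + a ^+ 2 by rewrite ltr_wpDr // sqr_ge0.
rewrite /enorm /= -[X in X ^+ 2 + _]/(_ * _) -[X in _ + X ^+ 2]/(_ * _).
rewrite !exprMn -mulrDr sqrrN expr1n exprVn sqr_sqrtr ?(ltW a0) // [a ^+ 2 + 1]addrC mulVf ?gt_eqF //.
by rewrite sqrtr1.
Qed.

(** The stress jump is continuous and, by its real and imaginary parts, zero at x0. The traction
    contracts it with a vector of bounded coordinates, so it tends to 0 whether or not the normals
    converge. *)
Theorem traction_vanishes : traction_tends_to_0 D x0 (fun x i j k l => Ct x i j k l - C0 i j k l) uinc.
Proof.
move=> i; have [C2u _] := u_incident; have [_ _ Csm _ _] := C_elastic.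
pose Sr j x := \sum_k \sum_l (Ct x i j k l - C0 i j k l) * partial k (cRe (uinc l)) x.
pose Si j x := \sum_k \sum_l (Ct x i j k l - C0 i j k l) * partial k (cIm (uinc l)) x.
have C1S (f : 'I_2 -> R * R -> R) j : (forall l, Cn_on 2 setT (f l)) ->
    continuous (fun x => \sum_k \sum_l (Ct x i j k l - C0 i j k l) * partial k (f l) x).
  move=> Cf x; have oT : open [set: R * R] by exact: openT.
  have CT : Cn_on 1 setT (fun x => \sum_k \sum_l (Ct x i j k l - C0 i j k l) * partial k (f l) x).
    apply: (Cn_on_sum oT) => k; apply: (Cn_on_sum oT) => l; apply: (Cn_on_mul oT); last exact: Cn_on_partial.
    by apply: (Cn_on_sub oT); [exact: Csm|exact: Cn_on_cst].
  exact: (Cn_on_cont CT (x := x)).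
have cSr j : continuous (Sr j) by apply: C1S => l; case: (C2u l).
have cSi j : continuous (Si j) by apply: C1S => l; case: (C2u l).
pose bound x := \sum_j (`|Sr j x| + `|Si j x|).
have cb : continuous bound.
  have E : bound = (fun x => (`|Sr 0 x| + `|Si 0 x|) + (`|Sr 1 x| + `|Si 1 x|)) by apply/funext => x; rewrite /bound sum2.
  rewrite E => x; have cn (f : R * R -> R) : continuous f -> {for x, continuous (fun y => `|f y|)}.
    by move=> cf; apply: (@continuous_comp _ _ _ f (fun t => `|t|)); [exact: cf|exact: norm_continuous].
  by apply: cvgD; apply: cvgD; apply: cn.
have b0 : bound x0 = 0.
  by apply: big1 => j _; rewrite /Sr /Si stress_jump_re stress_jump_im normr0 addr0.
have le x : Normc.normc (traction D (fun x i j k l => Ct x i j k l - C0 i j k l) uinc i x) <= bound x.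
  apply: le_trans (normc_le _) _; rewrite /traction Re_sum Im_sum.
  have E j : \sum_k \sum_l (Defs.coord j (inward_normal D x) * (Ct x i j k l - C0 i j k l))%:C * cpartial k (uinc l) x =
      (Defs.coord j (inward_normal D x))%:C * (Sr j x +i* Si j x).
    apply: complex_ext.
      rewrite ReMr /= /Sr mulr_sumr Re_sum; apply: eq_bigr => k _; rewrite mulr_sumr Re_sum.
      by apply: eq_bigr => l _; rewrite ReMr mulrA.
    rewrite ImMr /= /Si mulr_sumr Im_sum; apply: eq_bigr => k _; rewrite mulr_sumr Im_sum.
    by apply: eq_bigr => l _; rewrite ImMr mulrA.
  rewrite /bound big_split /=; apply: lerD; apply: le_trans (ler_norm_sum _ _ _) _; apply: ler_sum => j _; rewrite E.
    by rewrite ReMr normrM -[leRHS]mul1r ler_wpM2r // inward_normal_le.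
  by rewrite ImMr normrM -[leRHS]mul1r ler_wpM2r // inward_normal_le.
apply/cvgrPdist_lt => e e0.
have near_e : \forall x \near x0, bound x < e.
  have := cb x0 => /(_ [set t | t < e]); apply; rewrite b0.
  exact: (open_nbhs_nbhs (conj (@open_lt _ e) e0)).
have within_e := @cvg_within _ (nbhs x0) _ (bdry D `\ x0).
apply: within_e; apply: filterS near_e => x xe.
by rewrite sub0r normrN ger0_norm ?normc_ge0 // (le_lt_trans (le x)).
Qed.

End Reduction.

Theorem theorem1p5 (R : realType) (D : set (R * R)) (kappa lambda mu : R)
    (rho : R * R -> R) (C Ct : tensor_field R)
    (x0 : R * R) (alpha K : R) (Rt : tensor_field R)
    (D_open : open D) (D_bounded : bounded_set D)
    (D_lipschitz : lipschitz_boundary D)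
    (D_simply_connected : simply_connected D)
    (D_piecewise_C1 : piecewise_C1_boundary D)
    (kappa_gt0 : 0 < kappa)
    (mu_gt0 : 0 < mu) (lambda_2mu_gt0 : 0 < lambda + 2 * mu)
    (rho_density : density D rho)
    (C_elastic : elastic_tensor D C Ct (isotropic_tensor lambda mu))
    (x0_bdry : bdry D x0)
    (alpha_gt0 : 0 < alpha) (alpha_lt1 : alpha < 1) (K_gt0 : 0 < K)
    (contrast_bound : exists2 r : R, 0 < r &
       {ae mu2, forall x : R * R, disk x0 r x ->
          `|contrast D kappa rho x| <= K * enorm (x - x0) `^ alpha})
    (Ct_expansion : \forall x \near x0, forall i j k l : 'I_2,
       Ct x i j k l - isotropic_tensor lambda mu i j k l =
       Ct x0 i j k l - isotropic_tensor lambda mu i j k l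
         + Rt (x - x0) i j k l)
    (Rt_bound : \forall y \near (0 : R * R),
       tensor_norm (Rt y) <= K * enorm y `^ alpha)
    (* y = 0 is excluded: there 0 `^ (alpha - 1) = 0 instead of +oo *)
    (Rt_grad_bound : \forall y \near (0 : R * R)^',
       tensor_grad_norm Rt y <= K * enorm y `^ (alpha - 1))
    (bdry_not_C1 : ~ C1_boundary_near D x0) :
  forall uinc : vector_field R,
    incident_wave (isotropic_tensor lambda mu) kappa uinc ->
    ~ traction_tends_to_0 D x0
        (fun x i j k l => Ct x i j k l - isotropic_tensor lambda mu i j k l)
        uinc ->
    scatters D lambda mu kappa C rho uinc.
Proof.
move=> uinc u_incident traction_not_0 [usc [u_H1 u_weak _] usc_out]; apply: traction_not_0.
exact: (traction_vanishes D_open D_lipschitz D_piecewise_C1 rho_density C_elastic x0_bdry bdry_not_C1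
  u_incident u_H1 u_weak usc_out).
Qed.
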